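(* Let $m$ and $n$ be positive integers satisfying $m-\frac{m}{n}>2$, and let $R=\mathbb{Q}[A,B,C,D,T]/I$, where $I$ is the ideal generated by the size two minors of the matrix $$\begin{pmatrix} A^2+T^m & B & D\\ C & A^2 & B^n-D\end{pmatrix}.$$ Let $t$ denote the image of $T$ in $R$. Then the ring $R$ is not of F-pure type, whereas $R/tR$ is of F-regular type.
   Context: All rings are commutative, Noetherian, with identity. Characteristic $p$ notions. Let $S$ be a ring of prime characteristic $p>0$; $q=p^e$ denotes a power of $p$ with $e\ge 0$. For an ideal $J=(x_1,\dots,x_r)$ put $J^{[q]}=(x_1^q,\dots,x_r^q)$. Let $S^\circ$ be the complement of the union of the minimal primes of $S$. The tight closure $J^*$ of $J$ is the set of $x\in S$ for which there exists $c\in S^\circ$ with $cx^q\in J^{[q]}$ for all $q=p^e\gg 0$; $J$ is tightly closed if $J=J^*$. $S$ is weakly F-regular if every ideal of $S$ is tightly closed, and F-regular if every localization of $S$ is weakly F-regular. $S$ is F-pure if the Frobenius homomorphism $F:S\to S$, $x\mapsto x^p$, is pure, i.e., it remains injective after tensoring (over the source copy of $S$) with every $S$-module. Characteristic zero notions. Let $R=K[X_1,\dots,X_r]/I$ be a finitely generated algebra over a field $K$ of characteristic zero. $R$ is of F-regular type (respectively, F-pure type) if there exist a finitely generated $\mathbb{Z}$-algebra $A_0\subseteq K$ and a finitely generated $A_0$-algebra $R_{A_0}=A_0[X_1,\dots,X_r]/I_{A_0}$, free over $A_0$, with $R\cong R_{A_0}\otimes_{A_0}K$, such that for all maximal ideals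 $\mu$ in a Zariski dense subset of $\operatorname{Spec}A_0$, the fiber ring $R_{A_0}\otimes_{A_0}A_0/\mu$ is F-regular (respectively, F-pure). (The dense subset is not required to be open.) *)

(* Defs.v *)
From HB Require Import structures.
From mathcomp Require Import all_boot all_order all_algebra.
From mathcomp Require Import boolp.
From mathcomp Require Import mpoly.

Set Implicit Arguments.
Unset Strict Implicit.
Unset Printing Implicit Defensive.

Import Order.TTheory GRing.Theory Num.Theory.

Local Open Scope ring_scope.
Local Open Scope quotient_scope.

(* Rings are comNzRingType. The library structures idealr and prime_idealr are
   the types of proper ideals and of prime ideals; membership in them is boolean,
   which is no restriction since boolp is available. *)

Section Span.
Variable S : comNzRingType.

Definition in_span (xs : seq S) (x : S) : Prop :=
  exists c : 'I_(size xs) -> S, x = \sum_i c i * xs`_i.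

Lemma in_span0 xs : in_span xs 0.
Proof. by exists (fun=> 0); rewrite big1 // => i _; rewrite mul0r. Qed.

Lemma in_span_lin xs a x y :
  in_span xs x -> in_span xs y -> in_span xs (a * x + y).
Proof.
move=> [c ->] [d ->]; exists (fun i => a * c i + d i).
rewrite mulr_sumr -big_split /=; apply: eq_bigr => i _.
by rewrite mulrDl mulrA.
Qed.

Definition spanp (xs : seq S) (proper_xs : ~ in_span xs 1) : S -> bool :=
  fun x => `[< in_span xs x >].

Lemma span_idealr_closed xs (proper_xs : ~ in_span xs 1) :
  idealr_closed (spanp proper_xs : {pred S}).
Proof.
split=> [||a x y /asboolP hx /asboolP hy].
- by apply/asboolP; exact: in_span0.
- by apply/asboolPn.
- by apply/asboolP; exact: in_span_lin.
Qed.

HB.instance Definition _ xs (proper_xs : ~ in_span xs 1) :=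
  isIdealr.Build S (spanp proper_xs) (span_idealr_closed proper_xs).

Definition span xs (proper_xs : ~ in_span xs 1) : idealr S := spanp proper_xs.

End Span.

Definition quot_map (S : comNzRingType) (I : idealr S) :
  {rmorphism S -> {ideal_quot I}} := \pi_{ideal_quot I}.

(* The ring B, regarded as an A-algebra along f. *)
Definition restrict (A B : comNzRingType) (f : {rmorphism A -> B}) : Type := B.

Section Restriction.
Variables (A B : comNzRingType) (f : {rmorphism A -> B}).
Local Notation restrict := (restrict f).

HB.instance Definition _ := GRing.ComNzRing.copy restrict B.

Definition restrict_scale (a : A) (x : restrict) : restrict := f a * (x : B).

Lemma restrict_scaleA a b x :
  restrict_scale a (restrict_scale b x) = restrict_scale (a * b) x.
Proof. by rewrite /restrict_scale rmorphM mulrA. Qed.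
Lemma restrict_scale1 : left_id 1 restrict_scale.
Proof. by move=> x; rewrite /restrict_scale rmorph1 mul1r. Qed.
Lemma restrict_scaleDr : right_distributive restrict_scale +%R.
Proof. by move=> a x y; rewrite /restrict_scale mulrDr. Qed.
Lemma restrict_scaleDl x : {morph restrict_scale^~ x : a b / a + b}.
Proof. by move=> a b; rewrite /restrict_scale rmorphD mulrDl. Qed.

HB.instance Definition _ := GRing.Zmodule_isLmodule.Build A restrict
  restrict_scaleA restrict_scale1 restrict_scaleDr restrict_scaleDl.

Lemma restrict_scaleAl (a : A) (x y : restrict) : a *: (x * y) = (a *: x) * y.
Proof. exact: mulrA. Qed.

HB.instance Definition _ :=
  GRing.Lmodule_isLalgebra.Build A restrict restrict_scaleAl.
HB.instance Definition _ := GRing.Lalgebra_isComAlgebra.Build A restrict.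

Definition restrict_map : A^o -> restrict := f.

Lemma restrict_map_is_linear : linear restrict_map.
Proof. by move=> a x y; rewrite /restrict_map rmorphD rmorphM. Qed.

HB.instance Definition _ := GRing.isLinear.Build A A^o restrict *:%R restrict_map
  restrict_map_is_linear.

End Restriction.

Definition is_tensor (A : comNzRingType) (M N T : lmodType A)
    (tau : {bilinear M -> N -> T}) : Prop :=
  forall (Z : lmodType A) (beta : {bilinear M -> N -> Z}),
    exists g : {linear T -> Z},
      (forall x y, g (tau x y) = beta x y) /\
      (forall g' : {linear T -> Z}, (forall x y, g' (tau x y) = beta x y) -> g' =1 g).

Definition is_tensor_alg (A : comNzRingType) (B C T : comAlgType A)
    (tau : {bilinear B -> C -> T}) : Prop :=
  [/\ is_tensor tau, tau 1 1 = 1 &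
      forall b c b' c', tau b c * tau b' c' = tau (b * b') (c * c')].

Definition pure (A : comNzRingType) (M N : lmodType A) (phi : {linear M -> N}) : Prop :=
  forall (L T1 T2 : lmodType A)
    (tau1 : {bilinear M -> L -> T1}) (tau2 : {bilinear N -> L -> T2})
    (phiL : {linear T1 -> T2}),
  is_tensor tau1 -> is_tensor tau2 ->
  (forall x l, phiL (tau1 x l) = tau2 (phi x) l) ->
  injective phiL.

Definition free_module (A : comNzRingType) (M : lmodType A) : Prop :=
  exists basis : M -> Prop,
    (forall x : M, exists (s : seq M) (c : M -> A),
       (forall b, b \in s -> basis b) /\ x = \sum_(b <- s) c b *: b) /\
    (forall (s : seq M) (c : M -> A), uniq s -> (forall b, b \in s -> basis b) ->
       \sum_(b <- s) c b *: b = 0 -> forall b, b \in s -> c b = 0).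

Section CharP.
Variables (S : comNzRingType) (p : nat).

Definition minimal_prime (P : prime_idealr S) : Prop :=
  forall Q : prime_idealr S, {subset Q <= P} -> {subset P <= Q}.

Definition off_minimal_primes (c : S) : Prop :=
  forall P : prime_idealr S, minimal_prime P -> c \notin P.

Definition in_frobenius_power (xs : seq S) (e : nat) (y : S) : Prop :=
  in_span [seq x ^+ (p ^ e) | x <- xs] y.

Definition tight_closure (xs : seq S) (x : S) : Prop :=
  exists2 c : S, off_minimal_primes c &
    exists e0 : nat, forall e : nat, (e0 <= e)%N ->
      in_frobenius_power xs e (c * x ^+ (p ^ e)).

(* The rings considered are Noetherian, so every ideal is spanned by a finite
   sequence. *)
Definition weakly_F_regular : Prop :=
  forall (xs : seq S) (x : S), tight_closure xs x <-> in_span xs x.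

Definition F_pure_at (pcharS : p \in [pchar S]) : Prop :=
  pure (restrict_map (pFrobenius_aut pcharS)).

End CharP.

(* [f] exhibits [L] as the localization of [S] at the multiplicative set [W].
   The zero ring, which is the localization when 0 is in [W] and all of whose ideals
   are trivially tightly closed, is not a comNzRingType. *)
Definition is_localization (S L : comNzRingType) (W : S -> Prop)
    (f : {rmorphism S -> L}) : Prop :=
  [/\ W 1 /\ (forall u v, W u -> W v -> W (u * v)),
      forall w, W w -> exists v, f w * v = 1,
      forall s, f s = 0 -> exists2 w, W w & w * s = 0 &
      forall y, exists s w, W w /\ y * f w = f s].

Definition F_regular (S : comNzRingType) : Prop :=
  exists2 p : nat, p \in [pchar S] &
    forall (L : comNzRingType) (W : S -> Prop) (f : {rmorphism S -> L}),
      is_localization W f -> weakly_F_regular L p.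

Definition F_pure (S : comNzRingType) : Prop :=
  exists (p : nat) (pcharS : p \in [pchar S]), F_pure_at pcharS.

Definition fg_Z_algebra (A : comNzRingType) : Prop :=
  exists (k : nat) (a : 'I_k -> A),
    forall x : A, exists P : {mpoly int[k]}, x = mmap intr a P.

Definition maximal_ideal (A : comNzRingType) (mu : idealr A) : Prop :=
  forall J : idealr A, {subset mu <= J} -> {subset J <= mu}.

(* The closed subsets of Spec A are the sets V(J) of primes containing J. *)
Definition zariski_dense (A : comNzRingType) (Sigma : prime_idealr A -> Prop) : Prop :=
  forall J : A -> Prop,
    (forall P, Sigma P -> forall x, J x -> x \in P) ->
    forall (P : prime_idealr A) x, J x -> x \in P.

(* [has_type P pi]: the K-algebra R, presented as a quotient of K[X_1, ..., X_r] by
   the surjection [pi], is of "P type"; K is meant to have characteristic zero. In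
   the fourth clause R is the K-algebra R_{A0} tensored with K over A0, and in the
   last one F is the fiber ring over A0 / mu. *)
Definition has_type (P : comNzRingType -> Prop) (K : fieldType) (r : nat)
    (R : comNzRingType) (pi : {rmorphism {mpoly K[r]} -> R}) : Prop :=
  exists (A0 : comNzRingType) (iota : {rmorphism A0 -> K}) (I0 : idealr {mpoly A0[r]}),
    let structK : {rmorphism K -> R} := pi \o @mpolyC r K in
    let RA0 := restrict (quot_map I0 \o @mpolyC r A0) in
    [/\ injective iota, fg_Z_algebra A0, free_module RA0,
        exists tau : {bilinear RA0 -> restrict iota -> restrict (structK \o iota)},
          is_tensor_alg tau /\ (forall k : K, tau 1 k = structK k) &
        exists Sigma : prime_idealr A0 -> Prop,
          [/\ forall mu, Sigma mu -> maximal_ideal mu, zariski_dense Sigma &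
              forall mu, Sigma mu ->
                exists (F : comAlgType A0)
                  (tau : {bilinear RA0 -> restrict (quot_map mu) -> F}),
                is_tensor_alg tau /\ P F]].

Definition F_regular_type := has_type F_regular.
Definition F_pure_type := has_type F_pure.

Section Ring.
Variables m n : nat.

Local Notation A := ('X_(inord 0) : {mpoly rat[5]}).
Local Notation B := ('X_(inord 1) : {mpoly rat[5]}).
Local Notation C := ('X_(inord 2) : {mpoly rat[5]}).
Local Notation D := ('X_(inord 3) : {mpoly rat[5]}).
Local Notation T := ('X_(inord 4) : {mpoly rat[5]}).

Definition mx : 'M[{mpoly rat[5]}]_(2, 3) :=
  \matrix_(i < 2, j < 3)
    nth 0 (nth [::] [:: [:: A ^+ 2 + T ^+ m; B;      D         ];
                        [:: C;               A ^+ 2; B ^+ n - D]] i) j.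

Definition minors : seq {mpoly rat[5]} := [seq \det (col' j mx) | j : 'I_3].

(* The second row of [mx] vanishes at this point, at which T = 0 too. *)
Definition point (i : 'I_5) : rat := [:: 0; 1; 0; 1; 0]`_i.

Lemma meval_minors x : in_span minors x -> x.@[point] = 0.
Proof.
case=> c ->; rewrite rmorph_sum big1 // => i _ /=; rewrite rmorphM /=.
suff -> : (minors`_i).@[point] = 0 by rewrite mulr0.
have /imageP[j _ ->] : minors`_i \in minors by rewrite mem_nth.
rewrite -det_map_mx (expand_det_row _ (ord_max : 'I_2)) big1 // => k _.
suff -> : map_mx (meval point) (col' j mx) ord_max k = 0 by rewrite mul0r.
rewrite !mxE /=; have: (bump j k < 3)%N := ltn_ord (lift j k).
case: (bump j k) => [|[|[|//]]] _ /=.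
- by rewrite mevalXU /point inordK.
- by rewrite rmorphXn /= mevalXU /point inordK // expr0n.
- by rewrite mevalB rmorphXn /= !mevalXU /point !inordK //= expr1n subrr.
Qed.

Lemma minors_proper : ~ in_span minors 1.
Proof. by move=> /meval_minors; rewrite meval1 => /eqP; rewrite oner_eq0. Qed.

Definition R : comNzRingType := {ideal_quot span minors_proper}.

Definition R_proj : {rmorphism {mpoly rat[5]} -> R} := quot_map (span minors_proper).

Definition t : R := R_proj T.

Lemma t_proper : ~ in_span [:: t] 1.
Proof.
case=> c; rewrite big_ord1 /= => e.
have [f fE] : exists f, c ord0 = R_proj f.
  by exists (repr (c ord0 : {ideal_quot span minors_proper})); exact/esym/reprK.
move: e; rewrite fE /t -rmorphM -(rmorph1 R_proj) => /eqP.
rewrite [_ == _](esym (Quotient.idealrBE _ _ _)) => /asboolP /meval_minors.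
rewrite mevalB meval1 mevalM mevalXU /point inordK //= mulr0 subr0.
by move/eqP; rewrite oner_eq0.
Qed.

Definition R_mod_t : comNzRingType := {ideal_quot span t_proper}.

Definition R_mod_t_proj : {rmorphism {mpoly rat[5]} -> R_mod_t} :=
  quot_map (span t_proper) \o R_proj.

End Ring.

(* Main.v *)
From HB Require Import structures.
From mathcomp Require Import all_boot all_order all_algebra all_field cyclic.
From mathcomp Require Import ring zify boolp mpoly.
Require Import Defs.

Set Implicit Arguments.
Unset Strict Implicit.
Unset Printing Implicit Defensive.

Import Order.TTheory GRing.Theory Num.Theory.

Local Open Scope ring_scope.
Local Open Scope quotient_scope.

(** Write R for the quotient by the minors, a, b, c, d, t for the images of the
    variables, u = a^2 and s = a^2 + t^m.

    Why R is not of F-pure type.  The minors say that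
      u s = b c,   b^n s = d (c + s),   b^(n+1) = d (b + u).
    The element x = b^n t^(m-1) is not in the ideal (a, d), because R/(a, c, d)
    is K[B,T]/(B^(n+1), B^n T^m).  Nevertheless x^q lies in (a^q, d^q) for every
    q = 2mk + 1 with k >= n (frobenius_power_in_ideal2): t^((m-1)q) is a multiple of
    (s - u)^(2k(m-1)), a term u^j s^i of its binomial expansion vanishes modulo
    a^q as soon as j > mk, and the remaining terms still contain so many factors
    s that the three relations turn b^(nq) into a multiple of d^q (monomial_in_ideal2).
    The hypothesis m - m/n > 2 says exactly that there are enough of them.
    In characteristic p prime to 2m some power of p has the form 2mk + 1 with k
    large, and over an F-pure ring x^q in J^[q] implies x in J
    (F_pure_contracted_iter).  So no fiber whose characteristic avoids finitely
    many primes is F-pure, for the obvious integral model.  An arbitrary model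
    over A0 (which embeds in Q) agrees with the obvious one away from finitely
    many primes: the model, being free, embeds in R; multiples of a, b, c, d, t
    lie in it, and so weighted homogeneity of the equations produces elements of
    the fiber that satisfy the same equations; and the coefficient of
    B^n T^(m-1) shows that the corresponding element x of the fiber is not in
    (a, d) (fiber_not_F_pure).  A dense set of maximal ideals avoids any finite
    set of primes.

    Why R/tR is of F-regular type.  Over a field k in which 2 is invertible put,
    in k[x, y], U = x^(2n) - y^(2n), V = x^(2n) + y^(2n) and W = x y, so that
    V^2 = U^2 + 4 W^(2n).  The elements
      A = U V W,  B = - U^4 W^2,  C = - V^4 W^2,  D = (-1)^(n+1) U^(4n+2) / 4
    satisfy the equations of R/tR.  Two facts make this an isomorphism onto a
    direct summand of k[x, y].  On the one hand the equations
      B C = A^4,   B D = B^(n+1) - A^2 D,   C D = A^2 B^n - A^2 D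
    rewrite every polynomial as a combination of the monomials A^i B^j,
    A^i C^(j+1), A^i D^(j+1) (normal_form), and these are independent in k[x, y]
    (normal_free).  On the other hand the image is the ring of elements fixed by
    the substitution x -> y, y -> -x all of whose monomials x^i y^j satisfy
    4n | i - j and (4n+2) | i + j; projecting onto these monomials and averaging
    over the substitution retracts k[x, y] onto it, linearly over the image
    (retract_in_image).  A direct summand of a polynomial ring over a prime field
    is F-regular (F_regular_of_retract).  Since the monomials in the normal form
    do not depend on the base, they form a basis of an integral model over Z
    whose fiber at an odd prime p is the image in F_p[x, y]. *)

(** * An identity in Frobenius powers *)

Definition in_ideal2 (S : comNzRingType) (x y z : S) :=
  exists a b, z = a * x + b * y.

Lemma in_ideal2D (S : comNzRingType) (x y z w : S) :
  in_ideal2 x y z -> in_ideal2 x y w -> in_ideal2 x y (z + w).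
Proof.
by move=> [a [b ->]] [c [d ->]]; exists (a + c), (b + d); ring.
Qed.

Section FrobeniusPowers.
Variables (S : comNzRingType) (n : nat).
Hypothesis n_gt0 : (0 < n)%N.

Section Reduction.
Variables (b c d u s : S) (M : nat).
Hypothesis us : u * s = b * c.
Hypothesis bn_s : b ^+ n * s = d * (c + s).
Hypothesis bn1 : b ^+ n.+1 = d * (b + u).

(** Rewriting b^(n+1) as d b + d u either gains a factor d at the price of n
    factors b, or at the price of n + 1 of them but with a new factor u.  Here
    [delta] counts how many factors b have been lost in this way, so that never
    more than [delta] of the factors u are needed to win them back through
    u s = b c.  Since the power M of u is in the ideal, [w] bounds the losses
    that can ever occur; it is unchanged by the rewriting, and the last
    hypothesis provides the factors s for the final step, in which every d comes
    from b^n s = d (c + s). *)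
Lemma monomial_in_ideal2 (beta E i j delta w : nat) :
  (n * E <= beta + delta)%N -> (delta <= j)%N -> (j < M)%N ->
  (w + j).+1 = (delta + M)%N -> (w < i)%N -> (w <= n * (i - w.+1))%N ->
  in_ideal2 (d ^+ E) (u ^+ M) (u ^+ j * b ^+ beta * s ^+ i).
Proof.
elim/ltn_ind: beta E j delta => beta IH E j delta hE hd hj hw hi hwn.
case: E hE => [|E] hE; first by exists (u ^+ j * b ^+ beta * s ^+ i), 0; ring.
(* Few factors b are left: turn [delta] of the u into b, then use b^n s. *)
have [le_beta|gt_beta] := leqP beta n.
  have hEi : (E.+1 + delta <= i)%N.
    rewrite leqNgt; apply/negP => lt_i.
    have h1 : (i - delta <= E)%N by lia.
    have h2 : (i - w.+1 + 1 <= E)%N by lia.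
    have : (n * (i - w.+1 + 1) <= n * E)%N by rewrite leq_mul2l h2 orbT.
    rewrite mulnDr muln1 => h3; rewrite mulnS in hE; lia.
  exists (u ^+ (j - delta) * s ^+ (i - delta - E.+1) *
          b ^+ (beta + delta - n * E.+1) * c ^+ delta * (c + s) ^+ E.+1), 0.
  have -> : u ^+ j = u ^+ (j - delta) * u ^+ delta by rewrite -exprD subnK.
  have -> : s ^+ i = s ^+ (i - delta - E.+1) * s ^+ E.+1 * s ^+ delta.
    by rewrite -!exprD subnK ?subnK //; lia.
  have hus : u ^+ delta * s ^+ delta = b ^+ delta * c ^+ delta.
    by rewrite -!exprMn us.
  have hb : b ^+ beta * b ^+ delta =
      b ^+ (beta + delta - n * E.+1) * (b ^+ n) ^+ E.+1.
    by rewrite -exprM -!exprD subnK.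
  have hs : (b ^+ n) ^+ E.+1 * s ^+ E.+1 = d ^+ E.+1 * (c + s) ^+ E.+1.
    by rewrite -!exprMn bn_s.
  transitivity (u ^+ (j - delta) * s ^+ (i - delta - E.+1) * s ^+ E.+1 *
      b ^+ beta * (u ^+ delta * s ^+ delta)); first by ring.
  rewrite hus.
  transitivity (u ^+ (j - delta) * s ^+ (i - delta - E.+1) * s ^+ E.+1 *
      c ^+ delta * (b ^+ beta * b ^+ delta)); first by ring.
  rewrite hb.
  transitivity (u ^+ (j - delta) * s ^+ (i - delta - E.+1) *
      c ^+ delta * b ^+ (beta + delta - n * E.+1) *
      ((b ^+ n) ^+ E.+1 * s ^+ E.+1)); first by ring.
  rewrite hs; ring.
have [g hg] : exists g, beta = (g + n.+1)%N by exists (beta - n.+1)%N; lia.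
have -> : u ^+ j * b ^+ beta * s ^+ i =
    d * (u ^+ j * b ^+ g.+1 * s ^+ i) + d * (u ^+ j.+1 * b ^+ g * s ^+ i).
  by rewrite hg exprD bn1 !exprS; ring.
have lift x : in_ideal2 (d ^+ E) (u ^+ M) x -> in_ideal2 (d ^+ E.+1) (u ^+ M) (d * x).
  by move=> [e [f ->]]; exists e, (d * f); rewrite exprS; ring.
rewrite mulnS in hE.
apply: in_ideal2D; apply: lift.
  by apply: (IH g.+1 _ E j delta) => //; lia.
have [hjM|hjM] := ltnP j.+1 M; last first.
  have -> : j.+1 = M by lia.
  by exists 0, (b ^+ g * s ^+ i); ring.
by apply: (IH g _ E j.+1 delta.+1) => //; lia.
Qed.

End Reduction.

(** Only the terms u^i s^(N-i) with i <= mk of (s - u)^N, N = 2k(m-1), matter;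
    for these [monomial_in_ideal2] applies with no loss so far and w = mk - i.  The worst
    case i = 0 requires k(m - 2 - m/n) >= 1. *)
Lemma frobenius_power_in_ideal2 (m k : nat) (a b c d t : S) :
  (0 < m)%N -> (2 * n + m < m * n)%N -> (n <= k)%N ->
  let s := a ^+ 2 + t ^+ m in
  a ^+ 2 * s = b * c ->
  s * (b ^+ n - d) = c * d ->
  b * (b ^+ n - d) = a ^+ 2 * d ->
  let q := (2 * m * k).+1 in
  in_ideal2 (a ^+ q) (d ^+ q) ((b ^+ n * t ^+ m.-1) ^+ q).
Proof.
move=> m_gt0 hmn hk s us sb bb q.
have sE : s = a ^+ 2 + t ^+ m by []; clearbody s.
have bn_s : b ^+ n * s = d * (c + s).
  by transitivity (s * (b ^+ n - d) + d * s); [ring | rewrite sb; ring].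
have bn1 : b ^+ n.+1 = d * (b + a ^+ 2).
  by transitivity (b * (b ^+ n - d) + d * b); [rewrite exprS; ring | rewrite bb; ring].
have m_gt2 : (2 < m)%N.
  rewrite ltnNge; apply/negP => m2.
  have : (m * n <= 2 * n)%N by rewrite leq_mul2r m2 orbT.
  lia.
set N := (2 * k * (m - 1))%N.
have tm : (t ^+ m.-1) ^+ q = t ^+ m.-1 * (s - a ^+ 2) ^+ N.
  have -> : s - a ^+ 2 = t ^+ m by rewrite sE; ring.
  rewrite -!exprM -exprD; congr (_ ^+ _); rewrite /q /N -subn1; lia.
rewrite exprMn tm exprBn !mulr_sumr.
have h0 : in_ideal2 (a ^+ q) (d ^+ q) 0 by exists 0, 0; ring.
elim/big_rec: _ => // i x _ hx; apply: in_ideal2D => //.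
rewrite -mulr_natr; move: (nat_of_ord i) => {}i.
suff [e [f h]] : in_ideal2 (d ^+ q) ((a ^+ 2) ^+ (m * k).+1)
    ((a ^+ 2) ^+ i * b ^+ (n * q) * s ^+ (N - i)).
  pose z := (t ^+ m.-1 * ((-1) ^+ i * 'C(N, i)%:R)); exists (z * f * a), (z * e).
  transitivity (z * ((a ^+ 2) ^+ i * b ^+ (n * q) * s ^+ (N - i))).
    by rewrite /z exprM; ring.
  rewrite h.
  have -> : (a ^+ 2) ^+ (m * k).+1 = a * a ^+ q.
    by rewrite -exprM -exprS; congr (_ ^+ _); rewrite /q; lia.
  ring.
have [hi|hi] := leqP i (m * k); last first.
  exists 0, ((a ^+ 2) ^+ (i - (m * k).+1) * b ^+ (n * q) * s ^+ (N - i)).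
  have -> : (a ^+ 2) ^+ i = (a ^+ 2) ^+ (i - (m * k).+1) * (a ^+ 2) ^+ (m * k).+1.
    by rewrite -exprD subnK.
  ring.
have [m' hm] : exists m', m = m'.+3 by exists (m - 3)%N; lia.
have NE : N = (m * k + k * m'.+1)%N.
  by rewrite /N hm (_ : m'.+3 - 1 = m'.+2)%N; lia.
have k_le : (k + m * k <= n * (k * m'.+1))%N.
  have : (k * (1 + m) <= k * (n * m'.+1))%N.
    rewrite leq_mul2l; apply/orP; right; move: hmn; rewrite hm; lia.
  lia.
have hki : (k * m'.+1 > 0)%N by rewrite muln_gt0; lia.
apply: (@monomial_in_ideal2 b c d (a ^+ 2) s (m * k).+1 us bn_s bn1 _ _ _ _ 0 (m * k - i)) => //.
- lia.
- lia.
- rewrite NE; lia.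
- rewrite NE (_ : m * k + k * m'.+1 - i - (m * k - i).+1 = k * m'.+1 - 1)%N; last lia.
  rewrite mulnBr muln1; lia.
Qed.

End FrobeniusPowers.

(** * Quotient modules and tensor products *)

Section Constructors.
Variables (A : comNzRingType) (M N Z : lmodType A).

Definition mk_linear (f : M -> Z) (fL : linear f) : {linear M -> Z} :=
  HB.pack f (GRing.isLinear.Build A M Z *:%R f fL).

Definition mk_bilinear (f : M -> N -> Z) (fl : forall y, linear (f^~ y))
    (fr : forall x, linear (f x)) : {bilinear M -> N -> Z} :=
  HB.pack f (bilinear_isBilinear.Build A M N Z *:%R *:%R f (fl, fr)).

End Constructors.

Section QuotientModule.
Variables (A : comNzRingType) (M : lmodType A) (U : M -> Prop).

Definition submodule := U 0 /\ forall a x y, U x -> U y -> U (a *: x + y).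

Hypothesis sub_U : submodule.

Definition sub_pred (_ : submodule) : {pred M} := fun x => `[<U x>].

Lemma sub_pred_zmod_closed : zmod_closed (sub_pred sub_U).
Proof.
have [U0 UL] := sub_U; split=> [|x y /asboolP Ux /asboolP Uy]; apply/asboolP => //.
by rewrite addrC -scaleN1r; exact: UL.
Qed.

HB.instance Definition _ := GRing.isZmodClosed.Build M (sub_pred sub_U)
  sub_pred_zmod_closed.

Definition quot_mod : Type := Quotient.quot (sub_pred sub_U : zmodClosed M).
HB.instance Definition _ := GRing.Zmodule.on quot_mod.

Definition quot_proj : {additive M -> quot_mod} :=
  \pi_(Quotient.quot (sub_pred sub_U : zmodClosed M)).

Lemma quot_proj_eq x y : quot_proj x = quot_proj y <-> U (x - y).
Proof.
split=> [/eqP|h].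
  by rewrite [_ == _](esym (Quotient.idealrBE _ _ _)) => /asboolP.
by apply/eqP; rewrite [_ == _](esym (Quotient.idealrBE _ _ _)); apply/asboolP.
Qed.

Lemma quot_projP (y : quot_mod) : exists x, y = quot_proj x.
Proof. by exists (repr (y : Quotient.quot (sub_pred sub_U : zmodClosed M))); exact/esym/reprK. Qed.

Definition quot_scale (a : A) (y : quot_mod) : quot_mod :=
  quot_proj (a *: (repr (y : Quotient.quot (sub_pred sub_U : zmodClosed M)))).

Lemma quot_scaleE a x : quot_scale a (quot_proj x) = quot_proj (a *: x).
Proof.
apply/quot_proj_eq; rewrite -scalerBr -[a *: _]addr0; apply: sub_U.2; last exact: sub_U.1.
by apply/quot_proj_eq; exact: reprK.
Qed.

Lemma quot_scaleA a b x : quot_scale a (quot_scale b x) = quot_scale (a * b) x.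
Proof. by have [x' ->] := quot_projP x; rewrite !quot_scaleE scalerA. Qed.
Lemma quot_scale1 : left_id 1 quot_scale.
Proof. by move=> x; have [x' ->] := quot_projP x; rewrite !quot_scaleE scale1r. Qed.
Lemma quot_scaleDr : right_distributive quot_scale +%R.
Proof.
move=> a x y; have [x' ->] := quot_projP x; have [y' ->] := quot_projP y.
by rewrite -raddfD !quot_scaleE -raddfD scalerDr.
Qed.
Lemma quot_scaleDl x : {morph quot_scale^~ x : a b / a + b}.
Proof.
by move=> a b; have [x' ->] := quot_projP x; rewrite !quot_scaleE -raddfD scalerDl.
Qed.

HB.instance Definition _ := GRing.Zmodule_isLmodule.Build A quot_mod
  quot_scaleA quot_scale1 quot_scaleDr quot_scaleDl.

Lemma quot_proj_linear : linear quot_proj.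
Proof. by move=> a x y; rewrite raddfD -quot_scaleE. Qed.

Definition quot_lin : {linear M -> quot_mod} := mk_linear quot_proj_linear.

Lemma quot_lin0 x : quot_lin x = 0 <-> U x.
Proof. by have := quot_proj_eq x 0; rewrite subr0 raddf0. Qed.

End QuotientModule.

Section TensorTheory.
Variables (A : comNzRingType) (M N T : lmodType A) (tau : {bilinear M -> N -> T}).
Hypothesis tensor_tau : is_tensor tau.

(** Two linear maps that agree on pure tensors are equal; compare the projection
    modulo U with the zero map. *)
Lemma tensor_span (U : T -> Prop) :
  submodule U -> (forall x y, U (tau x y)) -> forall z, U z.
Proof.
move=> sub_U Utau z.
pose Q := quot_mod sub_U.
have zL (B : lmodType A) : linear (fun _ : B => 0 : Q) by move=> a x y; rewrite scaler0 addr0.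
pose beta : {bilinear M -> N -> Q} := mk_bilinear (fun=> zL M) (fun=> zL N).
have [g [_ g_uniq]] := tensor_tau beta.
have h1 := g_uniq (quot_lin sub_U) (fun x y => (quot_lin0 sub_U _).2 (Utau x y)).
have h2 := g_uniq (mk_linear (zL T)) (fun x y => erefl).
by apply/(quot_lin0 sub_U); rewrite h1 -h2.
Qed.

End TensorTheory.

(** M (x) A/mu is M / mu M, but only this consequence is needed: x goes to 0 only
    if it lies in every submodule that contains mu M, because M / E is a target
    for a bilinear map when E is such a submodule. *)
Lemma tensor_quot_kernel (A : comNzRingType) (mu : idealr A) (M T : lmodType A)
    (tau : {bilinear M -> restrict (quot_map mu) -> T}) (E : M -> Prop) :
  is_tensor tau -> submodule E -> (forall a x, a \in mu -> E (a *: x)) ->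
  forall x, tau x 1 = 0 -> E x.
Proof.
move=> tensor_tau sub_E muE x tx.
pose Q := quot_mod sub_E.
pose rp (y : restrict (quot_map mu)) : A := repr (y : {ideal_quot mu}).
have rpK y : quot_map mu (rp y) = y by exact: reprK.
have wd a b z : quot_map mu a = quot_map mu b -> quot_lin sub_E (a *: z) = quot_lin sub_E (b *: z).
  move=> /eqP; rewrite [_ == _](esym (Quotient.idealrBE _ _ _)) => hab.
  apply/eqP; rewrite -subr_eq0 -raddfB -scalerBl; apply/eqP/quot_lin0; exact: muE.
pose f z (y : restrict (quot_map mu)) : Q := quot_lin sub_E (rp y *: z).
have fl y : linear (f^~ y).
  by move=> a u v; rewrite /f scalerDr scalerA mulrC -scalerA linearP.
have fr z : linear (f z).
  move=> a u v; rewrite /f -linearZ -raddfD scalerA -scalerDl; apply: wd.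
  by rewrite rmorphD rmorphM !rpK.
have [g [gE _]] := tensor_tau _ (mk_bilinear fl fr).
have := gE x 1; rewrite tx raddf0 /= /f => /esym.
by rewrite (wd _ 1) ?rpK ?rmorph1 // scale1r => /quot_lin0.
Qed.

(** * Quotients by ideals *)

Section IdealQuotient.
Variables (S : comNzRingType) (I : idealr S).

Lemma quot_map_eq x y : quot_map I x = quot_map I y <-> x - y \in I.
Proof.
split=> [/eqP|h]; first by rewrite [_ == _](esym (Quotient.idealrBE _ _ _)).
by apply/eqP; rewrite [_ == _](esym (Quotient.idealrBE _ _ _)).
Qed.

Lemma quot_map_eq0 x : quot_map I x = 0 <-> x \in I.
Proof. by have := quot_map_eq x 0; rewrite subr0 rmorph0. Qed.

Lemma quot_map_surj (y : {ideal_quot I}) : exists x, quot_map I x = y.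
Proof. by exists (repr y); exact: reprK. Qed.

End IdealQuotient.

Section QuotientLift.
Variables (S B : comNzRingType) (I : idealr S) (f : {rmorphism S -> B}).
Hypothesis f_kills : forall x, x \in I -> f x = 0.

(** The ignored argument makes the ring morphism structure, which depends on it,
    inferable from the function. *)
Definition quot_lift_fun (_ : forall x, x \in I -> f x = 0) (y : {ideal_quot I}) : B :=
  f (repr y).

Lemma quot_lift_funE x : quot_lift_fun f_kills (quot_map I x) = f x.
Proof.
apply/eqP; rewrite -subr_eq0 -rmorphB; apply/eqP/f_kills/quot_map_eq; exact: reprK.
Qed.

Lemma quot_lift_zmod : zmod_morphism (quot_lift_fun f_kills).
Proof.
move=> y y'; have [x <-] := quot_map_surj y; have [x' <-] := quot_map_surj y'.
by rewrite -rmorphB !quot_lift_funE rmorphB.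
Qed.
Lemma quot_lift_monoid : monoid_morphism (quot_lift_fun f_kills).
Proof.
split=> [|y y']; first by rewrite -(rmorph1 (quot_map I)) quot_lift_funE rmorph1.
have [x <-] := quot_map_surj y; have [x' <-] := quot_map_surj y'.
by rewrite -rmorphM !quot_lift_funE rmorphM.
Qed.

HB.instance Definition _ :=
  GRing.isZmodMorphism.Build {ideal_quot I} B (quot_lift_fun f_kills) quot_lift_zmod.
HB.instance Definition _ :=
  GRing.isMonoidMorphism.Build {ideal_quot I} B (quot_lift_fun f_kills) quot_lift_monoid.

Definition quot_lift : {rmorphism {ideal_quot I} -> B} := quot_lift_fun f_kills.

Lemma quot_liftE x : quot_lift (quot_map I x) = f x.
Proof. exact: quot_lift_funE. Qed.

Lemma quot_lift_inj : (forall x, f x = 0 -> x \in I) -> injective quot_lift.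
Proof.
move=> ker y y'; have [x <-] := quot_map_surj y; have [x' <-] := quot_map_surj y'.
rewrite !quot_liftE => e; apply/quot_map_eq/ker.
by apply/eqP; rewrite rmorphB subr_eq0 e.
Qed.

End QuotientLift.

Lemma in_spanE (S : comNzRingType) (xs : seq S) (h : ~ in_span xs 1) x :
  x \in (span h : {pred S}) <-> in_span xs x.
Proof. by split=> /asboolP. Qed.


Lemma in_span_cons (S : comNzRingType) (x : S) xs y :
  in_span (x :: xs) y <-> exists a z, in_span xs z /\ y = a * x + z.
Proof.
split=> [[c ->]|[a [z [[c ->] ->]]]].
  exists (c ord0), (\sum_(i < size xs) c (lift ord0 i) * xs`_i).
  by rewrite big_ord_recl; split=> //; exists (fun i => c (lift ord0 i)).
exists (fun i => if unlift ord0 i is Some j then c j else a).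
rewrite [RHS]big_ord_recl unlift_none; congr (_ + _).
by apply: eq_bigr => i _; rewrite liftK.
Qed.

Lemma in_span_ind (S : comNzRingType) (xs : seq S) (P : S -> Prop) :
  P 0 -> (forall a x y, x \in xs -> P y -> P (a * x + y)) ->
  forall y, in_span xs y -> P y.
Proof.
elim: xs P => [|x xs IH] P P0 PD y; first by case=> c ->; rewrite big_ord0.
case/in_span_cons=> a [z [hz ->]]; apply: (PD); first exact: mem_head.
by apply: IH z hz => // b u v uxs Pv; apply: (PD) => //; rewrite inE uxs orbT.
Qed.

Lemma in_span_mem (S : comNzRingType) (xs : seq S) x : x \in xs -> in_span xs x.
Proof.
elim: xs => // z xs IH; rewrite inE => /predU1P[->|/IH h]; apply/in_span_cons.
  by exists 1, 0; split; [exact: in_span0 | rewrite mul1r addr0].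
by exists 0, x; rewrite mul0r add0r.
Qed.

(** * Frobenius powers over an F-pure ring *)

Section Purity.
Variables (S : comNzRingType) (p : nat) (pcharS : p \in [pchar S]).
Local Notation Fr := (pFrobenius_aut pcharS).

Lemma FrE x : Fr x = x ^+ p. Proof. exact: pFrobenius_autE. Qed.

Lemma frobenius_span (xs : seq S) y :
  in_span xs y -> in_span [seq x ^+ p | x <- xs] (y ^+ p).
Proof.
elim/in_span_ind=> {y} [|a x y xxs IH].
  by rewrite -FrE rmorph0; exact: in_span0.
have -> : (a * x + y) ^+ p = a ^+ p * x ^+ p + y ^+ p.
  by rewrite -!FrE rmorphD rmorphM.
by apply: in_span_lin => //; apply: in_span_mem; apply/mapP; exists x.
Qed.

(** Tensor the Frobenius with S/J, where J is spanned by [xs]: the source becomes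
    S/J, the target S/J^[p], and the map sends the class of y to that of y^p.
    Both tensor products are checked against the universal property. *)
Lemma F_pure_contracted (xs : seq S) (y : S) :
  F_pure_at pcharS -> in_span [seq x ^+ p | x <- xs] (y ^+ p) -> in_span xs y.
Proof.
move=> pureS hy.
have [xs1|proper_xs] := EM (in_span xs 1).
  by rewrite -[y]mulr1 -[_ * _]addr0; apply: in_span_lin => //; exact: in_span0.
(* J^[p] is contained in J, hence proper, so that S/J^[p] is a ring. *)
have sub_p z : in_span [seq x ^+ p | x <- xs] z -> in_span xs z.
  elim/in_span_ind=> [|a w v /mapP[x xxs ->] IH]; first exact: in_span0.
  apply: in_span_lin => //; have [p' ->] : exists p', p = p'.+1.
    by exists p.-1; rewrite prednK // prime_gt0 // (pcharf_prime pcharS).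
  by rewrite exprSr -[_ * x]addr0; apply: in_span_lin (in_span_mem xxs) (in_span0 _).
have proper_p : ~ in_span [seq x ^+ p | x <- xs] 1 by move/sub_p.
pose I := span proper_xs; pose Ip := span proper_p.
pose L : lmodType S := restrict (quot_map I).
pose T2 : lmodType S := restrict (quot_map Ip \o Fr).
pose lp (l : L) : S := repr (l : {ideal_quot I}).
have lpK l : quot_map I (lp l) = l by exact: reprK.
have Frwd a b : quot_map I a = quot_map I b -> quot_map Ip (Fr a) = quot_map Ip (Fr b).
  move=> /quot_map_eq/in_spanE h; apply/quot_map_eq/in_spanE.
  by rewrite -rmorphB /= FrE; exact: frobenius_span.
pose f1 (x : S^o) (l : L) : L := (x : S) *: l.
have f1l l : linear (f1^~ l) by move=> a x z; rewrite /f1 scalerDl scalerA.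
have f1r x : linear (f1 x) by move=> a l z; rewrite /f1 scalerDr !scalerA mulrC.
pose f2 (x : restrict Fr) (l : L) : T2 := quot_map Ip ((x : S) * Fr (lp l)).
have f2l l : linear (f2^~ l).
  move=> a x z; rewrite /f2 mulrDl rmorphD; congr (_ + _).
  by rewrite -mulrA rmorphM.
have f2r x : linear (f2 x).
  move=> a l z; rewrite /f2 !rmorphM.
  have -> : quot_map Ip (Fr (lp (a *: l + z))) =
            quot_map Ip (Fr (a * lp l + lp z)).
    by apply: Frwd; rewrite lpK rmorphD rmorphM !lpK.
  rewrite !rmorphD !rmorphM /= mulrDr mulrCA; congr (_ + _).
pose g (l : L) : T2 := quot_map Ip (Fr (lp l)).
have gL : linear g.
  move=> a l z; rewrite /g.
  have -> : quot_map Ip (Fr (lp (a *: l + z))) =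
            quot_map Ip (Fr (a * lp l + lp z)).
    by apply: Frwd; rewrite lpK rmorphD rmorphM !lpK.
  by rewrite !rmorphD !rmorphM.
have tensor1 : is_tensor (mk_bilinear f1l f1r).
  move=> Z beta; exists (mk_linear (linearPr beta (1 : S^o))); split.
    by move=> x l; rewrite /= /f1 linearZr_LR -linearZl_LR /= [_ *: _]mulr1.
  by move=> g' g'E l; have := g'E 1 l; rewrite /= /f1 scale1r.
have tensor2 : is_tensor (mk_bilinear f2l f2r).
  move=> Z beta.
  pose tp (w : T2) : S := repr (w : {ideal_quot Ip}).
  have tpK w : quot_map Ip (tp w) = w by exact: reprK.
  have lone (s : S) : (s *: (1 : L)) = quot_map I s by exact: mulr1.
  have fr0 z : in_span [seq x ^+ p | x <- xs] z -> beta (z : restrict Fr) 1 = 0.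
    elim/in_span_ind=> [|a w v /mapP[x xxs ->] IH]; first by rewrite linear0l.
    rewrite linearDl IH addr0 mulrC.
    have -> : x ^+ p * a = x *: (a : restrict Fr) by rewrite -FrE.
    rewrite linearZl_LR -linearZr_LR lone.
    have -> : quot_map I x = 0 by apply/quot_map_eq0/in_spanE; exact: in_span_mem.
    by rewrite linear0r.
  have bwd a b : quot_map Ip a = quot_map Ip b ->
      beta (a : restrict Fr) 1 = beta (b : restrict Fr) 1.
    move=> /quot_map_eq/in_spanE h; apply/eqP; rewrite -subr_eq0 -linearBl.
    by apply/eqP; exact: fr0.
  pose h (w : T2) : Z := beta (tp w : restrict Fr) 1.
  have hL : linear h.
    move=> a u v; rewrite /h -linearZl_LR -linearDl; apply: bwd.
    by rewrite tpK rmorphD rmorphM !tpK.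
  exists (mk_linear hL); split.
    move=> x l; rewrite /= /h (bwd _ ((x : S) * Fr (lp l))) ?tpK //.
    have -> : (x : S) * Fr (lp l) = lp l *: (x : restrict Fr) by rewrite mulrC.
    by rewrite linearZl_LR -linearZr_LR lone lpK.
  move=> g' g'E w; rewrite /= /h -(g'E (tp w) 1) /= /f2; congr (g' _).
  rewrite rmorphM (Frwd _ 1) ?lpK ?rmorph1 // mulr1; exact/esym/tpK.
have := pureS L L T2 _ _ (mk_linear gL) tensor1 tensor2.
have compat x l : g (f1 x l) = f2 (restrict_map Fr x) l.
  rewrite /g /f2 /f1 -rmorphM; apply: Frwd; by rewrite rmorphM !lpK.
move=> /(_ compat) g_inj.
have : quot_map I y = 0.
  apply: g_inj; rewrite raddf0 /= /g (Frwd _ y) ?lpK //.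
  by apply/quot_map_eq0/in_spanE; rewrite FrE.
by move/quot_map_eq0/in_spanE.
Qed.

Lemma F_pure_contracted_iter (xs : seq S) (y : S) e :
  F_pure_at pcharS -> in_frobenius_power p xs e (y ^+ (p ^ e)) -> in_span xs y.
Proof.
move=> pureS; elim: e => [|e IH].
  rewrite /in_frobenius_power expn0 expr1.
  by rewrite (eq_map (g := id)) ?map_id // => x; rewrite expr1.
move=> h; apply: IH; apply: F_pure_contracted => //.
rewrite -exprM -expnSr -map_comp.
by rewrite (eq_map (g := fun x => x ^+ (p ^ e.+1))) // => x /=; rewrite -exprM -expnSr.
Qed.

End Purity.

(** * Coordinates in a free module *)

Section FreeModule.
Variables (A : comNzRingType) (M : lmodType A) (basis : M -> Prop).
Hypothesis basis_span : forall x : M, exists (s : seq M) (c : M -> A),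
  (forall b, b \in s -> basis b) /\ x = \sum_(b <- s) c b *: b.
Hypothesis basis_free : forall (s : seq M) (c : M -> A),
  uniq s -> (forall b, b \in s -> basis b) ->
  \sum_(b <- s) c b *: b = 0 -> forall b, b \in s -> c b = 0.

(** The coefficients are extended by 0, so that they depend only on x. *)
Definition coords (x : M) (c : M -> A) := exists s,
  [/\ uniq s, forall b, b \in s -> basis b, forall b, b \notin s -> c b = 0 &
      x = \sum_(b <- s) c b *: b].

Lemma sum_widen (s t : seq M) (c : M -> A) :
  uniq s -> uniq t -> {subset s <= t} -> (forall b, b \notin s -> c b = 0) ->
  \sum_(b <- t) c b *: b = \sum_(b <- s) c b *: b.
Proof.
move=> us ut st cs.
rewrite (bigID (mem s)) /= [X in _ + X]big1 ?addr0 => [|b /cs ->]; last exact: scale0r.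
rewrite -big_filter; apply: perm_big; apply: uniq_perm => // [|b].
  exact: filter_uniq.
by rewrite mem_filter andb_idr //; exact: st.
Qed.

Lemma coords_lin a x y c d :
  coords x c -> coords y d -> coords (a *: x + y) (fun b => a * c b + d b).
Proof.
move=> [s [us sb sc ->]] [t [ut tb tc ->]]; exists (undup (s ++ t)); split.
- exact: undup_uniq.
- by move=> b; rewrite mem_undup mem_cat => /orP[/sb|/tb].
- move=> b; rewrite mem_undup mem_cat => /norP[/sc-> /tc->].
  by rewrite mulr0 addr0.
rewrite -(@sum_widen s (undup (s ++ t))) ?undup_uniq //; last first.
  by move=> b bs; rewrite mem_undup mem_cat bs.
rewrite -(@sum_widen t (undup (s ++ t))) ?undup_uniq //; last first.
  by move=> b bt; rewrite mem_undup mem_cat bt orbT.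
rewrite scaler_sumr -big_split /=; apply: eq_bigr => b _.
by rewrite scalerA scalerDl.
Qed.

Lemma coords0 c : coords 0 c -> forall b, c b = 0.
Proof.
move=> [s [us sb sc e]] b; have [bs|/sc//] := boolP (b \in s).
exact: (basis_free us sb (esym e)).
Qed.

Lemma coords_uniq x c d : coords x c -> coords x d -> c = d.
Proof.
move=> hc hd; apply/funext => b.
have /coords0/(_ b) : coords 0 (fun b => -1 * d b + c b).
  by rewrite -(addNr x) -scaleN1r; exact: coords_lin.
by rewrite mulN1r addrC => /subr0_eq.
Qed.

Lemma coords_ex x : exists c, coords x c.
Proof.
have [s [c [sb ->]]] := basis_span x; elim: s sb => [_|b s IH sb].
  by exists (fun=> 0), [::]; rewrite !big_nil.
have [d hd] : exists d, coords (\sum_(b <- s) c b *: b) d.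
  by apply: IH => b' bs; apply: sb; rewrite inE bs orbT.
have hb : coords b (fun b' => (b' == b)%:R).
  exists [:: b]; split=> // [b'|b'|].
  - by rewrite inE => /eqP->; apply: sb; rewrite mem_head.
  - by rewrite inE => /negPf->.
  - by rewrite big_seq1 eqxx scale1r.
by rewrite big_cons; eexists; exact: coords_lin hb hd.
Qed.

(** A coordinate function with values in A extends to a linear form on the tensor
    product with values in K, so an element that dies has zero coordinates. *)
Lemma tensor_free_inj (K : comNzRingType) (iota : {rmorphism A -> K}) (T : lmodType A)
    (tau : {bilinear M -> restrict iota -> T}) :
  injective iota -> is_tensor tau -> forall x, tau x 1 = 0 -> x = 0.
Proof.
move=> iota_inj tensor_tau x tx.
have [cf cfP] := choice coords_ex.
have cfL a u v b : cf (a *: u + v) b = a * cf u b + cf v b.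
  by rewrite (coords_uniq (cfP _) (coords_lin a (cfP u) (cfP v))).
suff cf0 b : cf x b = 0.
  by have [s [_ _ _ ->]] := cfP x; rewrite big1 // => b _; rewrite cf0 scale0r.
pose f u (k : restrict iota) : restrict iota := iota (cf u b) * (k : K).
have fl k : linear (f^~ k).
  by move=> a u v; rewrite /f cfL rmorphD rmorphM mulrDl -mulrA.
have fr u : linear (f u).
  by move=> a k l; rewrite /f mulrDr; congr (_ + _); exact: mulrCA.
have [g [gE _]] := tensor_tau _ (mk_bilinear fl fr).
have := gE x 1; rewrite tx raddf0 /= /f mulr1 => /esym h.
by apply: iota_inj; rewrite rmorph0.
Qed.

End FreeModule.

(** * The obstruction to F-purity *)

(** Powers of p whose exponent is a multiple of the totient are 1 modulo 2m. *)
Lemma frobenius_exponent (p m n : nat) : prime p -> (0 < m)%N -> ~~ (p %| 2 * m)%N ->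
  exists e k, (n <= k)%N /\ (p ^ e = (2 * m * k).+1)%N.
Proof.
move=> p_pr m_gt0 p_ndvd.
have cop : coprime p (2 * m) by rewrite prime_coprime.
have M_gt0 : (0 < 2 * m)%N by rewrite muln_gt0.
pose e := (totient (2 * m) * (2 * m * n).+1)%N.
have e_ge : ((2 * m * n).+1 <= e)%N by rewrite leq_pmull // totient_gt0.
have pe_gt : (e < p ^ e)%N by apply: ltn_expl; exact: prime_gt1.
have h : (p ^ e = 1 %[mod 2 * m])%N.
  by rewrite /e expnM -modnXm (Euler_exp_totient cop) modnXm exp1n.
have /dvdnP[k hk] : (2 * m %| p ^ e - 1)%N by rewrite -eqn_mod_dvd ?h // expn_gt0 prime_gt0.
have peE : (p ^ e = (2 * m * k).+1)%N by lia.
exists e, k; split=> //; rewrite -(leq_pmul2l M_gt0); lia.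
Qed.

Lemma F_pure_obstruction (F : comNzRingType) (m n : nat) (a b c d t : F) (p : nat)
    (pcharF : p \in [pchar F]) :
  (0 < m)%N -> (0 < n)%N -> (2 * n + m < m * n)%N -> ~~ (p %| 2 * m)%N ->
  a ^+ 2 * (a ^+ 2 + t ^+ m) = b * c ->
  (a ^+ 2 + t ^+ m) * (b ^+ n - d) = c * d ->
  b * (b ^+ n - d) = a ^+ 2 * d ->
  F_pure_at pcharF -> in_ideal2 a d (b ^+ n * t ^+ m.-1).
Proof.
move=> m_gt0 n_gt0 hmn p_ndvd r1 r2 r3 pureF.
have [e [k [hk peE]]] := frobenius_exponent n (pcharf_prime pcharF) m_gt0 p_ndvd.
have [x [y hxy]] := frobenius_power_in_ideal2 n_gt0 m_gt0 hmn hk r1 r2 r3.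
have /in_span_cons[u [z [/in_span_cons[v [w [[c' ->] ->]]] ->]]] :
    in_span [:: a; d] (b ^+ n * t ^+ m.-1).
  apply: (F_pure_contracted_iter pureF (e := e)).
  rewrite peE hxy; apply/in_span_cons; exists x, (y * d ^+ (2 * m * k).+1).
  rewrite -peE; split=> //; apply/in_span_cons; exists y, 0; split; last by rewrite addr0.
  exact: in_span0.
by exists u, v; rewrite big_ord0 addr0.
Qed.

(** * The ideal of minors *)

Lemma mpoly_ring_ind (A : comNzRingType) k (P : {mpoly A[k]} -> Prop) :
  (forall c, P c%:MP) -> (forall i, P 'X_i) ->
  (forall f g, P f -> P g -> P (f + g)) ->
  (forall f g, P f -> P g -> P (f * g)) -> forall f, P f.
Proof.
move=> PC PX PD PM f; rewrite (mpolyE f).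
elim/big_rec: _ => [|mon x _ Px]; first by rewrite -mpolyC0; exact: PC.
apply: (PD) => //; rewrite -mul_mpolyC; apply: (PM) => //.
rewrite mpolyXE_id; elim/big_rec: _ => [|i y _ Py]; first by rewrite -mpolyC1; exact: PC.
apply: (PM) => //; elim: (mon i) => [|j IH]; first by rewrite expr0 -mpolyC1; exact: PC.
by rewrite exprS; apply: (PM).
Qed.

Lemma mpolyC_int k (z : int) : z%:MP = z%:~R :> {mpoly int[k]}.
Proof. by rewrite -{1}[z]intz (rmorph_int (@mpolyC k int)). Qed.

Lemma mpolyZ_rmorph_ext k (B : comNzRingType) (f g : {rmorphism {mpoly int[k]} -> B}) :
  (forall i, f 'X_i = g 'X_i) -> f =1 g.
Proof.
move=> fg; elim/mpoly_ring_ind => [c|//|u v fu fv|u v fu fv].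
- by rewrite mpolyC_int !rmorph_int.
- by rewrite !rmorphD fu fv.
- by rewrite !rmorphM fu fv.
Qed.

Lemma det_mx22 (A : comNzRingType) (M : 'M[A]_2) :
  \det M = M 0 0 * M 1 1 - M 0 1 * M 1 0.
Proof.
rewrite (expand_det_row _ 0) !big_ord_recl big_ord0 addr0 /cofactor !det_mx11 !mxE /=.
rewrite expr0 expr1 mul1r mulN1r mulrN.
by congr (_ * M _ _ - M _ _ * M _ _); apply: val_inj.
Qed.

Section Minors.
Variables m n : nat.
Local Notation XX i := ('X_(inord i) : {mpoly rat[5]}).

Definition minor_rel (B : comNzRingType) (a b c d t : B) : Prop :=
  [/\ a ^+ 2 * (a ^+ 2 + t ^+ m) = b * c,
      (a ^+ 2 + t ^+ m) * (b ^+ n - d) = c * d &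
      b * (b ^+ n - d) = a ^+ 2 * d].

(** The three determinants are the differences of the two sides of the three
    relations. *)
Lemma minors_eq0 (B : comNzRingType) (f : {rmorphism {mpoly rat[5]} -> B}) :
  (forall x, x \in minors m n -> f x = 0) <->
  minor_rel (f (XX 0)) (f (XX 1)) (f (XX 2)) (f (XX 3)) (f (XX 4)).
Proof.
pose dd (j : 'I_3) := f (\det (col' j (mx m n))).
have d0 : dd 0 = f (XX 1) * (f (XX 1) ^+ n - f (XX 3)) - f (XX 3) * f (XX 0) ^+ 2.
  by rewrite /dd det_mx22 !mxE /= !(rmorphB, rmorphM, rmorphD, rmorphXn).
have d1 : dd 1 = (f (XX 0) ^+ 2 + f (XX 4) ^+ m) * (f (XX 1) ^+ n - f (XX 3)) - f (XX 3) * f (XX 2).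
  by rewrite /dd det_mx22 !mxE /= !(rmorphB, rmorphM, rmorphD, rmorphXn).
have d2 : dd (inord 2) = (f (XX 0) ^+ 2 + f (XX 4) ^+ m) * f (XX 0) ^+ 2 - f (XX 1) * f (XX 2).
  by rewrite /dd det_mx22 !mxE /= /bump !inordK //= !(rmorphB, rmorphM, rmorphD, rmorphXn).
split=> [h|[r1 r2 r3] x /imageP[j _ ->]].
  have ddE j : dd j = 0 by apply: h; apply: image_f.
  split; apply/eqP; rewrite -subr_eq0; apply/eqP.
  - by rewrite -[RHS](ddE (inord 2)) d2; ring.
  - by rewrite -[RHS](ddE 1) d1; ring.
  - by rewrite -[RHS](ddE 0) d0; ring.
rewrite -/(dd j).
have [->|->|->] : [\/ j = 0, j = 1 | j = inord 2].
  case: j => [[|[|[|//]]] hj]; [constructor 1 | constructor 2 | constructor 3]; apply: val_inj => //=.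
  by rewrite inordK.
- by rewrite d0 r3; ring.
- by rewrite d1 r2; ring.
- by rewrite d2 mulrC r1; ring.
Qed.

End Minors.

Lemma rmorph_span0 (S B : comNzRingType) (f : {rmorphism S -> B}) xs u :
  (forall x, x \in xs -> f x = 0) -> in_span xs u -> f u = 0.
Proof.
move=> f0; elim/in_span_ind=> [|a x y xxs fy]; first exact: rmorph0.
by rewrite rmorphD rmorphM (f0 x) // mulr0 add0r.
Qed.

Lemma map_intr_mpolyX k (B : comNzRingType) (i : 'I_k) :
  map_mpoly (intr : int -> B) 'X_i = 'X_i.
Proof. exact: map_mpolyX. Qed.

Section Coefficient.
Variables m n : nat.
Hypotheses (m_gt0 : (0 < m)%N) (n_gt0 : (0 < n)%N).
Local Notation XX i := ('X_(inord i) : {mpoly rat[5]}).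

(** The specialization A = C = D = 0, with values in polynomials in B (outer
    variable) over polynomials in T. *)
Definition BT_val (A : comNzRingType) (i : 'I_5) : {poly {poly A}} :=
  [:: 0; 'X; 0; 0; 'X%:P]`_i.

Definition to_BT (A : comNzRingType) : {rmorphism {mpoly A[5]} -> {poly {poly A}}} :=
  mmap (polyC \o @polyC A) (@BT_val A).

Lemma to_BTX (A : comNzRingType) i : (i < 5)%N ->
  to_BT A 'X_(inord i) = [:: 0; 'X; 0; 0; 'X%:P]`_i.
Proof. by move=> hi; rewrite [LHS]mmapX mmap1U /BT_val inordK. Qed.

Lemma to_BT_int (f : {mpoly int[5]}) :
  to_BT rat (map_mpoly intr f) = map_poly (map_poly intr) (to_BT int f).
Proof.
apply: (@mpolyZ_rmorph_ext _ _ (to_BT rat \o map_mpoly intr)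
  (map_poly (map_poly intr) \o to_BT int)) => i /=.
rewrite map_intr_mpolyX ![mmap _ _ _]mmapX !mmap1U /BT_val.
case: i => [[|[|[|[|[|//]]]]] hi] /=; rewrite ?map_poly0 ?map_polyX //.
by rewrite map_polyC /= map_polyX.
Qed.

(** The specialized minors generate an ideal inside (B^(n+1), B^n T^m), none of
    whose elements involves B^n T^(m-1). *)
Lemma span_minors_coef u : in_span (minors m n) u -> (to_BT rat u)`_n`_(m.-1) = 0.
Proof.
move=> hu; pose xs : seq {poly {poly rat}} := [:: 'X ^+ n.+1; ('X ^+ m)%:P * 'X ^+ n].
have proper_xs : ~ in_span xs 1.
  move=> /(rmorph_span0 (f := horner_eval (0 : {poly rat}))) h.
  suff /eqP : horner_eval (0 : {poly rat}) 1 = 0 by rewrite rmorph1 oner_eq0.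
  apply: h => x; rewrite !inE => /orP[]/eqP->; rewrite /= /horner_eval.
    by rewrite hornerXn expr0n.
  by rewrite hornerM hornerXn expr0n eqn0Ngt n_gt0 /= mulr0.
pose fq : {rmorphism {mpoly rat[5]} -> {ideal_quot span proper_xs}} :=
  quot_map (span proper_xs) \o to_BT rat.
have : fq u = 0.
  apply: rmorph_span0 hu; apply/minors_eq0.
  have e0 x : x \in xs -> quot_map (span proper_xs) x = 0.
    by move=> xxs; apply/quot_map_eq0/in_spanE; exact: in_span_mem.
  have [h0 h1 h2 h3 h4] : [/\ fq (XX 0) = 0, fq (XX 1) = quot_map (span proper_xs) 'X,
      fq (XX 2) = 0, fq (XX 3) = 0 & fq (XX 4) = quot_map (span proper_xs) 'X%:P].
    have fqE v : fq v = quot_map (span proper_xs) (to_BT rat v) by [].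
    by split; rewrite fqE to_BTX // rmorph0.
  rewrite /minor_rel h0 h1 h2 h3 h4 !expr0n !(mulr0, mul0r, add0r, subr0).
  split=> //; rewrite -!rmorphXn -rmorphM; apply: e0; rewrite !inE.
    by apply/orP; right.
  by rewrite -exprS eqxx.
move/quot_map_eq0/in_spanE/in_span_cons=> [r [_ [/in_span_cons[s [_ [[c ->] ->]]]]]].
move=> ->; rewrite big_ord0 addr0 mulrA coefD !coefMXn ltnSn ltnn subnn add0r.
by rewrite coefMC coefMXn prednK // leqnn.
Qed.

Lemma R_proj_eq0 u : R_proj m n u = 0 <-> in_span (minors m n) u.
Proof. by rewrite /R_proj quot_map_eq0 in_spanE. Qed.

(** Compare the coefficients of B^n T^(m-1): the multiples of A and of D
    contribute nothing. *)
Lemma coef_obstruction (p W : nat) (f g : {mpoly rat[5]}) (h : {mpoly int[5]}) :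
  R_proj m n ((XX 1 ^+ n * XX 4 ^+ m.-1) *+ W - f * XX 0 - g * XX 3) =
  R_proj m n (map_mpoly intr h) *+ p -> (p %| W)%N.
Proof.
move/eqP; rewrite -rmorphMn -subr_eq0 -rmorphB => /eqP/R_proj_eq0/span_minors_coef.
rewrite rmorphB !rmorphB !rmorphM !rmorphMn rmorphM !rmorphXn to_BT_int !to_BTX //=.
rewrite !mulr0 !subr0 => /eqP.
have -> : ('X%:P : {poly {poly rat}}) ^+ m.-1 = ('X ^+ m.-1)%:P by rewrite -rmorphXn.
rewrite coefB !coefMn coefMC coefXn eqxx mul1r coefB !coefMn coefXn eqxx.
rewrite !coef_map /= subr_eq0 => /eqP.
set z := (X in X%:~R *+ p) => e.
have : (W%:Z = z * p%:Z)%R.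
  by apply: (@intr_inj rat); rewrite intrM -!pmulrn mulr_natr.
by move=> hW; rewrite -(absz_nat W) hW abszM dvdn_mull.
Qed.

End Coefficient.

(** * Kernels, maximal ideals and denominators *)

Section KernelIdeal.
Variables (S B : comNzRingType) (f : {rmorphism S -> B}).

Definition ker_pred : S -> bool := fun x => f x == 0.

Lemma ker_pred_closed : idealr_closed (ker_pred : {pred S}).
Proof.
split=> [||a x y]; rewrite -!topredE /= /ker_pred ?rmorph0 ?rmorph1 ?oner_eq0 //.
by move=> /eqP fx /eqP fy; rewrite rmorphD rmorphM fx fy mulr0 addr0.
Qed.

HB.instance Definition _ := isIdealr.Build S ker_pred ker_pred_closed.

Definition ker_ideal : idealr S := ker_pred.

Lemma ker_idealE x : (x \in ker_ideal) = (f x == 0). Proof. by []. Qed.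

End KernelIdeal.

Section KernelPrime.
Variables (S : comNzRingType) (B : idomainType) (f : {rmorphism S -> B}).

Definition ker_prime_pred : S -> bool := ker_pred f.

Lemma ker_prime_pred_closed : prime_idealr_closed (ker_prime_pred : {pred S}).
Proof. by move=> u v; rewrite -!topredE /= /ker_prime_pred /ker_pred rmorphM mulf_eq0. Qed.

HB.instance Definition _ := isIdealr.Build S ker_prime_pred (ker_pred_closed f).
HB.instance Definition _ := isPrimeIdealrClosed.Build S ker_prime_pred ker_prime_pred_closed.

Definition ker_prime : prime_idealr S := ker_prime_pred.

Lemma ker_primeE x : (x \in ker_prime) = (f x == 0). Proof. by []. Qed.

End KernelPrime.

Section PropIdeal.
Variables (S : comNzRingType) (U : S -> Prop).
Hypotheses (U0 : U 0) (U1 : ~ U 1) (UL : forall a x y, U x -> U y -> U (a * x + y)).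

Definition prop_ideal_pred (_ : U 0) (_ : ~ U 1)
  (_ : forall a x y, U x -> U y -> U (a * x + y)) : S -> bool := fun x => `[<U x>].

Lemma prop_ideal_closed : idealr_closed (prop_ideal_pred U0 U1 UL : {pred S}).
Proof.
split=> [||a x y /asboolP hx /asboolP hy]; first exact/asboolP.
  exact/asboolPn.
by apply/asboolP; exact: UL.
Qed.

HB.instance Definition _ := isIdealr.Build S (prop_ideal_pred U0 U1 UL) prop_ideal_closed.

Definition prop_ideal : idealr S := prop_ideal_pred U0 U1 UL.

Lemma prop_idealE x : x \in (prop_ideal : {pred S}) <-> U x.
Proof. by split=> /asboolP. Qed.

End PropIdeal.

Lemma maximal_ideal_Bezout (S : comNzRingType) (mu : idealr S) x :
  maximal_ideal mu -> x \notin mu -> exists u v, v \in mu /\ 1 = u * x + v.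
Proof.
move=> mu_max x_mu.
pose U y := exists u v, v \in mu /\ y = u * x + v.
have U0 : U 0 by exists 0, 0; split; [exact: idealr0 | rewrite mul0r addr0].
have UL a y z : U y -> U z -> U (a * y + z).
  move=> [u [v [vmu ->]]] [u' [v' [vmu' ->]]]; exists (a * u + u'), (a * v + v').
  split; last by ring.
  by apply: rpredD => //; exact: idealMr.
have [//|U1] := EM (U 1).
have /mu_max/(_ x) : {subset mu <= prop_ideal U0 U1 UL}.
  by move=> y ymu; apply/prop_idealE; exists 0, y; split=> //; rewrite mul0r add0r.
suff -> : x \in prop_ideal U0 U1 UL by move=> /(_ isT); rewrite (negPf x_mu).
apply/prop_idealE; exists 1, 0; split; first exact: idealr0.
by rewrite mul1r addr0.
Qed.

Lemma common_denominator k (f : {mpoly rat[k]}) :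
  exists (N : nat) (g : {mpoly int[k]}), (0 < N)%N /\ f *+ N = map_mpoly intr g.
Proof.
elim/mpoly_ring_ind: f => [c|i|f f' [N [g [N0 e]]] [N' [g' [N0' e']]]|
    f f' [N [g [N0 e]]] [N' [g' [N0' e']]]].
- exists `|denq c|%N, (numq c)%:MP; rewrite absz_gt0 denq_neq0; split=> //.
  rewrite map_mpolyC -rmorphMn /= -mulr_natr; congr (_%:MP).
  rewrite -{1}(divq_num_den c) natr_absz gtr0_norm ?denq_gt0 //.
  by rewrite mulfVK // intr_eq0 denq_neq0.
- by exists 1%N, 'X_i; rewrite map_intr_mpolyX.
- exists (N * N')%N, (g *+ N' + g' *+ N); rewrite muln_gt0 N0 N0'; split=> //.
  by rewrite rmorphD !rmorphMn /= -e -e' mulrnDl -!mulrnA [(N' * N)%N]mulnC.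
- exists (N * N')%N, (g * g'); rewrite muln_gt0 N0 N0'; split=> //.
  by rewrite rmorphM /= -e -e' mulrnAr mulrnAl -mulrnA.
Qed.

(** The equations are homogeneous when a, b, c, d, t are given the weights m, 2m,
    2m, 2mn, 2. *)
Lemma minor_rel_scale (m n : nat) (B : comNzRingType) (a b c d t w : B) :
  minor_rel m n a b c d t ->
  minor_rel m n (w ^+ m * a) ((w ^+ m) ^+ 2 * b) ((w ^+ m) ^+ 2 * c)
    (((w ^+ m) ^+ 2) ^+ n * d) (w ^+ 2 * t).
Proof.
move=> [r1 r2 r3].
have e1 : (w ^+ m * a) ^+ 2 + (w ^+ 2 * t) ^+ m = (w ^+ m) ^+ 2 * (a ^+ 2 + t ^+ m).
  have -> : (w ^+ 2 * t) ^+ m = (w ^+ m) ^+ 2 * t ^+ m.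
    by rewrite exprMn exprAC.
  by ring.
rewrite /minor_rel e1 (exprMn n); move: (w ^+ m) => W; move: ((W ^+ 2) ^+ n) => Z.
split.
- transitivity (W ^+ 4 * (a ^+ 2 * (a ^+ 2 + t ^+ m))); first by ring.
  by rewrite r1; ring.
- transitivity (W ^+ 2 * Z * ((a ^+ 2 + t ^+ m) * (b ^+ n - d))); first by ring.
  by rewrite r2; ring.
- transitivity (W ^+ 2 * Z * (b * (b ^+ n - d))); first by ring.
  by rewrite r3; ring.
Qed.

Lemma mulrn_lin (B : comNzRingType) (s X Y G G' : B) (N N' M p : nat) :
  X *+ N = G *+ p -> Y *+ N' = G' *+ p ->
  (s * X + Y) *+ (N * N' * M) = ((s *+ M) * G *+ N' + G' *+ (N * M)) *+ p.
Proof.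
rewrite -(mulr_natr X) -(mulr_natr Y) -(mulr_natr G) -(mulr_natr G' p) => e e'.
rewrite -[LHS]mulr_natr -[RHS]mulr_natr -(mulr_natr s) -(mulr_natr _ N').
rewrite -(mulr_natr G') !natrM.
transitivity (s * M%:R * N'%:R * (X * N%:R) + N%:R * M%:R * (Y * N'%:R)); first by ring.
by rewrite e e'; ring.
Qed.

Lemma mulrn_scale (B : comNzRingType) (s X G Z : B) (N M p : nat) :
  X *+ N = G -> s *+ M = Z *+ p -> (s * X) *+ (N * M) = (Z * G) *+ p.
Proof.
rewrite -(mulr_natr X) -(mulr_natr s) -(mulr_natr Z) => e e'.
rewrite -[LHS]mulr_natr -[RHS]mulr_natr !natrM.
transitivity ((s * M%:R) * (X * N%:R)); first by ring.
by rewrite e e'; ring.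
Qed.

Lemma minor_rel_map (m n : nat) (B C : comNzRingType) (f : {rmorphism B -> C}) a b c d t :
  minor_rel m n a b c d t -> minor_rel m n (f a) (f b) (f c) (f d) (f t).
Proof.
by case=> r1 r2 r3; split; rewrite -!rmorphXn -?rmorphB -?rmorphD -!rmorphM ?(r1, r2, r3).
Qed.

Lemma minor_rel_inj (m n : nat) (B C : comNzRingType) (f : {rmorphism B -> C}) a b c d t :
  injective f ->
  minor_rel m n (f a) (f b) (f c) (f d) (f t) -> minor_rel m n a b c d t.
Proof.
move=> f_inj [r1 r2 r3]; split; apply: f_inj;
by rewrite !(rmorphM, rmorphB, rmorphD, rmorphXn).
Qed.

(** With r0, r1, r3, r4 the images of A, B, D, T, the right-hand side is b^n t^k
    minus a combination of a and d, for the weighted multiples of the variables,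
    after clearing a denominator N. *)
Lemma weighted_combination (B : comNzRingType) (r0 r1 r3 r4 U V : B) (m n k N0 N : nat) :
  let w : B := N0%:R in
  (r1 ^+ n * r4 ^+ k) *+ (N0 ^ (m * 2 * n + 2 * k) * N)
    - (U *+ (N0 ^ m * N)) * r0 - (V *+ (N0 ^ (m * 2 * n) * N)) * r3 =
  (((w ^+ m) ^+ 2 * r1) ^+ n * (w ^+ 2 * r4) ^+ k
    - (U * (w ^+ m * r0) + V * (((w ^+ m) ^+ 2) ^+ n * r3))) *+ N.
Proof.
move=> w; rewrite -(mulr_natr U) -(mulr_natr V) -(mulr_natr (_ * _) (_ * _)).
rewrite -[RHS]mulr_natr !natrM !natrX exprD !exprM -/w !exprMn.
move: (w ^+ m) => W; move: ((W ^+ 2) ^+ n) ((w ^+ 2) ^+ k) => X Y; ring.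
Qed.

(** * Descent to the fibers of an arbitrary model *)

Section Descent.
Variables (m n : nat).
Hypotheses (m_gt0 : (0 < m)%N) (n_gt0 : (0 < n)%N) (hmn : (2 * n + m < m * n)%N).
Variables (A0 : comNzRingType) (iota : {rmorphism A0 -> rat}) (I0 : idealr {mpoly A0[5]}).
Hypothesis iota_inj : injective iota.
Let RA0 := restrict (quot_map I0 \o @mpolyC 5 A0).
Let structK : {rmorphism rat -> R m n} := R_proj m n \o @mpolyC 5 rat.
Hypothesis free_RA0 : free_module RA0.
Variable tau : {bilinear RA0 -> restrict iota -> restrict (structK \o iota)}.
Hypotheses (tensor_tau : is_tensor_alg tau) (tau1 : forall k : rat, tau 1 k = structK k).

Local Notation XX i := ('X_(inord i) : {mpoly rat[5]}).

Definition theta (x : RA0) : R m n := tau x 1.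

Lemma theta_zmod : zmod_morphism theta.
Proof. by move=> x y; rewrite /theta linearBl. Qed.
Lemma theta_monoid : monoid_morphism theta.
Proof.
split; first by case: tensor_tau.
move=> x y; rewrite /theta; have [_ _ h] := tensor_tau.
by rewrite [RHS]h mulr1.
Qed.
HB.instance Definition _ := GRing.isZmodMorphism.Build RA0 (R m n) theta theta_zmod.
HB.instance Definition _ := GRing.isMonoidMorphism.Build RA0 (R m n) theta theta_monoid.

Lemma theta_inj : injective theta.
Proof.
have [basis [bspan bfree]] := free_RA0; have [tensor _ _] := tensor_tau.
move=> x y e; apply/eqP; rewrite -subr_eq0; apply/eqP.
apply: (tensor_free_inj bspan bfree iota_inj tensor).
by apply/eqP; rewrite linearBl subr_eq0; apply/eqP.
Qed.

Lemma theta_scale a x : theta (a *: x) = structK (iota a) * theta x.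
Proof. by rewrite /theta linearZl_LR. Qed.

(** The elements with this property form a submodule that contains every tensor
    x (x) k: a denominator of k does. *)
Lemma theta_denominator (y : R m n) :
  exists (N : nat) x, (0 < N)%N /\ theta x = y *+ N.
Proof.
have [tensor _ _] := tensor_tau.
pose U (y : restrict (structK \o iota)) :=
  exists (N : nat) x, (0 < N)%N /\ theta x = (y : R m n) *+ N.
apply: (tensor_span tensor (U := U)) => [|x k].
  split=> [|a u v [N [x [N0 e]]] [N' [x' [N0' e']]]].
    by exists 1%N, 0; rewrite rmorph0 mul0rn.
  exists (N * N')%N, (a *: x *+ N' + x' *+ N); rewrite muln_gt0 N0 N0'; split=> //.
  rewrite rmorphD !rmorphMn /= theta_scale e e' mulrnDl -!mulrnA [(N' * N)%N]mulnC.
  by rewrite mulrnAr -mulrnA.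
exists `|denq k|%N, (x *~ numq k); rewrite absz_gt0 denq_neq0; split=> //.
rewrite rmorphMz /theta -[RHS](linearMnr tau) -(raddfMz (tau x)); congr (tau x _).
rewrite -[LHS]/((numq k)%:~R : rat) numqE -mulr_natr natr_absz.
by rewrite gtr0_norm ?denq_gt0.
Qed.

Let psi : {rmorphism {mpoly int[5]} -> R m n} := R_proj m n \o map_mpoly intr.

(** [p_integral] and [p_divisible] say that the image of x in R comes from a
    polynomial with coefficients in the local ring of Z at p, respectively in its
    maximal ideal. *)
Definition p_integral (p : nat) (x : RA0) :=
  exists (N : nat) g, ~~ (p %| N)%N /\ theta x *+ N = psi g.

Definition gen (i : 'I_5) : RA0 := quot_map I0 'X_i.

Section AtPrime.
Variables (p : nat) (p_pr : prime p).
Hypothesis p_denq : forall a, ~~ (p %| `|denq (iota a)|)%N.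
Hypothesis gen_integral : forall i, p_integral p (gen i).

Lemma p_ndvdM N N' : ~~ (p %| N)%N -> ~~ (p %| N')%N -> ~~ (p %| N * N')%N.
Proof. by move=> h h'; rewrite Euclid_dvdM // negb_or h h'. Qed.

Lemma structK_num a : structK (iota a) *+ `|denq (iota a)|%N = psi (numq (iota a))%:MP.
Proof.
rewrite /psi /= map_mpolyC /structK /= -!rmorphMn /=; congr (R_proj m n (_%:MP)).
rewrite rmorphMn -mulr_natr natr_absz gtr0_norm ?denq_gt0 //. by rewrite -numqE.
Qed.

Lemma all_integral x : p_integral p x.
Proof.
have [f <-] := quot_map_surj x.
elim/mpoly_ring_ind: f => [c|i|f f' [N [g [N0 e]]] [N' [g' [N0' e']]]|
    f f' [N [g [N0 e]]] [N' [g' [N0' e']]]].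
- exists `|denq (iota c)|%N, (numq (iota c))%:MP; split=> //.
  rewrite -structK_num; congr (_ *+ _).
  have -> : quot_map I0 c%:MP = (c *: (1 : RA0)) by exact/esym/mulr1.
  by rewrite theta_scale rmorph1 mulr1.
- exact: gen_integral.
- exists (N * N')%N, (g *+ N' + g' *+ N); split; first exact: p_ndvdM.
  rewrite !rmorphD !rmorphMn -e -e' mulrnDl -!mulrnA [(N' * N)%N]mulnC.
  by [].
- exists (N * N')%N, (g * g'); split; first exact: p_ndvdM.
  by rewrite !rmorphM -e -e' mulrnAr mulrnAl -mulrnA.
Qed.

Definition p_divisible (x : RA0) :=
  exists (N : nat) g, ~~ (p %| N)%N /\ theta x *+ N = psi g *+ p.

Lemma p_divisible_submodule : submodule p_divisible.
Proof.
split=> [|a x y [N [g [N0 e]]] [N' [g' [N0' e']]]].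
  exists 1%N, 0; rewrite !rmorph0 !mul0rn; split=> //.
  by rewrite dvdn1; apply: contraTneq p_pr => ->.
exists (N * N' * `|denq (iota a)|)%N, ((numq (iota a))%:MP * g *+ N' +
  g' *+ (N * `|denq (iota a)|)); split; first by do !apply: p_ndvdM.
have := structK_num a; move: (p_denq a).
move: `|denq (iota a)|%N (numq (iota a)) => M z _ hz.
have -> : theta (a *: x + y) = structK (iota a) * theta x + theta y.
  by rewrite rmorphD /= theta_scale.
rewrite (rmorphD psi) !(rmorphMn psi) (rmorphM psi) -hz.
exact: mulrn_lin.
Qed.

Lemma mod_p_scale a x : (p %| `|numq (iota a)|)%N -> p_divisible (a *: x).
Proof.
move=> /dvdnP[w hw]; have [N [g [N0 e]]] := all_integral x.
have := structK_num a; move: (p_denq a); move: `|denq (iota a)|%N => M M0 hz.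
have [z hzz] : exists z, numq (iota a) = z * p%:Z.
  exists (sgz (numq (iota a)) * w%:Z).
  by rewrite -mulrA -PoszM -hw -intEsg.
exists (N * M)%N, (z%:MP * g); split; first exact: p_ndvdM.
rewrite theta_scale (rmorphM psi); apply: mulrn_scale => //.
rewrite hz hzz -(rmorphMn psi) -rmorphMn; congr (psi _%:MP).
by rewrite -mulr_natr natz.
Qed.

Section Fiber.
Variables (mu : idealr A0) (F : comAlgType A0).
Variable tauF : {bilinear RA0 -> restrict (quot_map mu) -> F}.
Hypotheses (tensor_tauF : is_tensor_alg tauF) (pcharF : p \in [pchar F]).
Hypothesis mu_numq : forall a, a \in mu -> (p %| `|numq (iota a)|)%N.
Variables (N0 : nat) (lifted : 'I_5 -> RA0).
Hypothesis p_N0 : ~~ (p %| N0)%N.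
Hypothesis liftedE : forall i, theta (lifted i) = R_proj m n 'X_i *+ N0.

Definition to_fiber (x : RA0) : F := tauF x 1.

Lemma to_fiber_zmod : zmod_morphism to_fiber.
Proof. by move=> x y; rewrite /to_fiber linearBl. Qed.
Lemma to_fiber_monoid : monoid_morphism to_fiber.
Proof.
split; first by case: tensor_tauF.
move=> x y; rewrite /to_fiber; have [_ _ h] := tensor_tauF.
by rewrite [RHS]h mulr1.
Qed.
HB.instance Definition _ := GRing.isZmodMorphism.Build RA0 F to_fiber to_fiber_zmod.
HB.instance Definition _ := GRing.isMonoidMorphism.Build RA0 F to_fiber to_fiber_monoid.

Lemma to_fiber_surj y : exists x, to_fiber x = y.
Proof.
have [tensor _ _] := tensor_tauF.
pose U (y : F) := exists x, to_fiber x = y.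
apply: (tensor_span tensor (U := U)) => [|x k].
  split=> [|a u v [x <-] [x' <-]]; first by exists 0; rewrite rmorph0.
  by exists (a *: x + x'); rewrite rmorphD /= /to_fiber linearZl_LR.
have [a <-] := quot_map_surj k; exists (a *: x).
rewrite /to_fiber linearZl_LR -linearZr_LR; congr (tauF x _).
exact: mulr1.
Qed.

(** If the fiber were F-pure, then b^n t^(m-1) would be in (a, d) there, for
    suitable elements a, b, d, t of the model that are multiples of the given
    generators.  Lifted to the model, this is a relation modulo p-divisible
    elements, which [coef_obstruction] excludes. *)
Lemma fiber_not_F_pure : ~~ (p %| 2 * m)%N -> ~ F_pure_at pcharF.
Proof.
move=> p_2m pureF.
pose l i := lifted (inord i); pose r i := R_proj m n (XX i).
have lE k i : theta (l i *+ k) = (N0 * k)%:R * r i.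
  by rewrite rmorphMn /= liftedE -mulrnA mulr_natl.
(* The images are w^m A, w^(2m) B, w^(2m) C, w^(2mn) D and w^2 T, for w = N0. *)
pose a := l 0 *+ N0 ^ m.-1; pose b := l 1 *+ N0 ^ (m * 2).-1.
pose c := l 2 *+ N0 ^ (m * 2).-1; pose d := l 3 *+ N0 ^ (m * 2 * n).-1.
pose t := l 4 *+ N0.
pose w : R m n := N0%:R.
have aE : theta a = w ^+ m * r 0 by rewrite lE -expnS prednK // natrX.
have m2 : (0 < m * 2)%N by rewrite muln_gt0 m_gt0.
have m2n : (0 < m * 2 * n)%N by rewrite muln_gt0 m2.
have bE : theta b = (w ^+ m) ^+ 2 * r 1.
  by rewrite lE -expnS prednK // natrX exprM.
have cE : theta c = (w ^+ m) ^+ 2 * r 2.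
  by rewrite lE -expnS prednK // natrX exprM.
have dE : theta d = ((w ^+ m) ^+ 2) ^+ n * r 3.
  by rewrite lE -expnS prednK // natrX !exprM.
have tE : theta t = w ^+ 2 * r 4 by rewrite lE natrM.
have rel_r : minor_rel m n (r 0) (r 1) (r 2) (r 3) (r 4).
  apply/(minors_eq0 m n (R_proj m n)) => x xin.
  by apply/R_proj_eq0; exact: in_span_mem.
have [r1 r2 r3] : minor_rel m n (to_fiber a) (to_fiber b) (to_fiber c) (to_fiber d) (to_fiber t).
  apply: minor_rel_map; apply: (minor_rel_inj theta_inj).
  by rewrite /= aE bE cE dE tE; exact: minor_rel_scale.
have [u' [v']] := F_pure_obstruction m_gt0 n_gt0 hmn p_2m r1 r2 r3 pureF.
have [u <-] := to_fiber_surj u'; have [v <-] := to_fiber_surj v'.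
move=> /eqP; rewrite -subr_eq0 -!rmorphXn -!rmorphM -rmorphD -rmorphB => /eqP h.
have [tensor _ _] := tensor_tauF.
have [N [g [pN e]]] := tensor_quot_kernel tensor p_divisible_submodule
  (fun a x amu => mod_p_scale x (mu_numq amu)) h.
have [fu fuE] := quot_map_surj (theta u); have [fv fvE] := quot_map_surj (theta v).
have := @coef_obstruction m n m_gt0 n_gt0 p (N0 ^ (m * 2 * n + 2 * m.-1) * N)
  (fu *+ (N0 ^ m * N)) (fv *+ (N0 ^ (m * 2 * n) * N)) g.
have -> : R_proj m n (map_mpoly intr g) *+ p = psi g *+ p by [].
rewrite -e.
have dvdX k : (p %| N0 ^ k * N)%N = false.
  apply/negbTE; apply: p_ndvdM => //; elim: k => [|k IH].
    by rewrite expn0 dvdn1; apply: contraTneq p_pr => ->.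
  by rewrite expnS; exact: p_ndvdM.
rewrite dvdX => contra; suff : false by []; apply: contra.
have -> : theta (b ^+ n * t ^+ m.-1 - (u * a + v * d)) =
    theta b ^+ n * theta t ^+ m.-1 - (theta u * theta a + theta v * theta d).
  by rewrite rmorphB rmorphD !rmorphM !rmorphXn.
rewrite aE bE dE tE -weighted_combination -fuE -fvE.
by rewrite !rmorphB !rmorphM !rmorphMn rmorphM !rmorphXn.
Qed.

End Fiber.

End AtPrime.

End Descent.

(** * Residue characteristics of subrings of the rationals *)

Section ResidueChar.
Variables (A0 : comNzRingType) (iota : {rmorphism A0 -> rat}) (mu : idealr A0) (p : nat).
Hypotheses (iota_inj : injective iota) (p_pr : prime p) (p_mu : p%:R \in mu).

Lemma mu_intl (u : int) : (p %| `|u|)%N -> u%:~R \in mu.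
Proof.
move=> /dvdnP[k hk]; rewrite [u]intEsg hk PoszM mulrA intrM.
exact: idealMr.
Qed.

Lemma mu_Bezout (u : int) : u%:~R \in mu -> (p %| `|u|)%N.
Proof.
move=> u_mu; apply: contraT => p_u.
have : coprimez u p%:Z by rewrite /coprimez /gcdz /= gcdnC; rewrite -prime_coprime in p_u.
move=> /coprimezP[[x y] /= hxy].
have : (1 : A0) \in mu.
  have -> : (1 : A0) = x%:~R * u%:~R + y%:~R * p%:R.
    by rewrite -[p%:R]/(p%:Z%:~R) -!intrM -intrD hxy.
  by apply: rpredD; exact: idealMr.
by rewrite idealr1.
Qed.

(** Otherwise 1/p would be in A0, and p could not be in a proper ideal. *)
Lemma residue_denq a : ~~ (p %| `|denq (iota a)|)%N.
Proof.
apply/negP => /dvdnP[d hd].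
have /coprimezP[[u v] /= huv] : coprimez (numq (iota a)) (denq (iota a)).
  by rewrite /coprimez /gcdz; exact: coprime_num_den.
have : (1 : A0) \in mu.
  have -> : (1 : A0) = (u%:~R * a + v%:~R) * (denq (iota a))%:~R.
    apply: iota_inj; rewrite rmorphM rmorphD rmorphM !rmorph_int rmorph1.
    by rewrite mulrDl -mulrA -numqE -!intrM -intrD huv.
  by apply: idealMr; apply: mu_intl; rewrite hd dvdn_mull.
by rewrite idealr1.
Qed.

Lemma residue_numq a : a \in mu -> (p %| `|numq (iota a)|)%N.
Proof.
move=> a_mu; apply: mu_Bezout.
have -> : (numq (iota a))%:~R = (denq (iota a))%:~R * a.
  by apply: iota_inj; rewrite rmorphM !rmorph_int numqE mulrC.
exact: idealMr.
Qed.

End ResidueChar.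

(** If p were invertible modulo mu, the fiber, in which p is 0, would vanish. *)
Lemma residue_char (A0 : comNzRingType) (mu : idealr A0) (B F : comAlgType A0)
    (tau : {bilinear B -> restrict (quot_map mu) -> F}) p :
  maximal_ideal mu -> tau 1 1 = 1 -> p \in [pchar F] -> p%:R \in mu.
Proof.
move=> mu_max tau11 pF; apply: contraT => p_mu.
have [u [v [v_mu e]]] := maximal_ideal_Bezout mu_max p_mu.
suff /eqP : (1 : F) = 0 by rewrite oner_eq0.
have h : (1 : restrict (quot_map mu)) = p%:R *: (quot_map mu u : restrict (quot_map mu)).
  rewrite -[LHS](rmorph1 (quot_map mu)) -[RHS](rmorphM (quot_map mu)).
  apply/quot_map_eq; suff -> : 1 - p%:R * u = v by [].
  by apply/eqP; rewrite subr_eq addrC mulrC -e.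
by rewrite -tau11 [X in tau _ X]h linearZr_LR scaler_nat -mulr_natl (pcharf0 pF) mul0r.
Qed.

(** Density is applied to the one-element set whose member is the product of 2m
    and of all the denominators that occur; this number is not in the zero ideal,
    which is prime. *)
Theorem R_not_F_pure_type (m n : nat) :
  (0 < m)%N -> (0 < n)%N -> (2 * n + m < m * n)%N -> ~ F_pure_type (R_proj m n).
Proof.
move=> m_gt0 n_gt0 hmn [A0 [iota [I0 [iota_inj _ free_RA0 tens fib]]]].
case: tens fib => tau [tensor_tau tau1] [Sigma [Sigma_max Sigma_dense Sigma_pure]].
have den i : {N : nat & {x | (0 < N)%N /\ theta tau x = R_proj m n 'X_i *+ N}}.
  by have /cid[N hN] := theta_denominator tensor_tau (R_proj m n 'X_i); exists N; exact: cid.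
pose N i := projT1 (den i); pose x i := projT1 (projT2 (den i)).
have N_gt0 i : (0 < N i)%N by case: (projT2 (projT2 (den i))).
have xE i : theta tau (x i) = R_proj m n 'X_i *+ N i by case: (projT2 (projT2 (den i))).
pose N0 := (\prod_i N i)%N.
pose lifted i := x i *+ (\prod_(j < 5 | j != i) N j)%N.
have liftedE i : theta tau (lifted i) = R_proj m n 'X_i *+ N0.
  by rewrite /N0 (bigD1 i) //= mulrnA -xE /theta linearMnl.
have gens i : {M : nat & {g | (0 < M)%N /\ theta tau (gen I0 i) *+ M = R_proj m n (map_mpoly intr g)}}.
  have /cid[f fE] := quot_map_surj (theta tau (gen I0 i)).
  have /cid[M hM] := common_denominator f; have /cid[g [M_gt0 e]] := hM.
  by exists M, g; rewrite -e rmorphMn /R_proj fE.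
pose M i := projT1 (gens i); pose g i := projT1 (projT2 (gens i)).
have M_gt0 i : (0 < M i)%N by case: (projT2 (projT2 (gens i))).
have gE i : theta tau (gen I0 i) *+ M i = R_proj m n (map_mpoly intr (g i)).
  by case: (projT2 (projT2 (gens i))).
pose bad := (2 * m * N0 * \prod_i M i)%N.
have bad_gt0 : (0 < bad)%N by rewrite !muln_gt0 m_gt0 !prodn_gt0.
have [mu [Smu bad_mu]] : exists mu, Sigma mu /\ bad%:R \notin mu.
  apply: contrapT => no_mu.
  suff : bad%:R \in ker_prime iota.
    by rewrite ker_primeE rmorph_nat pnatr_eq0 eqn0Ngt bad_gt0.
  apply: (Sigma_dense (fun x => x = bad%:R)) => // mu Smu _ ->.
   apply: contraT => bad_mu; case: no_mu; by exists mu.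
have [F [tauF [tensor_tauF [p [pF pureF]]]]] := Sigma_pure mu Smu.
have [_ tauF11 _] := tensor_tauF.
have p_mu := residue_char (Sigma_max mu Smu) tauF11 pF.
have p_pr := pcharf_prime pF.
have p_bad : ~~ (p %| bad)%N.
  apply: contra bad_mu => /dvdnP[k ->]; rewrite natrM; exact: idealMr.
move: p_bad; rewrite !Euclid_dvdM // !negb_or -!andbA => /and4P[p2 pm pN0 pM].
have p_denq := residue_denq iota_inj p_mu.
have gen_int i : p_integral tau p (gen I0 i).
  exists (M i), (g i); split=> //; apply: contra pM => h.
  by rewrite (bigD1 i) //= dvdn_mulr.
apply: (fiber_not_F_pure m_gt0 n_gt0 hmn iota_inj free_RA0 tensor_tau p_pr p_denq gen_int
  tensor_tauF _ pN0 liftedE _ pureF).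
  exact: residue_numq.
by rewrite Euclid_dvdM // negb_or p2.
Qed.

(** * F-regularity of direct summands of a polynomial ring *)

(** An additive map from A to its q-th powers that is linear over q-th powers,
    encoded by the q-th roots of its values. *)
Definition qroot (A : comNzRingType) (q : nat) (k : A -> A) :=
  {morph k : x y / x + y} /\ forall g r, k (g ^+ q * r) = g * k r.

Lemma qroot0 (A : comNzRingType) q (k : A -> A) : qroot q k -> k 0 = 0.
Proof. by case=> kD _; apply: (addrI (k 0)); rewrite -kD !addr0. Qed.

Section PolyRoot.
Variables (A : comNzRingType) (q : nat) (k : A -> A) (i : nat).

(** The component of f along the monomial X^i, when the polynomial ring is
    decomposed over its subring of q-th powers. *)
Definition poly_qroot (f : {poly A}) : {poly A} :=
  \poly_(a < size f) k f`_(q * a + i).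

Hypotheses (qroot_k : qroot q k) (lt_iq : (i < q)%N).

Lemma coef_poly_qroot f a : (poly_qroot f)`_a = k f`_(q * a + i).
Proof.
rewrite coef_poly; case: ltnP => // h; rewrite [f`__]nth_default ?(qroot0 qroot_k) //.
by apply: leq_trans h _; apply: leq_trans (leq_addr _ _); rewrite leq_pmull //; lia.
Qed.

Lemma poly_qrootP : [pchar A].-nat q -> qroot q poly_qroot.
Proof.
move=> qA; have [kD kM] := qroot_k.
have q_gt0 : (0 < q)%N by lia.
have pD : {morph poly_qroot : f g / f + g}.
  by move=> f g; apply/polyP => a; rewrite coefD !coef_poly_qroot coefD kD.
split=> // g; elim/poly_ind: g => [|g c IH] f.
  rewrite expr0n gtn_eqF // !mul0r; apply/polyP => a.
  by rewrite coef_poly_qroot !coef0 (qroot0 qroot_k).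
rewrite exprDn_pchar ?(eq_pnat _ (pchar_poly A)) // exprMn !mulrDl pD; congr (_ + _).
  rewrite -mulrA IH -mulrA; congr (_ * _); apply/polyP => a.
  rewrite coef_poly_qroot coefXM coefXnM; case: a => [|a] /=.
    by rewrite muln0 lt_iq (qroot0 qroot_k).
  rewrite coef_poly_qroot mulnS ltnNge -addnA leq_addr /=; congr (k f`__).
  by rewrite addKn.
apply/polyP => a; rewrite -rmorphXn coef_poly_qroot /= !coefCM kM.
by rewrite coef_poly_qroot.
Qed.

End PolyRoot.

Section FrobeniusSpan.
Variables (S : comNzRingType) (p : nat) (pcharS : p \in [pchar S]).

Lemma pchar_nat_exp e : [pchar S].-nat (p ^ e)%N.
Proof. by rewrite pnatX pnatE ?(pcharf_prime pcharS) // pcharS. Qed.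

Lemma in_frobenius_power_exp xs e (y : S) :
  in_span xs y -> in_frobenius_power p xs e (y ^+ (p ^ e)).
Proof.
have p_gt0 : (0 < p)%N by rewrite prime_gt0 // (pcharf_prime pcharS).
elim/in_span_ind=> {y} [|a x y xxs IH].
  by rewrite expr0n expn_eq0 gtn_eqF //; exact: in_span0.
rewrite exprDn_pchar ?pchar_nat_exp // exprMn; apply: in_span_lin => //.
by apply: in_span_mem; apply/mapP; exists x.
Qed.

End FrobeniusSpan.

Section Localization.
Variables (S L : comNzRingType) (W : S -> Prop) (f : {rmorphism S -> L}).
Hypothesis loc : is_localization W f.

Lemma loc_mul u v : W u -> W v -> W (u * v). Proof. by have [[_ h] _ _ _] := loc; exact: h. Qed.
Lemma loc1 : W 1. Proof. by have [[]] := loc. Qed.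

Lemma loc_inv w : W w -> exists v, f w * v = 1. Proof. by have [_ h _ _] := loc; exact: h. Qed.

Lemma loc_cancel w x y : W w -> f w * x = f w * y -> x = y.
Proof.
move=> /loc_inv[v hv] e; have : v * (f w * x) = v * (f w * y) by rewrite e.
by rewrite !mulrA ![v * _]mulrC hv !mul1r.
Qed.

Lemma loc_common (xs : seq L) : exists w (ys : seq S),
  W w /\ map f ys = [seq f w * x | x <- xs].
Proof.
elim: xs => [|x xs [w [ys [Ww e]]]]; first by exists 1, [::]; split=> //; exact: loc1.
have [_ _ _ /(_ x)[s [w' [Ww' e']]]] := loc.
exists (w' * w), (w * s :: map ( *%R w') ys); split; first exact: loc_mul.
rewrite /= -map_comp; congr (_ :: _).
  by rewrite !rmorphM -e'; ring.
transitivity (map ( *%R (f w')) (map f ys)).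
  by rewrite -map_comp; apply: eq_map => y; exact: rmorphM.
by rewrite e -map_comp; apply: eq_map => y /=; rewrite rmorphM mulrA.
Qed.

(** Expansion and contraction: clear the denominators of the coefficients, then
    those of the resulting equation. *)
Lemma loc_span (ys : seq S) (s : S) :
  in_span (map f ys) (f s) -> exists2 w, W w & in_span ys (w * s).
Proof.
have [_ _ _ surj] := loc; have [_ _ ker _] := loc.
suff gen z : in_span (map f ys) z -> exists w y, [/\ W w, in_span ys y & f w * z = f y].
  move=> /gen[w [y [Ww hy e]]].
  have /ker[w' Ww' e'] : f (w * s - y) = 0 by rewrite rmorphB rmorphM e subrr.
  exists (w' * w); first exact: loc_mul.
  have -> : w' * w * s = w' * y.
    by apply/eqP; rewrite -subr_eq0 -mulrA -mulrBr e'.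
  by rewrite -[w' * y]addr0; apply: in_span_lin => //; exact: in_span0.
elim/in_span_ind=> {z} [|a _ z /mapP[y yys ->] [w [t [Ww ht e]]]].
  by exists 1, 0; rewrite !rmorph0 mulr0; split=> //; [exact: loc1 | exact: in_span0].
have [b [w' [Ww' e']]] := surj a.
exists (w' * w), ((w * b) * y + w' * t); split; first exact: loc_mul.
  apply: in_span_lin; first exact: in_span_mem.
  by rewrite -[w' * t]addr0; apply: in_span_lin => //; exact: in_span0.
by rewrite rmorphD !rmorphM mulrDr -e -e'; ring.
Qed.

Lemma loc_domain : GRing.integral_domain_axiom S -> GRing.integral_domain_axiom L.
Proof.
move=> domS u v uv; have [_ _ ker surj] := loc.
have [s [w [Ww e]]] := surj u; have [s' [w' [Ww' e']]] := surj v.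
have /ker[w'' Ww''] : f (s * s') = 0.
  by rewrite rmorphM -e -e' mulrACA uv mul0r.
move=> /domS; case/orP=> [/eqP w0|/eqP/domS/orP[]/eqP s0].
- have [x] := loc_inv Ww''; rewrite w0 rmorph0 mul0r => /eqP.
  by rewrite eq_sym oner_eq0.
- apply/orP; left; apply/eqP; apply: (loc_cancel Ww).
  by rewrite mulr0 mulrC e s0 rmorph0.
- apply/orP; right; apply/eqP; apply: (loc_cancel Ww').
  by rewrite mulr0 mulrC e' s0 rmorph0.
Qed.

End Localization.

Section ZeroPrime.
Variables (L : comNzRingType) (domL : GRing.integral_domain_axiom L).

Definition zero_pred (_ : GRing.integral_domain_axiom L) : L -> bool := fun x => x == 0.

Lemma zero_pred_closed : idealr_closed (zero_pred domL : {pred L}).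
Proof.
split=> [||a x y]; rewrite -!topredE /= /zero_pred ?oner_eq0 //.
by move=> /eqP-> /eqP->; rewrite mulr0 addr0.
Qed.
Lemma zero_pred_prime : prime_idealr_closed (zero_pred domL : {pred L}).
Proof. by move=> u v; rewrite -!topredE /= /zero_pred => /eqP/domL. Qed.

HB.instance Definition _ := isIdealr.Build L (zero_pred domL) zero_pred_closed.
HB.instance Definition _ := isPrimeIdealrClosed.Build L (zero_pred domL) zero_pred_prime.

Lemma off_minimal_primes_neq0 (c : L) : off_minimal_primes c -> c != 0.
Proof.
move=> /(_ (zero_pred domL : prime_idealr L)); apply=> Q _ x /eqP->; exact: idealr0.
Qed.

End ZeroPrime.

Lemma polyCC_mulVf (k : fieldType) (u : k) :
  u != 0 -> (u^-1)%:P%:P * u%:P%:P = 1 :> {poly {poly k}}.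
Proof. by move=> u0; rewrite -!rmorphM mulVf // !rmorph1. Qed.

Section Criterion.
Variables (p : nat) (p_pr : prime p) (S : comNzRingType) (pcharS : p \in [pchar S]).
Local Notation P := {poly {poly 'F_p}}.
Variables (phi : {rmorphism S -> P}) (rho : P -> S).
Hypotheses (phi_inj : injective phi) (rhoD : {morph rho : x y / x + y}).
Hypotheses (rhoM : forall s x, rho (phi s * x) = s * rho x) (rho1 : rho 1 = 1).

Lemma retract_span ys s : in_span (map phi ys) (phi s) -> in_span ys s.
Proof.
move=> h; have -> : s = rho (phi s) by rewrite -[phi s]mulr1 rhoM rho1 mulr1.
move: (phi s) h => z.
elim/in_span_ind=> [|a _ x /mapP[y yys ->] IH].
  have -> : rho 0 = 0 by apply: (addrI (rho 0)); rewrite -rhoD !addr0.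
  exact: in_span0.
by rewrite rhoD mulrC rhoM mulrC; apply: in_span_lin => //; exact: in_span_mem.
Qed.

Lemma retract_domain : GRing.integral_domain_axiom S.
Proof.
move=> u v uv; have /eqP : phi u * phi v = 0 by rewrite -rmorphM uv rmorph0.
by rewrite mulf_eq0 -!(inj_eq phi_inj) rmorph0.
Qed.

Lemma Fp_exp (x : 'F_p) e : x ^+ (p ^ e) = x.
Proof.
elim: e => [|e IH]; first by rewrite expr1.
by rewrite expnSr exprM IH; have := expf_card x; rewrite card_Fp.
Qed.

(** For q larger than the degrees of c, the component of c along one of its
    monomials is a nonzero constant. *)
Lemma qroot_exists (c : P) : c != 0 -> exists e0, forall e, (e0 <= e)%N ->
  exists (k : P -> P) (u : 'F_p), [/\ qroot (p ^ e) k, u != 0 & k c = u%:P%:P].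
Proof.
move=> c0; pose cj := lead_coef c; have cj0 : cj != 0 by rewrite lead_coef_eq0.
exists (size c + size cj)%N => e le_e.
have lt_e : (e < p ^ e)%N by apply: ltn_expl; exact: prime_gt1.
have pc : p \in [pchar 'F_p] by exact: pchar_Fp.
have pc' : p \in [pchar {poly 'F_p}] by rewrite pchar_poly.
have q1 : qroot (p ^ e) (@id 'F_p) by split=> // g r; rewrite Fp_exp.
have sc : (0 < size c)%N by rewrite size_poly_gt0.
have scj : (0 < size cj)%N by rewrite size_poly_gt0.
have lti : ((size cj).-1 < p ^ e)%N by lia.
have ltj : ((size c).-1 < p ^ e)%N by lia.
have q2 := poly_qrootP q1 lti (pchar_nat_exp pc e).
have q3 := poly_qrootP q2 ltj (pchar_nat_exp pc' e).
exists (poly_qroot (p ^ e) (poly_qroot (p ^ e) id (size cj).-1) (size c).-1), (lead_coef cj).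
split=> //; first by rewrite lead_coef_eq0.
have aux (A : comNzRingType) (k : A -> A) i (f : {poly A}) :
    qroot (p ^ e) k -> (i < p ^ e)%N -> (size f <= p ^ e)%N ->
    poly_qroot (p ^ e) k i f = (k f`_i)%:P.
  move=> qk ilt hf; apply/polyP => a; rewrite (coef_poly_qroot qk) // coefC.
  case: a => [|a] /=; first by rewrite muln0.
  rewrite nth_default ?(qroot0 qk) //; apply: leq_trans hf _.
  by rewrite mulnS -addnA leq_addr.
have le_c : (size c <= p ^ e)%N by lia.
have le_cj : (size cj <= p ^ e)%N by lia.
by rewrite (aux _ _ _ _ q2 ltj le_c) (aux _ _ _ _ q1 lti le_cj).
Qed.

(** Let c x^q be in J^[q] for all large q, in a localization of S.  Clearing
    denominators gives d (w z)^q in J^[q] in S, then in k[x, y], where a map as in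
    [qroot_exists] sends d to a unit and is linear over q-th powers.  Hence w z is
    in J k[x, y], and the retraction brings it back to J. *)
Theorem F_regular_of_retract : F_regular S.
Proof.
exists p => // L W f loc xs x.
have pcharL : p \in [pchar L].
  by apply/andP; split=> //; rewrite -(rmorph_nat f) (pcharf0 pcharS) rmorph0.
split=> [[c c_off [e0 he0]]|hx]; last first.
  exists 1; first by move=> Q _; rewrite idealr1.
  exists 0%N => e _; rewrite mul1r; exact: in_frobenius_power_exp.
have c0 := off_minimal_primes_neq0 (loc_domain loc retract_domain) c_off.
have [w [ys [Ww ysE]]] := loc_common loc xs.
have [_ _ ker surj] := loc.
have [s [w2 [Ww2 e2]]] := surj x.
have [d [w0 [Ww0 e1]]] := surj c.
have d0 : phi d != 0.
  apply: contra c0 => /eqP; rewrite -(rmorph0 phi) => /phi_inj d0.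
  by apply/eqP; apply: (loc_cancel loc Ww0); rewrite mulr0 mulrC e1 d0 rmorph0.
have [e3 he3] := qroot_exists d0.
pose e := maxn e0 e3.
have [k [u [qk u0 kd]]] := he3 e (leq_maxr _ _).
have /(_ (leq_maxl _ _)) hspan := he0 e.
pose q := (p ^ e)%N.
have q_gt0 : (0 < q)%N by rewrite expn_gt0 prime_gt0.
pose z := w * s.
have : in_span (map f [seq y ^+ q | y <- ys]) (f (d * z ^+ q)).
  have -> : map f [seq y ^+ q | y <- ys] = [seq f w ^+ q * x ^+ q | x <- xs].
    rewrite -map_comp (eq_map (g := fun y => (f y) ^+ q)); last by move=> y /=; rewrite rmorphXn.
    rewrite (map_comp (fun y => y ^+ q) f) ysE -map_comp; apply: eq_map => y /=.
    by rewrite exprMn.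
  have -> : f (d * z ^+ q) = (f w0 * f w2 ^+ q) * (f w ^+ q * (c * x ^+ q)).
    by rewrite !rmorphM rmorphXn -e1 rmorphM -e2 !exprMn; ring.
  move: (f w0 * _) hspan => v; rewrite /in_frobenius_power -/q.
  move: (c * _) => y; elim/in_span_ind=> [|a _ y' /mapP[x' x'xs ->] IH].
    by rewrite !mulr0; exact: in_span0.
  rewrite !mulrDr; have -> : v * (f w ^+ q * (a * x' ^+ q)) = (v * a) * (f w ^+ q * x' ^+ q).
    by ring.
  by apply: in_span_lin => //; apply: in_span_mem; apply/mapP; exists x'.
move=> /(loc_span loc)[w3 Ww3 h3].
have h4 : in_span (map phi ys) (phi (w3 * z)).
  have : in_span [seq phi y ^+ q | y <- ys] (phi (w3 * z) ^+ q * phi d).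
    have -> : phi (w3 * z) ^+ q * phi d = phi (w3 ^+ q.-1 * (w3 * (d * z ^+ q))).
      rewrite -{1}(prednK q_gt0) -rmorphXn -rmorphM; congr (phi _).
      by rewrite prednK // exprMn -{1}(prednK q_gt0) exprS; ring.
    move: (w3 * _) h3 => v; elim/in_span_ind=> [|a _ v' /mapP[y yys ->] IH].
      by rewrite mulr0 rmorph0; exact: in_span0.
    rewrite mulrDr rmorphD mulrA rmorphM rmorphXn; apply: in_span_lin => //.
    by apply: in_span_mem; apply/mapP; exists y.
  have [kD kM] := qk.
  suff gen v : in_span [seq phi y ^+ q | y <- ys] v -> in_span (map phi ys) (k v).
    move=> /gen; rewrite kM kd => h.
    have -> : phi (w3 * z) = (u^-1)%:P%:P * (phi (w3 * z) * u%:P%:P) + 0.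
      by move: (phi _) => y; rewrite addr0 mulrCA polyCC_mulVf ?mulr1.
    by apply: in_span_lin => //; exact: in_span0.
  elim/in_span_ind=> [|a _ v' /mapP[y yys ->] IH]; first by rewrite (qroot0 qk); exact: in_span0.
  rewrite kD mulrC kM mulrC; apply: in_span_lin => //; apply: in_span_mem.
  by apply/mapP; exists y.
have h5 := retract_span h4.
have h6 : in_span xs (f (w3 * z)).
  move: (w3 * z) h5 => v; elim/in_span_ind=> [|a y v' yys IH]; first by rewrite rmorph0; exact: in_span0.
  rewrite rmorphD rmorphM.
  have /mapP[x' x'xs ->] : f y \in [seq f w * x | x <- xs] by rewrite -ysE map_f.
  by rewrite mulrA; apply: in_span_lin => //; exact: in_span_mem.
have : in_span xs (f (w3 * w * w2) * x).
  by have -> : f (w3 * w * w2) * x = f (w3 * z) by rewrite /z !rmorphM -e2; ring.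
have [v hv] := loc_inv loc (loc_mul loc (loc_mul loc Ww3 Ww) Ww2).
move=> h; have -> : x = v * (f (w3 * w * w2) * x) + 0.
  by rewrite addr0 mulrA [v * _]mulrC hv mul1r.
by apply: in_span_lin => //; exact: in_span0.
Qed.

End Criterion.

(** * Normal forms modulo the equations of the cone *)

Section Evaluation.
Variables (A H : comNzRingType) (iota : {rmorphism A -> H}).

(** [ev1] evaluates a polynomial in one variable, and [ev2] one in two variables,
    the first argument being the value of the outer variable. *)
Definition ev1 (y : H) : {rmorphism {poly A} -> H} := horner_eval y \o map_poly iota.
Definition ev2 (x y : H) : {rmorphism {poly {poly A}} -> H} :=
  horner_eval x \o map_poly (ev1 y).

Lemma ev1E y f : ev1 y f = (map_poly iota f).[y]. Proof. by []. Qed.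
Lemma ev2E x y f : ev2 x y f = (map_poly (ev1 y) f).[x]. Proof. by []. Qed.
Lemma ev1C y c : ev1 y c%:P = iota c. Proof. by rewrite ev1E map_polyC hornerC. Qed.
Lemma ev1X y : ev1 y 'X = y. Proof. by rewrite ev1E map_polyX hornerX. Qed.
Lemma ev2C x y f : ev2 x y f%:P = ev1 y f. Proof. by rewrite ev2E map_polyC hornerC. Qed.
Lemma ev2X x y : ev2 x y 'X = x. Proof. by rewrite ev2E map_polyX hornerX. Qed.

End Evaluation.

Lemma ev1_ext (A H : comNzRingType) (f g : {rmorphism {poly A} -> H}) :
  (forall c, f c%:P = g c%:P) -> f 'X = g 'X -> f =1 g.
Proof.
move=> fgC fgX; elim/poly_ind => [|u c IH]; first by rewrite !rmorph0.
by rewrite !rmorphD !rmorphM IH fgX fgC.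
Qed.

(** The three polynomials describe a combination of the monomials a^i b^j,
    a^i c^(j+1) and a^i d^(j+1). *)
Definition normal (A H : comNzRingType) (iota : {rmorphism A -> H}) (a b c d : H)
    (F G K : {poly {poly A}}) : H :=
  ev2 iota a b F + c * ev2 iota a c G + d * ev2 iota a d K.

Section BaseChange.
Variables (A H B : comNzRingType).

Lemma ev1_map (iota : {rmorphism A -> H}) (iota' : {rmorphism A -> B})
    (f : {rmorphism H -> B}) y p :
  (forall c, f (iota c) = iota' c) -> f (ev1 iota y p) = ev1 iota' (f y) p.
Proof.
move=> fE; apply: (@ev1_ext _ _ (f \o ev1 iota y) (ev1 iota' (f y))) => [c|].
  by transitivity (f (ev1 iota y c%:P)); rewrite // !ev1C fE.
by transitivity (f (ev1 iota y 'X)); rewrite // !ev1X.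
Qed.

Lemma ev2_map (iota : {rmorphism A -> H}) (iota' : {rmorphism A -> B})
    (f : {rmorphism H -> B}) x y p :
  (forall c, f (iota c) = iota' c) -> f (ev2 iota x y p) = ev2 iota' (f x) (f y) p.
Proof.
move=> fE; have h1 z u := ev1_map (iota := iota) (iota' := iota') (f := f) z u fE.
apply: (@ev1_ext _ _ (f \o ev2 iota x y) (ev2 iota' (f x) (f y))) => [c|].
  by transitivity (f (ev2 iota x y c%:P)); rewrite // !ev2C h1.
by transitivity (f (ev2 iota x y 'X)); rewrite // !ev2X.
Qed.

Lemma normal_map (iota : {rmorphism A -> H}) (iota' : {rmorphism A -> B})
    (f : {rmorphism H -> B}) a b c d F G K :
  (forall z, f (iota z) = iota' z) ->
  f (normal iota a b c d F G K) = normal iota' (f a) (f b) (f c) (f d) F G K.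
Proof. by move=> fE; rewrite /normal !rmorphD !rmorphM !(ev2_map _ _ _ fE). Qed.

Lemma normal_base (j : {rmorphism A -> H}) (iota : {rmorphism H -> B})
    (iota' : {rmorphism A -> B}) a b c d F G K :
  (forall z, iota (j z) = iota' z) ->
  normal iota' a b c d F G K =
  normal iota a b c d (map_poly (map_poly j) F) (map_poly (map_poly j) G)
    (map_poly (map_poly j) K).
Proof.
move=> jE.
have h1 y p : ev1 iota' y p = ev1 iota y (map_poly j p).
  rewrite !ev1E -map_poly_comp; congr (_.[_]); apply: eq_map_poly => z /=.
  by rewrite jE.
have h2 x y p : ev2 iota' x y p = ev2 iota x y (map_poly (map_poly j) p).
  rewrite !ev2E -map_poly_comp; congr (_.[_]); apply: eq_map_poly => z /=.
  exact: h1.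
by rewrite /normal !h2.
Qed.

End BaseChange.

Section NormalForm.
Variable n : nat.
Local Notation XX i := ('X_(inord i) : {mpoly int[5]}).
Local Notation zz H := (intr : {rmorphism int -> H}).

Definition cone_rel (H : comNzRingType) (a b c d : H) : Prop :=
  [/\ b * c = a ^+ 4, b * d = b ^+ n.+1 - a ^+ 2 * d &
      c * d = a ^+ 2 * b ^+ n - a ^+ 2 * d].

(** Quantifying over these morphisms replaces membership in the ideal generated by
    the equations of R/tR over Z. *)
Definition cone_hom (H : comNzRingType) (psi : {rmorphism {mpoly int[5]} -> H}) : Prop :=
  cone_rel (psi (XX 0)) (psi (XX 1)) (psi (XX 2)) (psi (XX 3)) /\ psi (XX 4) = 0.

Definition has_normal_form (f : {mpoly int[5]}) : Prop :=
  exists F G K, forall (H : comNzRingType) (psi : {rmorphism {mpoly int[5]} -> H}),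
    cone_hom psi -> psi f = normal (zz H) (psi (XX 0)) (psi (XX 1)) (psi (XX 2)) (psi (XX 3)) F G K.

Lemma has_normal_form_congr f g : has_normal_form g ->
  (forall (H : comNzRingType) (psi : {rmorphism {mpoly int[5]} -> H}),
     cone_hom psi -> psi f = psi g) -> has_normal_form f.
Proof. by move=> [F [G [K hF]]] fg; exists (F), (G), (K); move=> H psi gpsi; rewrite fg // hF. Qed.

Lemma has_normal_form_add f g : has_normal_form f -> has_normal_form g -> has_normal_form (f + g).
Proof.
move=> [F1 [F2 [F3 hF]]] [G1 [G2 [G3 hG]]]; exists (F1 + G1), (F2 + G2), (F3 + G3); move=> H psi gpsi.
by rewrite rmorphD hF // hG // /normal ![ev2 _ _ _ (_ + _)]rmorphD; ring.
Qed.

Lemma has_normal_form_scale (z : int) f : has_normal_form f -> has_normal_form (z%:~R * f).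
Proof.
move=> [F1 [F2 [F3 hF]]]; exists (z%:~R * F1), (z%:~R * F2), (z%:~R * F3); move=> H psi gpsi.
have E x y G : ev2 (zz H) x y (z%:~R * G) = z%:~R * ev2 (zz H) x y G.
  by rewrite rmorphM rmorph_int.
rewrite rmorphM rmorph_int hF // /normal !E; move: (z%:~R : H) (ev2 _ _ _ F1) => w x; ring.
Qed.

Lemma has_normal_form_opp f : has_normal_form f -> has_normal_form (- f).
Proof. by move=> /(has_normal_form_scale (-1)); rewrite rmorphN1 mulN1r. Qed.

Lemma has_normal_form_mulA i f : has_normal_form f -> has_normal_form (XX 0 ^+ i * f).
Proof.
move=> [F1 [F2 [F3 hF]]]; exists ('X ^+ i * F1), ('X ^+ i * F2), ('X ^+ i * F3); move=> H psi gpsi.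
have E x y G : ev2 (zz H) x y ('X ^+ i * G) = x ^+ i * ev2 (zz H) x y G.
  by rewrite rmorphM rmorphXn ev2X.
by rewrite rmorphM rmorphXn hF // /normal !E; ring.
Qed.

Lemma has_normal_form_B j : has_normal_form (XX 1 ^+ j).
Proof.
exists (('X ^+ j)%:P), (0), (0); move=> H psi gpsi.
by rewrite /normal !rmorph0 !mulr0 !addr0 ev2C !rmorphXn ev1X.
Qed.
Lemma has_normal_form_C j : has_normal_form (XX 2 ^+ j.+1).
Proof.
exists (0), (('X ^+ j)%:P), (0); move=> H psi gpsi.
by rewrite /normal !rmorph0 mulr0 addr0 add0r ev2C !rmorphXn ev1X exprS.
Qed.
Lemma has_normal_form_D j : has_normal_form (XX 3 ^+ j.+1).
Proof.
exists (0), (0), (('X ^+ j)%:P); move=> H psi gpsi.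
by rewrite /normal !rmorph0 mulr0 !add0r ev2C !rmorphXn ev1X exprS.
Qed.

(** Each of the three equations replaces a product of two of b, c, d by terms in
    which the exponent of d drops, or else it is unchanged and the sum of the two
    other exponents drops. *)
Lemma has_normal_form_BCD (be ga de : nat) : has_normal_form (XX 1 ^+ be * XX 2 ^+ ga * XX 3 ^+ de).
Proof.
elim/ltn_ind: de be ga => de IHde be ga.
have [N] := ubnP (be + ga); elim: N be ga => // N IHN be ga; rewrite ltnS => le_N.
have [be0|be_gt0] := posnP be; have [ga0|ga_gt0] := posnP ga.
- rewrite be0 ga0 !expr0 !mul1r; case: de {IHde IHN} => [|de]; last exact: has_normal_form_D.
  by rewrite expr0 -(expr0 (XX 1)); exact: has_normal_form_B.
- have [de0|de_gt0] := posnP de.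
    by rewrite be0 de0 !expr0 mul1r mulr1 -(prednK ga_gt0); exact: has_normal_form_C.
  apply: (@has_normal_form_congr _ (XX 0 ^+ 2 * (XX 1 ^+ n * XX 2 ^+ ga.-1 * XX 3 ^+ de.-1) +
      - (XX 0 ^+ 2 * (XX 1 ^+ 0 * XX 2 ^+ ga.-1 * XX 3 ^+ de)))).
    apply: has_normal_form_add; first by apply: has_normal_form_mulA; apply: IHde; lia.
    by apply: has_normal_form_opp; apply: has_normal_form_mulA; apply: IHN; lia.
  move=> H psi [[_ _ r3] _]; rewrite be0 !(rmorphB, rmorphXn, rmorphM).
  rewrite -{1}(prednK ga_gt0) -{1 3}(prednK de_gt0) !exprS.
  move: r3; move: (psi (XX 0)) (psi (XX 1)) (psi (XX 2)) (psi (XX 3)) => a b c d r3.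
  transitivity (c ^+ ga.-1 * d ^+ de.-1 * (c * d)); first by ring.
  by rewrite r3; ring.
- have [de0|de_gt0] := posnP de.
    by rewrite ga0 de0 !expr0 !mulr1; exact: has_normal_form_B.
  apply: (@has_normal_form_congr _ (XX 1 ^+ (be + n) * XX 2 ^+ 0 * XX 3 ^+ de.-1 +
      - (XX 0 ^+ 2 * (XX 1 ^+ be.-1 * XX 2 ^+ 0 * XX 3 ^+ de)))).
    apply: has_normal_form_add; first by apply: IHde; lia.
    by apply: has_normal_form_opp; apply: has_normal_form_mulA; apply: IHN; lia.
  move=> H psi [[_ r2 _] _]; rewrite ga0 !(rmorphB, rmorphXn, rmorphM).
  rewrite -{1 2}(prednK be_gt0) -{1 3}(prednK de_gt0) !exprD !exprS.
  move: r2; move: (psi (XX 0)) (psi (XX 1)) (psi (XX 2)) (psi (XX 3)) => a b c d r2.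
  transitivity (b ^+ be.-1 * d ^+ de.-1 * (b * d)); first by ring.
  by rewrite r2 exprS; ring.
apply: (@has_normal_form_congr _ (XX 0 ^+ 4 * (XX 1 ^+ be.-1 * XX 2 ^+ ga.-1 * XX 3 ^+ de))).
  by apply: has_normal_form_mulA; apply: IHN; lia.
move=> H psi [[r1 _ _] _]; rewrite !(rmorphXn, rmorphM) -r1.
rewrite -{1}(prednK be_gt0) -{1}(prednK ga_gt0) !exprS.
by move: (psi (XX 1)) (psi (XX 2)) (psi (XX 3)) => b c d; ring.
Qed.

Theorem normal_form f : has_normal_form f.
Proof.
rewrite (mpolyE f); elim/big_rec: _ => [|mon x _ hx].
  by rewrite -(mul0r (XX 1 ^+ 0)) -[0]/(0%:~R); apply: has_normal_form_scale; exact: has_normal_form_B.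
apply: has_normal_form_add => //; rewrite -mul_mpolyC mpolyC_int; apply: has_normal_form_scale.
rewrite mpolyXE_id !big_ord_recl big_ord0 mulr1.
have ordE (i : 'I_5) k : val i = k -> i = inord k by move=> <-; rewrite inord_val.
rewrite (ordE (lift _ (lift _ (lift _ (lift _ _)))) 4%N) //.
rewrite (ordE (lift _ (lift _ (lift _ _))) 3%N) // (ordE (lift _ (lift _ _)) 2%N) //.
rewrite (ordE (lift _ _) 1%N) // (ordE ord0 0%N) //.
move: (mon (inord 0)) (mon (inord 1)) (mon (inord 2)) (mon (inord 3)) (mon (inord 4)).
move=> i j k l r.
case: r => [|r]; first by rewrite expr0 mulr1 [X in _ * X]mulrA; apply: has_normal_form_mulA; exact: has_normal_form_BCD.
apply: (has_normal_form_congr (has_normal_form_scale 0 (has_normal_form_B 0))) => H psi [_ psi4].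
by rewrite mul0r exprS !rmorphM psi4 mul0r !mulr0 rmorph0.
Qed.

End NormalForm.

Lemma cone_rel_param (n : nat) (H : comNzRingType) (U V W e : H) :
  4%:R * e = 1 -> V ^+ 2 = U ^+ 2 + 4%:R * W ^+ (2 * n) ->
  cone_rel n (U * V * W) (- (U ^+ 4 * W ^+ 2)) (- (V ^+ 4 * W ^+ 2))
    ((-1) ^+ n.+1 * e * U ^+ (4 * n + 2)).
Proof.
move=> e4 hV.
have e4' z : 4%:R * (e * z) = z by rewrite mulrA e4 mul1r.
have VU : V ^+ 2 - U ^+ 2 = 4%:R * W ^+ (2 * n) by rewrite hV addrC addKr.
rewrite /cone_rel.
have -> : U ^+ (4 * n + 2) = (U ^+ n) ^+ 4 * U ^+ 2 by rewrite exprD [(4 * n)%N]mulnC exprM.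
have bn : (- (U ^+ 4 * W ^+ 2)) ^+ n = (-1) ^+ n * (U ^+ n) ^+ 4 * W ^+ (2 * n).
  by rewrite -(mulN1r (U ^+ 4 * W ^+ 2)) exprMn (exprMn n (U ^+ 4)) mulrA exprAC -(exprM W).
rewrite !(exprS _ n) bn.
move: ((-1) ^+ n) (U ^+ n) (W ^+ (2 * n)) VU hV => s X Z VU hV; split; first by ring.
- apply/eqP; rewrite -subr_eq0; apply/eqP.
  transitivity (- s * U ^+ 4 * W ^+ 2 * X ^+ 4 * (e * (V ^+ 2 - U ^+ 2) - Z)); last first.
    by rewrite VU (mulrCA e) e4' subrr mulr0.
  ring.
- apply/eqP; rewrite -subr_eq0; apply/eqP.
  transitivity (s * V ^+ 2 * W ^+ 2 * X ^+ 4 * U ^+ 2 * (e * (V ^+ 2 - U ^+ 2) - Z)); last first.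
    by rewrite VU (mulrCA e) e4' subrr mulr0.
  ring.
Qed.

(** * The cone as a subring of the polynomial ring in two variables *)

Section Cover.
Variables (k : fieldType) (n : nat).
Hypotheses (two_neq0 : (2%:R : k) != 0) (n_gt0 : (0 < n)%N).
Local Notation P := {poly {poly k}}.

Definition cst : {rmorphism k -> P} := polyC \o polyC.
(* In [P] the outer variable is y and the inner one is x. *)
Definition cx : P := 'X%:P.
Definition cy : P := 'X.
Definition cU : P := cx ^+ (2 * n) - cy ^+ (2 * n).
Definition cV : P := cx ^+ (2 * n) + cy ^+ (2 * n).
Definition cW : P := cx * cy.
Definition quarter : P := cst (4%:R^-1).

Definition cA : P := cU * cV * cW.
Definition cB : P := - (cU ^+ 4 * cW ^+ 2).
Definition cC : P := - (cV ^+ 4 * cW ^+ 2).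
Definition cD : P := (-1) ^+ n.+1 * quarter * cU ^+ (4 * n + 2).

Lemma four_neq0 : (4%:R : k) != 0.
Proof. by rewrite (natrM k 2 2) mulf_neq0. Qed.

Lemma quarterE : 4%:R * quarter = 1.
Proof.
by rewrite /quarter -(rmorph_nat cst) -rmorphM mulfV ?rmorph1 // four_neq0.
Qed.

Lemma cVU : cV ^+ 2 = cU ^+ 2 + 4%:R * cW ^+ (2 * n).
Proof. by rewrite /cU /cV /cW exprMn; ring. Qed.

Lemma cone_rel_cover : cone_rel n cA cB cC cD.
Proof. exact: cone_rel_param quarterE cVU. Qed.

Section Points.
Variables (L : fieldType) (iota : {rmorphism k -> L}).

(** Restriction to the line spanned by (u, v). *)
Definition at_point (u v : L) : {rmorphism P -> {poly L}} :=
  ev2 (polyC \o iota) (v *: 'X) (u *: 'X).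

Lemma scale_polyM (a b : L) (f g : {poly L}) : (a *: f) * (b *: g) = (a * b) *: (f * g).
Proof. by rewrite -scalerAl -scalerAr scalerA. Qed.

Lemma at_x u v : at_point u v cx = u *: 'X. Proof. by rewrite /at_point ev2C ev1X. Qed.
Lemma at_y u v : at_point u v cy = v *: 'X. Proof. by rewrite /at_point ev2X. Qed.
Lemma at_cst u v c : at_point u v (cst c) = (iota c)%:P.
Proof. by rewrite /at_point ev2C ev1C. Qed.

Lemma at_U u v : at_point u v cU = (u ^+ (2 * n) - v ^+ (2 * n)) *: 'X ^+ (2 * n).
Proof. by rewrite rmorphB !rmorphXn at_x at_y !exprZn scalerBl. Qed.
Lemma at_V u v : at_point u v cV = (u ^+ (2 * n) + v ^+ (2 * n)) *: 'X ^+ (2 * n).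
Proof. by rewrite rmorphD !rmorphXn at_x at_y !exprZn scalerDl. Qed.
Lemma at_W u v : at_point u v cW = (u * v) *: 'X ^+ 2.
Proof. by rewrite rmorphM at_x at_y -scalerAl -scalerAr scalerA. Qed.

Lemma at_A u v : at_point u v cA =
  ((u ^+ (2 * n) - v ^+ (2 * n)) * (u ^+ (2 * n) + v ^+ (2 * n)) * (u * v)) *:
    'X ^+ (2 * n + 2 * n + 2).
Proof.
rewrite (rmorphM _ (cU * cV)) (rmorphM _ cU) at_U at_V at_W.
by rewrite !scale_polyM !exprD.
Qed.
Lemma at_B u v : at_point u v cB =
  (- ((u ^+ (2 * n) - v ^+ (2 * n)) ^+ 4 * (u * v) ^+ 2)) *: 'X ^+ (2 * n * 4 + 2 * 2).
Proof.
rewrite rmorphN (rmorphM _ (cU ^+ 4)) (rmorphXn _ 4) (rmorphXn _ 2) at_U at_W !exprZn.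
by rewrite scale_polyM scaleNr exprD -!exprM.
Qed.
Lemma at_C u v : at_point u v cC =
  (- ((u ^+ (2 * n) + v ^+ (2 * n)) ^+ 4 * (u * v) ^+ 2)) *: 'X ^+ (2 * n * 4 + 2 * 2).
Proof.
rewrite rmorphN (rmorphM _ (cV ^+ 4)) (rmorphXn _ 4) (rmorphXn _ 2) at_V at_W !exprZn.
by rewrite scale_polyM scaleNr exprD -!exprM.
Qed.
Lemma at_D u v : at_point u v cD =
  ((-1) ^+ n.+1 * iota 4%:R^-1 * (u ^+ (2 * n) - v ^+ (2 * n)) ^+ (4 * n + 2)) *:
    'X ^+ (2 * n * (4 * n + 2)).
Proof.
rewrite (rmorphM _ ((-1) ^+ n.+1 * quarter)) (rmorphM _ _ quarter) !rmorphXn rmorphN1.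
rewrite at_cst at_U exprZn -exprM.
rewrite -scalerAr -!mul_polyC !(rmorphM (@polyC L)) !(rmorphXn (@polyC L)) rmorphN1.
by rewrite mulrCA mulrA.
Qed.

Lemma ev1_monomial (w : L) r (f : {poly k}) : w != 0 -> (0 < r)%N ->
  ev1 (polyC \o iota) (w *: 'X ^+ r) f = 0 -> f = 0.
Proof.
move=> w0 r0 /eqP; rewrite ev1E.
have -> : map_poly (polyC \o iota) f = map_poly polyC (map_poly iota f).
  by rewrite -map_poly_comp.
rewrite -/(comp_poly _ _) comp_poly_eq0 ?map_poly_eq0; first by move/eqP.
by rewrite size_scale // size_polyXn.
Qed.

End Points.

Lemma poly_uncons (A : nzRingType) (F : {poly A}) N : (size F <= N.+1)%N ->
  exists F' F0, F = F' * 'X + F0%:P /\ (size F' <= N)%N.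
Proof.
elim/poly_ind: F => [|F c _] h; first by exists 0, 0; rewrite mul0r addr0 size_poly0.
exists F, c; split=> //; move: h; rewrite size_MXaddC.
by case: ifP => // /andP[/eqP-> _]; rewrite size_poly0.
Qed.

(** Restrict a relation to the lines y = 0, x = y and y = zeta x, on which W, U
    and V vanish respectively.  A vanishes on all three; on the first only D
    survives, on the second only C, and on the third B once D has been
    eliminated.  So the coefficients that do not involve A are zero, and the
    relation can be divided by A. *)
Theorem normal_free (L : fieldType) (iota : {rmorphism k -> L}) (zeta : L) F G K :
  zeta ^+ (2 * n) = -1 -> normal cst cA cB cC cD F G K = 0 ->
  [/\ F = 0, G = 0 & K = 0].
Proof.
move=> hz; have two0 : (2%:R : L) != 0 by rewrite -(rmorph_nat iota) fmorph_eq0.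
have n2 : (0 < 2 * n)%N by rewrite muln_gt0.
have z0 : zeta != 0.
  by apply: contra_eq_neq hz => ->; rewrite expr0n gtn_eqF // eq_sym oppr_eq0 oner_eq0.
pose N := (size F + size G + size K)%N.
have : (size F <= N)%N by rewrite /N; lia.
have : (size G <= N)%N by rewrite /N; lia.
have : (size K <= N)%N by rewrite /N; lia.
move: N => N; elim: N F G K => [|N IH] F G K.
  by rewrite !leqn0 !size_poly_eq0 => /eqP-> /eqP-> /eqP->.
move=> /poly_uncons[K' [K0 [-> sK]]] /poly_uncons[G' [G0 [-> sG]]] /poly_uncons[F' [F0 [-> sF]]].
have split1 y H H0 : ev2 cst cA y (H * 'X + H0%:P) = cA * ev2 cst cA y H + ev1 cst y H0.
  by rewrite rmorphD rmorphM ev2C ev2X mulrC.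
rewrite /normal !split1 => e.
pose rest := ev1 cst cB F0 + cC * ev1 cst cC G0 + cD * ev1 cst cD K0.
have {}e : cA * normal cst cA cB cC cD F' G' K' + rest = 0.
  by rewrite -[RHS]e /normal /rest; ring.
have ev_at u v y f : at_point iota u v (ev1 cst y f) = ev1 (polyC \o iota) (at_point iota u v y) f.
  by apply: (@ev1_map _ _ _ cst (polyC \o iota)) => c; exact: at_cst.
have rest0 u v : at_point iota u v cA = 0 -> at_point iota u v rest = 0.
  by move=> h; have /(congr1 (at_point iota u v)) := e; rewrite rmorphD rmorphM h mul0r add0r rmorph0.
have i4 : iota 4%:R^-1 != 0 by rewrite fmorph_eq0 invr_eq0 four_neq0.
have s0 : ((-1) ^+ n.+1 : L) != 0 by rewrite signr_eq0.
have r1_gt0 : (0 < 2 * n * (4 * n + 2))%N by rewrite muln_gt0 n2 addn2.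
have r2_gt0 : (0 < 2 * n * 4 + 2 * 2)%N by rewrite addn_gt0 orbT.
have restE u v : at_point iota u v rest =
    ev1 (polyC \o iota) (at_point iota u v cB) F0 +
    at_point iota u v cC * ev1 (polyC \o iota) (at_point iota u v cC) G0 +
    at_point iota u v cD * ev1 (polyC \o iota) (at_point iota u v cD) K0.
  by rewrite !rmorphD !(rmorphM _ _ (ev1 _ _ _)) !ev_at.
have ev1_0 f : ev1 (polyC \o iota) 0 f = (iota f`_0)%:P.
  by rewrite ev1E horner_coef0 coef_map.
have ev1_cons w f c : ev1 (polyC \o iota) w (c%:P + 'X * f) =
    (iota c)%:P + w * ev1 (polyC \o iota) w f.
  by rewrite rmorphD rmorphM ev1C ev1X.
have X_inj f c : c%:P + 'X * f = 0 :> {poly k} -> c = 0 /\ f = 0.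
  move=> h; have c0 : c = 0.
    by have := congr1 (fun g : {poly k} => g`_0) h; rewrite coefD coefC coefXM coef0 addr0.
  split=> //; move: h; rewrite c0 add0r => /eqP; rewrite mulf_eq0 polyX_eq0 /=.
  by move/eqP.
have one2n : 1 ^+ (2 * n) = 1 :> L by rewrite expr1n.
have zero2n : 0 ^+ (2 * n) = 0 :> L by rewrite expr0n gtn_eqF.
have zero2 : 0 ^+ 2 = 0 :> L by rewrite expr0n.
have zero4 : 0 ^+ 4 = 0 :> L by rewrite expr0n.
have zerod : 0 ^+ (4 * n + 2) = 0 :> L by rewrite expr0n addn2.
have two1 : (1 + 1 : L) != 0 by [].
(* the line y = 0, where W vanishes *)
have [F00 K00] : F0`_0 = 0 /\ K0 = 0.
  have h : at_point iota 1 0 rest = 0 by apply: rest0; rewrite at_A !mulr0 scale0r.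
  have : (iota F0`_0)%:P + at_point iota 1 0 cD *
      ev1 (polyC \o iota) (at_point iota 1 0 cD) K0 = 0.
    by rewrite -[RHS]h restE at_B at_C !mulr0 zero2 !mulr0 oppr0 !scale0r ev1_0 mul0r addr0.
  rewrite at_D -ev1_cons one2n zero2n subr0 expr1n mulr1 => /ev1_monomial h'.
  by apply: X_inj; apply: h' => //; rewrite mulf_neq0.
(* the line x = y, where U vanishes *)
have G00 : G0 = 0.
  have h : at_point iota 1 1 rest = 0 by apply: rest0; rewrite at_A subrr !mul0r scale0r.
  have : (iota 0)%:P + at_point iota 1 1 cC *
      ev1 (polyC \o iota) (at_point iota 1 1 cC) G0 = 0.
    rewrite -[RHS]h restE at_B at_D subrr zero4 zerod mul0r mulr0 oppr0 !scale0r ev1_0 F00.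
    by rewrite mul0r addr0.
  rewrite at_C -ev1_cons one2n mulr1 expr1n mulr1 => /ev1_monomial h'.
  suff [//] : (0 : k) = 0 /\ G0 = 0.
  by apply: X_inj; apply: h' => //; rewrite oppr_eq0 expf_neq0.
(* the line y = zeta x, where V vanishes *)
have F0_0 : F0 = 0.
  have h : at_point iota 1 zeta rest = 0.
    by apply: rest0; rewrite at_A one2n hz subrr mulr0 mul0r scale0r.
  have : ev1 (polyC \o iota) (at_point iota 1 zeta cB) F0 = 0.
    rewrite -[RHS]h restE K00 at_C one2n hz subrr zero4 mul0r oppr0 scale0r mul0r addr0.
    by rewrite rmorph0 mulr0 addr0.
  rewrite at_B one2n hz opprK mul1r => /ev1_monomial; apply=> //.
  by rewrite oppr_eq0 mulf_neq0 // expf_neq0.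
have rest_0 : rest = 0 by rewrite /rest F0_0 G00 K00 !rmorph0 !mulr0 !addr0.
have cA0 : cA != 0.
  have : at_point iota 1 0 cU != 0.
    by rewrite at_U one2n zero2n subr0 scale1r monic_neq0 ?monicXn.
  have : at_point iota 1 0 cV != 0.
    by rewrite at_V one2n zero2n addr0 scale1r monic_neq0 ?monicXn.
  have : at_point iota 1 1 cW != 0 by rewrite at_W mulr1 scale1r monic_neq0 ?monicXn.
  have nz u v f : at_point iota u v f != 0 -> f != 0.
    by apply: contra_neq => ->; rewrite rmorph0.
  by move=> /nz hW /nz hV /nz hU; rewrite /cA mulf_neq0 // mulf_neq0.
move/eqP: e; rewrite rest_0 addr0 mulf_eq0 (negPf cA0) /= => /eqP/IH[] // -> -> ->.
by rewrite F0_0 G00 K00 mul0r addr0.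
Qed.

End Cover.

(** * Generators of the ring of invariants *)

Section Generation.
Variables (n : nat) (H : comNzRingType) (U V W e : H) (Sub : H -> Prop).
Hypotheses (e4 : 4%:R * e = 1) (VU : V ^+ 2 = U ^+ 2 + 4%:R * W ^+ (2 * n)).
Hypotheses (Sub1 : Sub 1) (SubD : forall x y, Sub x -> Sub y -> Sub (x + y)).
Hypotheses (SubN : forall x, Sub x -> Sub (- x)).
Hypotheses (SubM : forall x y, Sub x -> Sub y -> Sub (x * y)) (Sube : Sub e).
Hypotheses (Sub_A : Sub (U * V * W)) (Sub_B : Sub (U ^+ 4 * W ^+ 2)).
Hypotheses (Sub_C : Sub (V ^+ 4 * W ^+ 2)) (Sub_D : Sub (U ^+ (4 * n + 2))).

Lemma SubX x i : Sub x -> Sub (x ^+ i).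
Proof. by move=> Sx; elim: i => [|i IH]; rewrite ?expr0 // exprS; exact: SubM. Qed.

Lemma Sub0 : Sub 0.
Proof. by rewrite -(subrr 1); apply: SubD => //; exact: SubN. Qed.

Lemma Sub_nat i : Sub i%:R.
Proof. by elim: i => [|i IH]; [exact: Sub0 | rewrite mulrSr; exact: SubD]. Qed.

(** The monomial U^a V^b W^c has degree 2n(a + b) + 2c in x and y, and the
    degree of A is 4n + 2, so k below is the degree relative to A.  When c = k
    the monomial is a product of powers of A and of one of B, C. *)
Lemma gen_middle a b k : (a + b = 2 * k)%N -> odd a = odd k -> odd b = odd k ->
  Sub (U ^+ a * V ^+ b * W ^+ k).
Proof.
move=> hab oa ob; have [le_ba|lt_ab] := leqP b a.
  have [i hi] : exists i, (k = b + 2 * i)%N.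
    by exists (k - b)./2; lia.
  have -> : U ^+ a * V ^+ b * W ^+ k = (U * V * W) ^+ b * (U ^+ 4 * W ^+ 2) ^+ i.
    have -> : a = (b + 4 * i)%N by lia.
    by rewrite hi (exprD U) (exprD W) (exprM U) (exprM W) (exprMn i (U ^+ 4)) (exprMn b (U * V)) (exprMn b U); ring.
  by apply: SubM; exact: SubX.
have [i hi] : exists i, (k = a + 2 * i)%N.
  by exists (k - a)./2; lia.
have -> : U ^+ a * V ^+ b * W ^+ k = (U * V * W) ^+ a * (V ^+ 4 * W ^+ 2) ^+ i.
  have -> : b = (a + 4 * i)%N by lia.
  by rewrite hi (exprD V) (exprD W) (exprM V) (exprM W) (exprMn i (V ^+ 4)) (exprMn a (U * V)) (exprMn a U); ring.
by apply: SubM; exact: SubX.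
Qed.

(** While a < 4n + 2, the equation V^2 = U^2 + 4 W^(2n) moves exponents from V to
    U, with an error term whose exponent of W is closer to k; when a reaches
    4n + 2, a factor D splits off. *)
Lemma gen_above kap a b c k : (c + 2 * n * kap = k)%N -> (a + b = 2 * k + 2 * kap)%N ->
  odd a = odd c -> odd b = odd c -> Sub (U ^+ a * V ^+ b * W ^+ c).
Proof.
elim: kap a b c k => [|kap IH] a b c k hc hab oa ob.
  have <- : k = c by lia.
  by apply: gen_middle; rewrite ?oa ?ob //; lia.
elim/ltn_ind: b a hab oa ob => b IHb a hab oa ob.
have [le_a|lt_a] := leqP (4 * n + 2) a.
  have -> : U ^+ a * V ^+ b * W ^+ c = U ^+ (4 * n + 2) * (U ^+ (a - (4 * n + 2)) * V ^+ b * W ^+ c).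
    by rewrite -{1}(subnKC le_a) exprD !mulrA.
  by apply: SubM => //; apply: (IH _ _ _ (k - 2 * n)%N) => //; lia.
have le_b : (2 <= b)%N by lia.
have -> : U ^+ a * V ^+ b * W ^+ c = U ^+ (a + 2) * V ^+ (b - 2) * W ^+ c +
    4%:R * (U ^+ a * V ^+ (b - 2) * W ^+ (c + 2 * n)).
  by rewrite -{1}(subnK le_b) (exprD V (b - 2)) (exprD U a) (exprD W c) VU; ring.
apply: SubD; first by apply: IHb; lia.
by apply: SubM; [exact: Sub_nat | apply: (IH _ _ _ k); lia].
Qed.

(** Here W^(2n) is a multiple of V^2 - U^2, which brings c down to k. *)
Lemma gen_below kap a b c k : (c = k + 2 * n * kap)%N -> (a + b + 2 * kap = 2 * k)%N ->
  odd a = odd c -> odd b = odd c -> Sub (U ^+ a * V ^+ b * W ^+ c).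
Proof.
elim: kap a b c k => [|kap IH] a b c k hc hab oa ob.
  have <- : k = c by lia.
  by apply: gen_middle; rewrite ?oa ?ob; lia.
have hc2 : (2 * n <= c)%N by lia.
have hW : W ^+ c = W ^+ (c - 2 * n) * (e * (V ^+ 2 - U ^+ 2)).
  have -> : e * (V ^+ 2 - U ^+ 2) = W ^+ (2 * n).
    by rewrite VU addrC addKr mulrA [e * _]mulrC e4 mul1r.
  by rewrite -exprD subnK.
have -> : U ^+ a * V ^+ b * W ^+ c = e * (U ^+ a * V ^+ (b + 2) * W ^+ (c - 2 * n)
    - U ^+ (a + 2) * V ^+ b * W ^+ (c - 2 * n)).
  by rewrite hW (exprD V b) (exprD U a); ring.
by apply: SubM => //; apply: SubD; [|apply: SubN]; apply: (IH _ _ _ k); lia.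
Qed.

Lemma gen_monomial a b c k : (n * (a + b) + c = (2 * n).+1 * k)%N ->
  odd a = odd c -> odd b = odd c -> Sub (U ^+ a * V ^+ b * W ^+ c).
Proof.
move=> h oa ob; have [l hl] : exists l, (a + b = 2 * l)%N by exists (a + b)./2; lia.
rewrite hl in h; have [le_kl|lt_lk] := leqP k l.
  have [kap hk] : exists kap, (l = k + kap)%N by exists (l - k)%N; lia.
  by apply: (@gen_above kap _ _ _ k) => //; rewrite ?hl; lia.
have [kap hk] : exists kap, (k = l + kap)%N by exists (k - l)%N; lia.
by apply: (@gen_below kap _ _ _ k) => //; rewrite ?hl; lia.
Qed.

(** In the binomial expansion only the terms with the exponent of U congruent to j
    modulo 2 survive. *)
Lemma gen_symmetric j l k : (n * (2 * l) + j = (2 * n).+1 * k)%N ->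
  Sub (W ^+ j * ((V + U) ^+ (2 * l) + (-1) ^+ j * (V - U) ^+ (2 * l))).
Proof.
move=> h; rewrite exprDn exprBn mulr_sumr -big_split mulr_sumr /=.
elim/big_rec: _ => [|i x _ Sx]; first exact: Sub0.
apply: SubD => //; have le_i : (i <= 2 * l)%N by rewrite -ltnS.
rewrite -mulr_natr -(mulr_natr (_ * _ * _)).
have [oij|oij] := eqVneq (odd i) (odd j); last first.
  have -> : (-1) ^+ i = - (-1) ^+ j :> H.
    by rewrite -signr_odd -[in RHS]signr_odd; case: (odd i) (odd j) oij => [] [] //= _; rewrite ?opprK.
  set s : H := (-1) ^+ j; have ss : s * s = 1 by rewrite -expr2 sqrr_sign.
  have -> : forall C : H, W ^+ j * (V ^+ (2 * l - i) * U ^+ i * C +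
      s * (- s * V ^+ (2 * l - i) * U ^+ i * C)) = 0.
    move=> C; transitivity (W ^+ j * V ^+ (2 * l - i) * U ^+ i * C * (1 - s * s)); first by ring.
    by rewrite ss subrr mulr0.
  exact: Sub0.
have -> : (-1) ^+ i = (-1) ^+ j :> H by rewrite -signr_odd oij signr_odd.
set s : H := (-1) ^+ j; have ss : s * s = 1 by rewrite -expr2 sqrr_sign.
have -> : forall C : H, W ^+ j * (V ^+ (2 * l - i) * U ^+ i * C +
    s * (s * V ^+ (2 * l - i) * U ^+ i * C)) =
    2%:R * C * (U ^+ i * V ^+ (2 * l - i) * W ^+ j).
  move=> C; transitivity (W ^+ j * V ^+ (2 * l - i) * U ^+ i * C * (1 + s * s)); first by ring.
  by rewrite ss; ring.
apply: SubM; first by rewrite -natrM; exact: Sub_nat.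
apply: (@gen_monomial _ _ _ k); rewrite ?subnKC //.
by rewrite oddB // oddM /= oij.
Qed.

End Generation.

(** * The retraction onto the ring of invariants *)

Section Projection.
Variables (k : comNzRingType) (n : nat).
Hypothesis n_gt0 : (0 < n)%N.
Local Notation P := {poly {poly k}}.

(** A grading of k[x, y] by (Z/4n) x (Z/(4n+2)): the monomial x^i y^j has degree
    (i - j, i + j).  To stay within the natural numbers, - j is written
    (4n - 1) j. *)
Definition in_class (al be i j : nat) :=
  ((i + (4 * n).-1 * j == al %[mod (4 * n)]) && (i + j == be %[mod (4 * n + 2)]))%N.

Definition proj (al be : nat) (f : P) : P :=
  \poly_(j < size f) \poly_(i < size f`_j) (if in_class al be i j then f`_j`_i else 0).

Lemma coef_proj al be f i j :
  (proj al be f)`_j`_i = if in_class al be i j then f`_j`_i else 0.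
Proof.
rewrite coef_poly; case: ltnP => hj; last first.
  by rewrite [f`__]nth_default // coef0 if_same.
rewrite coef_poly; case: ltnP => // hi.
by rewrite [f`__`__]nth_default // if_same.
Qed.

Lemma poly2P (f g : P) : (forall i j, f`_j`_i = g`_j`_i) -> f = g.
Proof. by move=> fg; apply/polyP => j; apply/polyP => i. Qed.

Lemma projD al be : {morph proj al be : f g / f + g}.
Proof.
by move=> f g; apply: poly2P => i j; rewrite !(coefD, coef_proj); case: ifP => // _; rewrite addr0.
Qed.

Lemma proj_congr al be al' be' f : (al = al' %[mod (4 * n)])%N -> (be = be' %[mod (4 * n + 2)])%N ->
  proj al be f = proj al' be' f.
Proof. by move=> ha hb; apply: poly2P => i j; rewrite !coef_proj /in_class ha hb. Qed.

(** Homogeneity of g, expressed by what is needed of it: multiplication by g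
    shifts the projections. *)
Definition of_class (al be : nat) (g : P) :=
  forall al' be' f, proj (al + al') (be + be') (g * f) = g * proj al' be' f.

Lemma of_classD al be g h : of_class al be g -> of_class al be h -> of_class al be (g + h).
Proof. by move=> hg hh al' be' f; rewrite !mulrDl projD hg hh. Qed.

Lemma of_classM al be al' be' g h : of_class al be g -> of_class al' be' h ->
  of_class (al + al') (be + be') (g * h).
Proof. by move=> hg hh x y f; rewrite -!mulrA -!addnA hg hh. Qed.

Lemma of_class_congr al be al' be' g : (al = al' %[mod (4 * n)])%N -> (be = be' %[mod (4 * n + 2)])%N ->
  of_class al be g -> of_class al' be' g.
Proof.
move=> ha hb hg x y f; rewrite -hg; apply: proj_congr.
  by rewrite -modnDml -ha modnDml.
by rewrite -modnDml -hb modnDml.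
Qed.

Lemma of_classC c : of_class 0 0 c%:P%:P.
Proof.
move=> al be f; apply: poly2P => i j.
by rewrite !(coefCM, coef_proj); case: ifP => // _; rewrite mulr0.
Qed.

Lemma of_classX al be g i : of_class al be g -> of_class (al * i) (be * i) (g ^+ i).
Proof.
move=> hg; elim: i => [|i IH]; first by rewrite !muln0 expr0; exact: of_classC.
by rewrite !mulnS exprS; exact: of_classM.
Qed.

Lemma of_class_x : of_class 1 1 'X%:P.
Proof.
move=> al be f; apply: poly2P => i j.
rewrite coefCM !(coef_proj, coefXM, coefCM); case: i => [|i] /=; first by rewrite if_same.
by rewrite /in_class !addSn -(add1n (i + _)) -(add1n (i + j)) !eqn_modDl.
Qed.

Lemma of_class_y : of_class (4 * n).-1 1 'X.
Proof.
move=> al be f; apply: poly2P => i j.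
rewrite !(coef_proj, coefXM); case: j => [|j] /=; first by rewrite coef0 if_same.
rewrite /in_class mulnS addnCA (addnS i j) -(add1n (i + j)) !eqn_modDl.
by rewrite coef_proj.
Qed.

Lemma proj1 : proj 0 0 1 = 1.
Proof.
apply: poly2P => i j; rewrite coef_proj coef1; case: j => [|j] /=; last by rewrite coef0 if_same.
rewrite coef1; case: i => [|i] /=; last by rewrite if_same.
by rewrite /in_class muln0 !eqxx.
Qed.

End Projection.

Section Retraction.
Variables (k : fieldType) (n : nat).
Hypotheses (two_neq0 : (2%:R : k) != 0) (n_gt0 : (0 < n)%N).
Local Notation P := {poly {poly k}}.
Local Notation x := (cx k). Local Notation y := (cy k).
Local Notation U := (cU k n). Local Notation V := (cV k n). Local Notation W := (cW k).

(** The sign makes W, and not only U, change sign, so that A is fixed. *)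
Definition swap : {rmorphism P -> P} := ev2 (cst k) (- x) y.

Lemma swap_x : swap x = y. Proof. by rewrite /swap ev2C ev1X. Qed.
Lemma swap_y : swap y = - x. Proof. by rewrite /swap ev2X. Qed.
Lemma swap_cst c : swap (cst k c) = cst k c. Proof. by rewrite /swap ev2C ev1C. Qed.
Lemma swap_U : swap U = - U.
Proof.
by rewrite rmorphB !rmorphXn swap_x swap_y (exprM (- x)) sqrrN -exprM opprB.
Qed.
Lemma swap_V : swap V = V.
Proof.
by rewrite rmorphD !rmorphXn swap_x swap_y (exprM (- x)) sqrrN -exprM addrC.
Qed.
Lemma swap_W : swap W = - W.
Proof. by rewrite rmorphM swap_x swap_y mulrN mulrC. Qed.

Definition invariant (g : P) := of_class n 0 0 g /\ swap g = g.

Lemma invariantD g h : invariant g -> invariant h -> invariant (g + h).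
Proof. by move=> [hg sg] [hh sh]; split; [exact: of_classD | rewrite rmorphD sg sh]. Qed.
Lemma invariantM g h : invariant g -> invariant h -> invariant (g * h).
Proof. by move=> [hg sg] [hh sh]; split; [exact: (of_classM hg hh) | rewrite rmorphM sg sh]. Qed.
Lemma invariant_cst c : invariant (cst k c).
Proof. by split; [exact: of_classC | exact: swap_cst]. Qed.

Lemma of_class_U : of_class n (2 * n) (2 * n) U.
Proof.
apply: of_classD.
  by have := of_classX (2 * n) (@of_class_x k n); rewrite !mul1n.
have -> : - y ^+ (2 * n) = (-1)%:P%:P * y ^+ (2 * n) by rewrite !rmorphN1 mulN1r.
have := of_classM (of_classC n (-1 : k)) (of_classX (2 * n) (@of_class_y k n)).
rewrite !add0n mul1n; apply: of_class_congr => //.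
have -> : ((4 * n).-1 * (2 * n) = (2 * n).-1 * (4 * n) + 2 * n)%N by nia.
by rewrite modnMDl.
Qed.
Lemma of_class_V : of_class n (2 * n) (2 * n) V.
Proof.
apply: of_classD.
  by have := of_classX (2 * n) (@of_class_x k n); rewrite !mul1n.
have := of_classX (2 * n) (@of_class_y k n).
rewrite mul1n; apply: of_class_congr => //.
have -> : ((4 * n).-1 * (2 * n) = (2 * n).-1 * (4 * n) + 2 * n)%N by nia.
by rewrite modnMDl.
Qed.
Lemma of_class_W : of_class n 0 2 W.
Proof.
have := of_classM (@of_class_x k n) (@of_class_y k n); apply: of_class_congr => //.
by rewrite add1n prednK ?muln_gt0 // modnn mod0n.
Qed.

Lemma invariant_A : invariant (cA k n).
Proof.
split; last by rewrite (rmorphM _ (U * V)) (rmorphM _ U) swap_U swap_V swap_W mulrN !mulNr opprK.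
have := of_classM (of_classM of_class_U of_class_V) of_class_W; apply: of_class_congr.
  by rewrite (_ : _ + _ = 4 * n)%N ?modnn ?mod0n //; lia.
by rewrite (_ : _ + _ = 4 * n + 2)%N ?modnn ?mod0n //; lia.
Qed.
Lemma invariant_B : invariant (cB k n).
Proof.
split; last first.
  by rewrite rmorphN (rmorphM _ (U ^+ 4)) (rmorphXn _ 4) (rmorphXn _ 2) swap_U swap_W /cB; ring.
have -> : cB k n = (-1)%:P%:P * (U ^+ 4 * W ^+ 2) by rewrite !rmorphN1 mulN1r.
have := of_classM (of_classC n (-1 : k)) (of_classM (of_classX 4 of_class_U) (of_classX 2 of_class_W)).
apply: of_class_congr.
  by rewrite (_ : _ + _ = 2 * (4 * n))%N ?modnMl ?mod0n //; lia.
by rewrite (_ : _ + _ = 2 * (4 * n + 2))%N ?modnMl ?mod0n //; lia.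
Qed.
Lemma invariant_C : invariant (cC k n).
Proof.
split; last first.
  by rewrite rmorphN (rmorphM _ (V ^+ 4)) (rmorphXn _ 4) (rmorphXn _ 2) swap_V swap_W sqrrN.
have -> : cC k n = (-1)%:P%:P * (V ^+ 4 * W ^+ 2) by rewrite !rmorphN1 mulN1r.
have := of_classM (of_classC n (-1 : k)) (of_classM (of_classX 4 of_class_V) (of_classX 2 of_class_W)).
apply: of_class_congr.
  by rewrite (_ : _ + _ = 2 * (4 * n))%N ?modnMl ?mod0n //; lia.
by rewrite (_ : _ + _ = 2 * (4 * n + 2))%N ?modnMl ?mod0n //; lia.
Qed.
Lemma invariant_D : invariant (cD k n).
Proof.
have -> : cD k n = cst k ((-1) ^+ n.+1 * 4%:R^-1) * U ^+ (4 * n + 2).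
  by rewrite /cD rmorphM rmorphXn rmorphN1.
apply: invariantM; first exact: invariant_cst.
split; last by rewrite (rmorphXn _ (4 * n + 2)) swap_U exprNn -signr_odd oddD oddM /= mul1r.
have := of_classX (4 * n + 2) of_class_U; apply: of_class_congr.
  by rewrite (_ : _ * _ = (2 * n + 1) * (4 * n))%N ?modnMl ?mod0n //; lia.
by rewrite modnMl mod0n.
Qed.

Definition retract (f : P) : P :=
  cst k (2%:R^-1) * (proj n 0 0 f + swap (proj n 0 0 f)).

Lemma retractD : {morph retract : f g / f + g}.
Proof. by move=> f g; rewrite /retract projD rmorphD; ring. Qed.

Lemma retractM g f : invariant g -> retract (g * f) = g * retract f.
Proof.
move=> [hg sg]; rewrite /retract.
have -> : proj n 0 0 (g * f) = g * proj n 0 0 f by exact: (hg 0%N 0%N).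
by rewrite rmorphM sg -mulrDr mulrCA.
Qed.

Lemma halfE : cst k (2%:R^-1) * (1 + 1) = 1.
Proof.
by rewrite -[1 + 1]/(2%:R) -(rmorph_nat (cst k)) -rmorphM mulVf // rmorph1.
Qed.

Lemma retract1 : retract 1 = 1.
Proof. by rewrite /retract proj1 rmorph1 halfE. Qed.

End Retraction.

(** * F-regularity of the cone in odd characteristic *)

Section ConeMap.
Variables (k : fieldType) (n : nat).
Hypotheses (two_neq0 : (2%:R : k) != 0) (n_gt0 : (0 < n)%N).

Definition cone_val (i : 'I_5) : {poly {poly k}} :=
  [:: cA k n; cB k n; cC k n; cD k n; 0]`_i.

Definition cone_map : {rmorphism {mpoly int[5]} -> {poly {poly k}}} :=
  mmap intr cone_val.

Lemma cone_mapX i : (i < 5)%N ->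
  cone_map 'X_(inord i) = [:: cA k n; cB k n; cC k n; cD k n; 0]`_i.
Proof. by move=> hi; rewrite [LHS]mmapX mmap1U /cone_val inordK. Qed.

Lemma cone_map_hom : cone_hom n cone_map.
Proof. by split; rewrite !cone_mapX //=; exact: cone_rel_cover. Qed.

Lemma cone_map_invariant f : invariant n (cone_map f).
Proof.
elim/mpoly_ring_ind: f => [c|i|f g hf hg|f g hf hg].
- rewrite mpolyC_int rmorph_int -(rmorph_int (cst k)); exact: invariant_cst.
- rewrite -(inord_val i) cone_mapX //; case: i => [[|[|[|[|[|//]]]]] hi] /=.
  + exact: invariant_A.
  + exact: invariant_B.
  + exact: invariant_C.
  + exact: invariant_D.
  + by rewrite -(rmorph0 (cst k)); exact: invariant_cst.
- by rewrite rmorphD; exact: invariantD.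
- by rewrite rmorphM; exact: invariantM.
Qed.

End ConeMap.

Section PrimeField.
Variables (p n : nat).
Hypotheses (p_pr : prime p) (p_odd : odd p) (n_gt0 : (0 < n)%N).
Local Notation k := 'F_p.
Local Notation P := {poly {poly k}}.
Local Notation x := (cx k). Local Notation y := (cy k).
Local Notation U := (cU k n). Local Notation V := (cV k n). Local Notation W := (cW k).

Lemma two_neq0 : (2%:R : k) != 0.
Proof.
clear n_gt0.
have pF : p \in [pchar k] by exact: pchar_Fp.
rewrite -(dvdn_pcharf pF); apply: contraL p_odd => /dvdn_leq h.
have := prime_gt1 p_pr; have := h isT.
by move=> le2 lt1; have -> : p = 2%N by lia.
Qed.

Definition in_image (g : P) := exists f, cone_map k n f = g.

Lemma in_imageD g h : in_image g -> in_image h -> in_image (g + h).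
Proof. by move=> [f <-] [f' <-]; exists (f + f'); rewrite rmorphD. Qed.
Lemma in_imageM g h : in_image g -> in_image h -> in_image (g * h).
Proof. by move=> [f <-] [f' <-]; exists (f * f'); rewrite rmorphM. Qed.
Lemma in_imageN g : in_image g -> in_image (- g).
Proof. by move=> [f <-]; exists (- f); rewrite rmorphN. Qed.
Lemma in_image1 : in_image 1. Proof. by exists 1; rewrite rmorph1. Qed.
Lemma in_image_cst c : in_image (cst k c).
Proof. by exists (c : nat)%:R; rewrite rmorph_nat -[in RHS](natr_Zp c) rmorph_nat. Qed.
Lemma in_imageX i : (i < 5)%N -> in_image [:: cA k n; cB k n; cC k n; cD k n; 0]`_i.
Proof. by move=> hi; exists 'X_(inord i); exact: cone_mapX. Qed.

(** 2 x^(2n) = V + U and 2 y^(2n) = V - U, so [gen_symmetric] applies after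
    division by a power of 2. *)
Lemma in_image_symmetric j l m : (n * (2 * l) + j = (2 * n).+1 * m)%N ->
  in_image (W ^+ j * (x ^+ (2 * n) ^+ (2 * l) + (-1) ^+ j * y ^+ (2 * n) ^+ (2 * l))).
Proof.
move=> h; pose half := cst k 2%:R^-1.
have halfK : half * 2%:R = 1 by exact: (halfE two_neq0).
have -> : W ^+ j * (x ^+ (2 * n) ^+ (2 * l) + (-1) ^+ j * y ^+ (2 * n) ^+ (2 * l)) =
    half ^+ (2 * l) * (W ^+ j * ((V + U) ^+ (2 * l) + (-1) ^+ j * (V - U) ^+ (2 * l))).
  have -> : V + U = 2%:R * x ^+ (2 * n) by rewrite /cV /cU; ring.
  have -> : V - U = 2%:R * y ^+ (2 * n) by rewrite /cV /cU; ring.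
  rewrite !(exprMn (2 * l)).
  have hX : half ^+ (2 * l) * 2%:R ^+ (2 * l) = 1 by rewrite -exprMn halfK expr1n.
  move: (half ^+ _) (2%:R ^+ _) hX (W ^+ j) ((-1) ^+ j) => a b ab w s.
  move: (_ ^+ _ ^+ _) (_ ^+ _ ^+ _) => u v.
  transitivity (a * b * (w * (v + s * u))); last by ring.
  by rewrite ab mul1r.
apply: in_imageM; first by apply: SubX; [exact: in_image1 | exact: in_imageM | exact: in_image_cst].
apply: (gen_symmetric (e := quarter k) _ _ _ _ _ _ _ _ _ _ _ h).
- exact: (quarterE two_neq0).
- exact: cVU.
- exact: in_image1.
- exact: in_imageD.
- exact: in_imageN.
- exact: in_imageM.
- exact: in_image_cst.
- exact: (@in_imageX 0).
- by rewrite -[_ * _]opprK; apply: in_imageN; exact: (@in_imageX 1).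
- by rewrite -[_ * _]opprK; apply: in_imageN; exact: (@in_imageX 2).
- have -> : U ^+ (4 * n + 2) = cst k ((-1) ^+ n.+1 * 4%:R) * cD k n.
    have q := quarterE two_neq0.
    rewrite /cD rmorphM rmorphXn rmorphN1 rmorph_nat.
    set s : P := (-1) ^+ n.+1; have ss : s * s = 1 by rewrite -expr2 sqrr_sign.
    transitivity (s * s * (4%:R * quarter k) * U ^+ (4 * n + 2)); last by ring.
    by rewrite ss q !mul1r.
  by apply: in_imageM; [exact: in_image_cst | exact: (@in_imageX 3)].
Qed.

(** If i - j = 4nl with l >= 0, then up to a factor 1/2 the retraction of x^i y^j
    is W^j (X^(2l) + (-1)^j Y^(2l)) with X = x^(2n), Y = y^(2n); the case i < j is
    symmetric. *)
Lemma retract_monomial i j : in_image (retract n (x ^+ i * y ^+ j)).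
Proof.
rewrite /retract.
have -> : proj n 0 0 (x ^+ i * y ^+ j) = if in_class n 0 0 i j then x ^+ i * y ^+ j else 0.
  have xyE i' j' : (x ^+ i * y ^+ j)`_j'`_i' = ((j' == j) && (i' == i))%:R.
    rewrite /cx /cy -rmorphXn coefCM coefXn; case: eqP => _; last by rewrite mulr0 coef0.
    by rewrite mulr1 coefXn.
  apply: poly2P => i' j'; rewrite coef_proj (fun_if (fun f : P => f`_j'`_i')) !coef0 xyE.
  case: eqP => [->|_]; last by rewrite !if_same.
  by case: eqP => [->|_] //=; rewrite !if_same.
case: ifP => [|_]; last first.
  by rewrite rmorph0 addr0 mulr0; rewrite -(rmorph0 (cst k)); exact: in_image_cst.
move=> /andP[h1 h2]; apply: in_imageM; first exact: in_image_cst.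
rewrite rmorphM !rmorphXn swap_x swap_y [(- x) ^+ j]exprNn.
have /dvdnP[m hm] : (4 * n + 2 %| i + j)%N by rewrite /dvdn (eqP h2) mod0n.
have /dvdnP[q hq] : (4 * n %| i + (4 * n).-1 * j)%N by rewrite /dvdn (eqP h1) mod0n.
have hq' : (i + 4 * n * j = q * (4 * n) + j)%N.
  have : ((4 * n).-1 * j + j = 4 * n * j)%N by rewrite -mulSnr prednK ?muln_gt0.
  lia.
have {hq'} hq' : (i + 4 * (n * j) = 4 * (n * q) + j)%N by lia.
have par : odd i = odd j by move: (n * j)%N (n * q)%N hq' => u v hq'; clear -hq'; lia.
have [le_ji|lt_ij] := leqP j i.
  have [l hl] : exists l, (i = j + 4 * n * l)%N.
    exists (q - j)%N; rewrite -mulnA mulnBr mulnBr; clear -hq' le_ji; lia.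
  have hjl : (n * (2 * l) + j = (2 * n).+1 * m)%N by clear -hl hm; lia.
  have := in_image_symmetric hjl; congr in_image.
  rewrite hl exprD -!exprM (_ : 2 * n * (2 * l) = 4 * n * l)%N ?exprD /cW ?exprMn; last by lia.
  by ring.
have [l hl] : exists l, (j = i + 4 * n * l)%N.
  exists (j - q)%N; rewrite -mulnA mulnBr mulnBr; clear -hq' lt_ij; lia.
have hil : (n * (2 * l) + i = (2 * n).+1 * m)%N by clear -hl hm; lia.
have -> : (-1) ^+ j = (-1) ^+ i :> P by rewrite -signr_odd -par signr_odd.
set s : P := (-1) ^+ i; have ss : s * s = 1 by rewrite -expr2 sqrr_sign.
have -> : x ^+ i * y ^+ j + y ^+ i * (s * x ^+ j) =
    s * (W ^+ i * (x ^+ (2 * n) ^+ (2 * l) + s * y ^+ (2 * n) ^+ (2 * l))).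
  rewrite hl (exprD y) (exprD x) -(exprM x) -(exprM y) (_ : 2 * n * (2 * l) = 4 * n * l)%N; last by lia.
  rewrite /cW exprMn.
  transitivity (s * x ^+ i * y ^+ i * x ^+ (4 * n * l) +
    s * s * x ^+ i * y ^+ i * y ^+ (4 * n * l)); last by ring.
  by rewrite ss; ring.
apply: in_imageM (in_image_symmetric hil).
by rewrite /s -(rmorphN1 (cst k)) -rmorphXn; exact: in_image_cst.
Qed.

Lemma retract_in_image f : in_image (retract n f).
Proof.
suff mono g i j : in_image (retract n ((g * 'X ^+ i)%:P * 'X ^+ j)).
  have : forall j, in_image (retract n (f * 'X ^+ j)).
    elim/poly_ind: f => [|f c IH] j.
      rewrite mul0r -(mul0r ('X ^+ 0)) -(polyC0 _) -(mul0r ('X ^+ 0)); exact: mono.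
    rewrite mulrDl retractD -mulrA -exprS; apply: in_imageD => //.
    by rewrite -[c]mulr1 -(expr0 'X); exact: mono.
  by move=> /(_ 0%N); rewrite expr0 mulr1.
elim/poly_ind: g i => [|g c IH] i.
  have -> : (0 * 'X ^+ i)%:P * 'X ^+ j = cst k 0 * (1 : P) by rewrite mul0r !rmorph0 !mul0r.
  rewrite retractM; last exact: invariant_cst.
  rewrite rmorph0 mul0r -(rmorph0 (cst k)); exact: in_image_cst.
rewrite mulrDl polyCD mulrDl retractD; apply: in_imageD.
  by rewrite -mulrA -exprS.
have -> : (c%:P * 'X ^+ i)%:P * 'X ^+ j = cst k c * (x ^+ i * y ^+ j).
  by rewrite polyCM mulrA /cx -rmorphXn.
rewrite retractM; last exact: invariant_cst.
by apply: in_imageM; [exact: in_image_cst | exact: retract_monomial].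
Qed.

Definition cone_ideal : idealr {mpoly int[5]} := ker_ideal (cone_map k n).
Local Notation S := {ideal_quot cone_ideal}.

Lemma cone_ideal_kills f : f \in cone_ideal -> cone_map k n f = 0.
Proof. by rewrite ker_idealE => /eqP. Qed.

Definition cone_embed : {rmorphism S -> P} := quot_lift cone_ideal_kills.

Lemma cone_embed_inj : injective cone_embed.
Proof. by apply: quot_lift_inj => f; rewrite ker_idealE => ->. Qed.

Theorem cone_F_regular : F_regular S.
Proof.
have ex f : exists s : S, cone_embed s = retract n f.
  have [g gE] := retract_in_image f.
  by exists (quot_map cone_ideal g); rewrite quot_liftE.
have [rho rhoE] := choice ex.
have pS : p \in [pchar S].
  apply/andP; split=> //; apply/eqP; apply: cone_embed_inj.
  rewrite rmorph_nat rmorph0; apply/eqP; rewrite -[_%:R](rmorph_nat (cst k)).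
  by rewrite (pcharf0 (pchar_Fp p_pr)) rmorph0.
apply: (@F_regular_of_retract p p_pr S pS cone_embed rho cone_embed_inj).
- by move=> f g; apply: cone_embed_inj; rewrite rmorphD !rhoE retractD.
- move=> s f; apply: cone_embed_inj; rewrite rmorphM !rhoE retractM //.
  have [f' <-] := quot_map_surj s; rewrite quot_liftE.
  by apply: cone_map_invariant; rewrite ?two_neq0.
have h : cone_embed (rho 1) = cone_embed 1.
  by rewrite rmorph1 rhoE; apply: retract1; exact: two_neq0.
exact: cone_embed_inj h.
Qed.

End PrimeField.

(** * Free modules and tensor products over the integers *)

Lemma free_of_family (A : comNzRingType) (M : lmodType A) (I : eqType) (v : I -> M) :
  (forall x, exists l : seq (A * I), x = \sum_(u <- l) u.1 *: v u.2) ->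
  (forall (s : seq I) (c : I -> A), uniq s -> \sum_(i <- s) c i *: v i = 0 ->
     forall i, i \in s -> c i = 0) ->
  free_module M.
Proof.
move=> v_span v_free.
have v_inj : injective v.
  move=> i j vij; apply/eqP/contraT => neq_ij.
  have /(_ i) : forall i', i' \in [:: i; j] -> (if i' == i then 1 else -1 : A) = 0.
    apply: v_free; first by rewrite /= inE neq_ij.
    rewrite !big_cons big_nil addr0 eqxx eq_sym (negPf neq_ij) scale1r scaleN1r vij.
    exact: subrr.
  by rewrite mem_head eqxx => /(_ isT)/eqP; rewrite oner_eq0.
have [i0|noI] := EM (exists i : I, True); last first.
  exists (fun=> False); split=> [x|s c _ sF _ b /sF //].
  exists [::], (fun=> 0); split=> //; have [[|[a i] l] ->] := v_span x.
    by rewrite !big_nil.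
  by case: noI; exists i.
have inv_ex b : exists j, (exists i, b = v i) -> v j = b.
  have [[i ->]|nb] := EM (exists i, b = v i); first by exists i.
  by have [i _] := i0; exists i.
have [inv invP] := choice inv_ex.
have vK i : inv (v i) = i by apply: v_inj; rewrite invP //; exists i.
exists (fun b => exists i, b = v i); split=> [x|s c us sv e b bs].
  have [l ->] := v_span x.
  pose c i := \sum_(u <- l | u.2 == i) u.1.
  exists (map v (undup (map snd l))), (c \o inv); split.
    by move=> b /mapP[i _ ->]; exists i.
  rewrite big_map; under [RHS]eq_bigr do rewrite /= vK /c scaler_suml.
  rewrite (exchange_big_dep xpredT) //=; apply: eq_big_seq => u ul.
  rewrite (big_rem u.2) /= ?mem_undup ?map_f // eqxx big1_seq ?addr0 // => i.
  by rewrite rem_filter ?undup_uniq // mem_filter /= => /andP[/eqP <-]; rewrite eqxx.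
have := v_free (map inv s) (c \o v); rewrite big_map => /(_ _ _ (inv b)).
rewrite /= invP; last exact: sv.
apply; last exact: map_f.
  rewrite map_inj_in_uniq // => b1 b2 /sv h1 /sv h2 e'.
  by rewrite -(invP b1) // -(invP b2) // e'.
rewrite -[RHS]e; apply: eq_big_seq => b' /sv hb.
by rewrite invP.
Qed.

Lemma int_scaleE (M : lmodType int) (a : int) (x : M) : a *: x = x *~ a.
Proof. by rewrite -[X in X *: _]intz scaler_int. Qed.

Lemma morphMz (V W : zmodType) (f : V -> W) : {morph f : x y / x + y} ->
  forall (a : int) x, f (x *~ a) = f x *~ a.
Proof.
move=> fD a x.
have f0 : f 0 = 0 by apply: (addrI (f 0)); rewrite -fD !addr0.
have fN z : f (- z) = - f z by apply: (addrI (f z)); rewrite -fD !subrr.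
have fMn z (j : nat) : f (z *+ j) = f z *+ j.
  by elim: j => [|j IH]; rewrite ?mulr0n // !mulrS fD IH.
by case: a => j; [exact: fMn | rewrite NegzE !mulrNz fN -!pmulrn fMn].
Qed.

Lemma int_linear (M N : lmodType int) (f : M -> N) :
  {morph f : x y / x + y} -> linear f.
Proof. by move=> fD a x y; rewrite fD !int_scaleE morphMz. Qed.

Section TensorRat.
Variables (M : lmodType int) (R : comNzRingType) (structK : {rmorphism rat -> R}).
Let iota : {rmorphism int -> rat} := intr.
Local Notation T := (restrict (structK \o iota)).
Variable theta : M -> R.
Hypotheses (thetaD : {morph theta : x y / x + y}) (theta_inj : injective theta).
Hypothesis theta_den : forall y, exists (N : nat) x, (0 < N)%N /\ theta x = y *+ N.

Definition tau_rat (x : M) (q : restrict iota) : T := structK (q : rat) * theta x.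

Lemma tau_ratl q : linear (tau_rat^~ q).
Proof. by apply: int_linear => x y; rewrite /tau_rat thetaD mulrDr. Qed.
Lemma tau_ratr x : linear (tau_rat x).
Proof. by apply: int_linear => q q'; rewrite /tau_rat rmorphD mulrDl. Qed.

(** An element y of R is theta x / N for some x and N, and the linear map that
    corresponds to beta must send it to beta(x, 1/N); injectivity of theta makes
    this independent of the choices. *)
Lemma tensor_rat : is_tensor (mk_bilinear tau_ratl tau_ratr).
Proof.
move=> Z beta.
have thetaMn x (j : nat) : theta (x *+ j) = theta x *+ j by exact: (morphMz thetaD j).
pose rep (y : T) (z : Z) := exists (N : nat) x,
  [/\ (0 < N)%N, theta x = (y : R) *+ N & z = beta x (N%:R^-1 : rat)].
have nz (N : nat) : (0 < N)%N -> (N%:R : rat) != 0 by rewrite pnatr_eq0 lt0n.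
have beta_scale x (q : rat) (N : nat) : beta x (q *+ N : rat) = beta (x *+ N) q.
  by rewrite linearMnl -linearMnr.
have rep_uniq y z z' : rep y z -> rep y z' -> z = z'.
  move=> [N [x [N0 ex ->]]] [N' [x' [N0' ex' ->]]].
  have e : x *+ N' = x' *+ N by apply: theta_inj; rewrite !thetaMn ex ex' mulrnAC.
  have -> : (N%:R^-1 : rat) = (N%:R * N'%:R)^-1 *+ N'.
    by rewrite -[RHS]mulr_natr invfM mulfVK ?nz.
  rewrite [X in X = _]beta_scale e -beta_scale; congr (beta x' _).
  by rewrite -[LHS]mulr_natr mulrC invfM mulrA mulfV ?nz // mul1r.
have rep_ex y : exists z, rep y z.
  by have [N [x [N0 e]]] := theta_den y; exists (beta x (N%:R^-1 : rat)), N, x.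
have [g gP] := choice rep_ex.
have gD : {morph g : y y' / y + y'}.
  move=> y y'; apply: (rep_uniq (y + y')); first exact: gP.
  have [N [x [N0 ex ->]]] := gP y; have [N' [x' [N0' ex' ->]]] := gP y'.
  exists (N * N')%N, (x *+ N' + x' *+ N); split; first by rewrite muln_gt0 N0.
    by rewrite thetaD !thetaMn ex ex' mulrnDl -!mulrnA [(N' * N)%N]mulnC.
  rewrite linearDl -!beta_scale; congr (beta _ _ + beta _ _).
    by rewrite natrM -[RHS]mulr_natr invfM mulfVK ?nz.
  by rewrite natrM -[RHS]mulr_natr mulrC invfM mulrA mulfV ?nz // mul1r.
exists (mk_linear (int_linear gD)); split=> [x q /=|g' g'E y].
  apply: (rep_uniq (tau_rat x q)); first exact: gP.
  exists `|denq q|%N, (x *~ numq q); rewrite absz_gt0 denq_neq0.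
  have dE : (`|denq q|%N)%:R = (denq q)%:~R :> rat.
    by rewrite natr_absz gtr0_norm ?denq_gt0.
  split=> //.
    rewrite (morphMz thetaD) /tau_rat -mulrnAl -rmorphMn -mulr_natr dE -numqE.
    by rewrite rmorph_int mulrzl.
  have -> : x *~ numq q = (numq q) *: x by rewrite int_scaleE.
  rewrite linearZl_LR -linearZr_LR; congr (beta x _).
  by rewrite -[RHS]/((numq q)%:~R * _) dE divq_num_den.
apply: (rep_uniq y); last exact: gP.
have [N [x [N0 ex _]]] := gP y; exists N, x; split=> //; rewrite -g'E /=; congr (g' _).
rewrite /tau_rat ex -(mulr_natl (y : R)) mulrA -(rmorph_nat structK N) -rmorphM mulVf ?nz //.
by rewrite rmorph1 mul1r.
Qed.

End TensorRat.

Section TensorQuotient.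
Variables (A : comNzRingType) (mu : idealr A) (M B : lmodType A) (pi : {linear M -> B}).
Hypothesis pi_surj : forall y, exists x, pi x = y.
Hypothesis pi_ker : forall x, pi x = 0 -> exists a x', a \in mu /\ x = a *: x'.
Hypothesis mu_kills : forall a y, a \in mu -> a *: (y : B) = 0.

Definition tau_quot (x : M) (q : restrict (quot_map mu)) : B :=
  (repr (q : {ideal_quot mu})) *: pi x.

Lemma tau_quotE x a : tau_quot x (quot_map mu a) = a *: pi x.
Proof.
apply/eqP; rewrite -subr_eq0 -scalerBl; apply/eqP/mu_kills/quot_map_eq; exact: reprK.
Qed.

Lemma tau_quotl q : linear (tau_quot^~ q).
Proof.
move=> a x y; have [b <-] := quot_map_surj q; rewrite !tau_quotE linearP scalerDr !scalerA.
by rewrite mulrC.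
Qed.
Lemma tau_quotr x : linear (tau_quot x).
Proof.
move=> a q q'; have [b <-] := quot_map_surj q; have [b' <-] := quot_map_surj q'.
have -> : a *: (quot_map mu b : restrict (quot_map mu)) + quot_map mu b' =
    quot_map mu (a * b + b') by rewrite rmorphD rmorphM.
by rewrite !tau_quotE scalerDl scalerA.
Qed.

(** B is M / mu M, because the kernel of pi consists of multiples by elements of
    mu and mu kills B. *)
Lemma tensor_quotient : is_tensor (mk_bilinear tau_quotl tau_quotr).
Proof.
move=> Z beta; pose one : restrict (quot_map mu) := 1.
have smul a : a *: one = quot_map mu a by exact: mulr1.
have wd x x' : pi x = pi x' -> beta x one = beta x' one.
  move=> e; have /pi_ker[a [z [amu xE]]] : pi (x - x') = 0 by rewrite raddfB /= e subrr.
  apply/eqP; rewrite -subr_eq0 -linearBl xE linearZl_LR -linearZr_LR smul.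
  by rewrite (quot_map_eq0 mu a).2 // linear0r.
have [sec secP] := choice pi_surj.
have gL : linear (fun y => beta (sec y) one).
  move=> a y y'; rewrite -linearZl_LR -linearDl; apply: wd.
  by rewrite secP linearP !secP.
exists (mk_linear gL); split=> [x q /=|g' g'E y /=].
  have [a <-] := quot_map_surj q; rewrite tau_quotE -smul linearZr_LR -linearZl_LR.
  by apply: wd; rewrite secP linearZ.
rewrite -g'E /=; congr (g' _).
by rewrite -[one](rmorph1 (quot_map mu)) tau_quotE scale1r secP.
Qed.

End TensorQuotient.

Lemma tensor_alg_quotient (A : comNzRingType) (mu : idealr A) (M B : comAlgType A)
    (pi : {linear M -> B})
    (mu_kills : forall a (y : B), a \in mu -> a *: y = 0) :
  (forall y, exists x, pi x = y) ->
  (forall x, pi x = 0 -> exists a x', a \in mu /\ x = a *: x') ->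
  pi 1 = 1 -> {morph pi : x y / x * y} ->
  is_tensor_alg (mk_bilinear (tau_quotl pi mu_kills) (tau_quotr pi mu_kills)).
Proof.
move=> pi_surj pi_ker pi1 piM; split; first exact: tensor_quotient.
  by rewrite /= -(rmorph1 (quot_map mu)) tau_quotE // scale1r pi1.
move=> b c b' c'; have [u <-] := quot_map_surj c; have [u' <-] := quot_map_surj c'.
have e : (quot_map mu u : restrict (quot_map mu)) * quot_map mu u' = quot_map mu (u * u').
  by rewrite rmorphM.
rewrite e [LHS]/= [RHS]/= !tau_quotE //.
by rewrite piM -scalerAl -scalerAr scalerA.
Qed.

(** * The integral model and its reductions *)

Lemma root_of_minus_one (k : countFieldType) (N : nat) : (0 < N)%N ->
  exists (L : fieldType) (iota : {rmorphism k -> L}) (z : L), z ^+ N = -1.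
Proof.
move=> N_gt0; have [L [iota _]] := countable_algebraic_closure k.
have /closed_rootP[z] : size ('X^N + 1%:P : {poly L}) != 1%N.
  by rewrite size_XnaddC // eqSS -lt0n.
rewrite rootE !hornerE addr_eq0 => /eqP hz.
by exists L, iota, z.
Qed.

Section Kernels.
Variable n : nat.
Hypothesis n_gt0 : (0 < n)%N.
Local Notation XX i := ('X_(inord i) : {mpoly int[5]}).
Local Notation zz H := (intr : {rmorphism int -> H}).

Lemma cone_map_normal (k : countFieldType) (two_neq0 : (2%:R : k) != 0) F G K :
  normal (zz _) (cA k n) (cB k n) (cC k n) (cD k n) F G K = 0 ->
  [/\ map_poly (map_poly (zz k)) F = 0, map_poly (map_poly (zz k)) G = 0 &
      map_poly (map_poly (zz k)) K = 0].
Proof.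
have n2 : (0 < 2 * n)%N by rewrite muln_gt0.
have [L [iota [z hz]]] := root_of_minus_one k n2.
rewrite (normal_base (iota := cst k) (j := zz k)); last by move=> c; rewrite rmorph_int.
exact: (normal_free two_neq0 n_gt0 iota hz).
Qed.

Lemma cone_map_rat_normal F G K :
  normal (zz _) (cA rat n) (cB rat n) (cC rat n) (cD rat n) F G K = 0 ->
  [/\ F = 0, G = 0 & K = 0].
Proof.
have inj (E : {poly {poly int}}) : map_poly (map_poly (zz rat)) E = 0 -> E = 0.
  move=> h; apply: (@map_inj_poly _ _ (map_poly (zz rat))); last by rewrite h rmorph0.
    by apply: map_inj_poly; [exact: intr_inj | rewrite rmorph0].
  by rewrite rmorph0.
by case/cone_map_normal => // /inj F0 /inj G0 /inj K0.
Qed.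

(** Such an f has the normal form 0, so it is killed by every morphism that
    respects the equations. *)
Lemma ker_rat_sub (f : {mpoly int[5]}) (H : comNzRingType)
    (psi : {rmorphism {mpoly int[5]} -> H}) :
  cone_map rat n f = 0 -> cone_hom n psi -> psi f = 0.
Proof.
move=> f0 gpsi; have two0 : (2%:R : rat) != 0 by [].
have [F [G [K hf]]] := normal_form n f.
have := hf _ _ (cone_map_hom n two0); rewrite f0 !cone_mapX //= => /esym.
case/cone_map_rat_normal => F0 G0 K0.
by rewrite (hf _ _ gpsi) F0 G0 K0 /normal !rmorph0 !mulr0 !addr0.
Qed.

(** The coefficients of the normal form of f are divisible by p. *)
Lemma ker_Fp_split (p : nat) (p_pr : prime p) (p_odd : odd p) (f : {mpoly int[5]}) :
  cone_map 'F_p n f = 0 -> exists h, cone_map rat n (f - h *+ p) = 0.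
Proof.
move=> f0; have [F [G [K hf]]] := normal_form n f.
have := hf _ _ (cone_map_hom n (two_neq0 p_pr p_odd)); rewrite f0 !cone_mapX //= => /esym.
case/(cone_map_normal (two_neq0 p_pr p_odd)) => F0 G0 K0.
have div (E : {poly {poly int}}) : map_poly (map_poly (zz 'F_p)) E = 0 ->
    exists E', E = E' *+ p.
  move=> h; exists (\poly_(i < size E) \poly_(j < size E`_i) (E`_i`_j %/ p)%Z).
  apply: poly2P => j i; rewrite !coefMn !coef_poly.
  case: ltnP => hi; last by rewrite [E`_i]nth_default ?coef0 ?mul0rn.
  rewrite coef_poly; case: ltnP => hj; last by rewrite [X in X = _]nth_default // mul0rn.
  have := congr1 (fun q : {poly {poly 'F_p}} => q`_i`_j) h.
  rewrite !coef_map /= !coef0 => e.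
  have : (p %| E`_i`_j)%Z.
    by rewrite (dvdz_pcharf (pchar_Fp p_pr)) e.
  by move=> d; rewrite -[RHS]mulr_natr natz divzK.
have [F' FE] := div _ F0; have [G' GE] := div _ G0; have [K' KE] := div _ K0.
exists (normal (zz _) (XX 0) (XX 1) (XX 2) (XX 3) F' G' K').
have two0 : (2%:R : rat) != 0 by [].
have gQ := cone_map_hom n two0 : cone_hom n (cone_map rat n).
rewrite rmorphB rmorphMn hf // (normal_map (iota' := zz _)); last by move=> c; rewrite rmorph_int.
by rewrite FE GE KE /normal !rmorphMn !mulrnAr -!mulrnDl subrr.
Qed.

End Kernels.

(** * The odd primes are dense in the spectrum of Z *)

Section PrimeIdealZ.
Variables (p : nat) (p_pr : prime p).

Definition prime_int_pred (_ : prime p) : int -> bool := fun x => (p %| x)%Z.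

Lemma prime_int_closed : idealr_closed (prime_int_pred p_pr : {pred int}).
Proof.
split=> [||a x y]; rewrite -!topredE /= /prime_int_pred ?dvdz0 //.
  by rewrite dvdzE /= dvdn1; apply: contraTneq p_pr => ->.
by move=> hx hy; rewrite rpredD // dvdz_mull.
Qed.
Lemma prime_int_prime : prime_idealr_closed (prime_int_pred p_pr : {pred int}).
Proof. by move=> u v; rewrite -!topredE /= /prime_int_pred !dvdzE abszM Euclid_dvdM. Qed.

HB.instance Definition _ := isIdealr.Build int (prime_int_pred p_pr) prime_int_closed.
HB.instance Definition _ := isPrimeIdealrClosed.Build int (prime_int_pred p_pr) prime_int_prime.

Definition prime_int : prime_idealr int := prime_int_pred p_pr.

Lemma prime_intE x : (x \in prime_int) = (p %| x)%Z. Proof. by []. Qed.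

Lemma prime_int_maximal : maximal_ideal prime_int.
Proof.
move=> J sJ x xJ; rewrite prime_intE; apply: contraT => p_x.
have /coprimezP[[u v] /= huv] : coprimez x p%:Z.
  by rewrite /coprimez /gcdz /= gcdnC; rewrite dvdzE /= -prime_coprime in p_x.
have : (1 : int) \in J.
  rewrite -huv; apply: rpredD; apply: idealMr => //.
  by apply: sJ; rewrite prime_intE dvdzz.
by rewrite idealr1.
Qed.

End PrimeIdealZ.

Definition odd_primes (mu : prime_idealr int) : Prop :=
  exists (p : nat) (p_pr : prime p), odd p /\ mu = prime_int p_pr.

Lemma odd_primes_dense : zariski_dense odd_primes.
Proof.
move=> J hJ P x Jx; suff -> : x = 0 by exact: idealr0.
have [p hp p_pr] := prime_above (maxn `|x| 2).
have p_odd : odd p.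
  by case: (even_prime p_pr) hp => // ->; lia.
have : x \in prime_int p_pr by apply: hJ => //; exists p, p_pr.
rewrite prime_intE dvdzE /= => /dvdn_leq h; apply/eqP; rewrite -absz_eq0.
by apply: contraT; rewrite -lt0n => /h; lia.
Qed.

(** * The integral model is free *)

Section Model.
Variable n : nat.
Hypothesis n_gt0 : (0 < n)%N.
Local Notation XX i := ('X_(inord i) : {mpoly int[5]}).
Local Notation zz H := (intr : {rmorphism int -> H}).
Let two0 : (2%:R : rat) != 0. Proof. by []. Qed.

Definition int_ideal : idealr {mpoly int[5]} := ker_ideal (cone_map rat n).
Local Notation I0 := int_ideal.
Definition int_model : comAlgType int := restrict (quot_map I0 \o @mpolyC 5 int).
Local Notation RA0 := int_model.

Lemma int_ideal_kills f : f \in I0 -> cone_map rat n f = 0.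
Proof. by rewrite ker_idealE => /eqP. Qed.

Definition int_embed : {rmorphism {ideal_quot I0} -> {poly {poly rat}}} :=
  quot_lift int_ideal_kills.

Lemma int_embed_inj : injective int_embed.
Proof. by apply: quot_lift_inj => f; rewrite ker_idealE => ->. Qed.

Lemma cone_hom_quot : cone_hom n (quot_map I0).
Proof.
have [[r1 r2 r3] r4] := cone_map_hom n two0.
split; last by apply: int_embed_inj; rewrite quot_liftE r4 rmorph0.
by split; apply: int_embed_inj; rewrite !(rmorphB, rmorphM, rmorphXn) !quot_liftE.
Qed.

(** Coefficients of normal forms: [assemble] is a bijection from triples to the
    model, which carries the evident basis of triples to the required basis. *)
Definition triple : zmodType :=
  ({poly {poly int}} * {poly {poly int}} * {poly {poly int}})%type.

Definition assemble (E : triple) : RA0 :=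
  normal (zz {ideal_quot I0}) (quot_map I0 (XX 0)) (quot_map I0 (XX 1))
    (quot_map I0 (XX 2)) (quot_map I0 (XX 3)) E.1.1 E.1.2 E.2.

Lemma assembleD : {morph assemble : E E' / E + E'}.
Proof. by move=> E E'; rewrite /assemble /normal !rmorphD /=; ring. Qed.

Lemma assemble_surj x : exists E, assemble E = x.
Proof.
have [f <-] := quot_map_surj x; have [F [G [K hf]]] := normal_form n f.
by exists (F, G, K); rewrite hf //; exact: cone_hom_quot.
Qed.

Lemma assemble_inj0 E : assemble E = 0 -> E = 0.
Proof.
case: E => [[F G] K] /(congr1 int_embed).
rewrite (normal_map (iota' := zz _)); last by move=> c; rewrite rmorph_int.
rewrite rmorph0 !quot_liftE !cone_mapX //= => /(cone_map_rat_normal n_gt0)[-> -> ->].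
by [].
Qed.

Definition mono2 (i j : nat) : {poly {poly int}} := ('X ^+ j)%:P * 'X ^+ i.

Definition unit_triple (u : 'I_3 * (nat * nat)) : triple :=
  let f := mono2 u.2.1 u.2.2 in
  if val u.1 is k.+1 then (if k is 0 then (0, f, 0) else (0, 0, f)) else (f, 0, 0).

Definition coef_triple (u : 'I_3 * (nat * nat)) (E : triple) : int :=
  (if val u.1 is k.+1 then (if k is 0 then E.1.2 else E.2) else E.1.1)`_u.2.1`_u.2.2.

Lemma coef_mon i j i' j' : (mono2 i j)`_i'`_j' = ((i' == i) && (j' == j))%:R.
Proof.
rewrite /mono2 coefCM coefXn; case: eqP => _; last by rewrite mulr0 coef0.
by rewrite mulr1 coefXn.
Qed.

Lemma coef_unit u u' : coef_triple u (unit_triple u') = (u == u')%:R.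
Proof.
case: u u' => [t [i j]] [t' [i' j']]; rewrite /coef_triple /unit_triple /= !xpair_eqE.
have -> : (t == t') = (val t == val t') by [].
case: t => [[|[|[|//]]] ht]; case: t' => [[|[|[|//]]] ht'] //=;
by rewrite ?coef0 ?coef_mon.
Qed.

Lemma coef_tripleD u : {morph coef_triple u : E E' / E + E'}.
Proof. by move=> E E'; rewrite /coef_triple; case: (val u.1) => [|[|k]]; rewrite /= !coefD. Qed.

Lemma triple_span E : exists l : seq (int * ('I_3 * (nat * nat))),
  E = \sum_(u <- l) unit_triple u.2 *~ u.1.
Proof.
pose Q (E : triple) := exists l : seq (int * ('I_3 * (nat * nat))),
  E = \sum_(u <- l) unit_triple u.2 *~ u.1.
have Q0 : Q 0 by exists [::]; rewrite big_nil.
have QD E1 E2 : Q E1 -> Q E2 -> Q (E1 + E2).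
  by move=> [l ->] [l' ->]; exists (l ++ l'); rewrite big_cat.
have Qu c u : Q (unit_triple u *~ c) by exists [:: (c, u)]; rewrite big_seq1.
have expand (inj : {poly {poly int}} -> triple) (t : 'I_3) F :
    inj 0 = 0 -> {morph inj : F G / F + G} ->
    (forall i j, inj (mono2 i j) = unit_triple (t, (i, j))) -> Q (inj F).
  move=> inj0 injD inju; rewrite -[F]coefK poly_def.
  elim/big_rec: _ => [|i G _ QG]; first by rewrite inj0.
  rewrite injD; apply: (QD) => //; rewrite -[F`_i]coefK poly_def scaler_suml.
  elim/big_rec: _ => [|j H _ QH]; first by rewrite inj0.
  rewrite injD; apply: (QD) => //.
  have -> : (F`_i`_j *: 'X ^+ j) *: 'X ^+ i = mono2 i j *~ F`_i`_j.
    rewrite /mono2 -mulrzAl -[LHS]mul_polyC; congr (_ * _); rewrite -rmorphMz; congr (_%:P).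
    by rewrite -[X in X *: _]intz scaler_int.
  by rewrite (morphMz injD) inju.
rewrite -/(Q E); case: E => [[F G] K].
have -> : (F, G, K) = ((F, 0, 0) : triple) + ((0, G, 0) : triple) + ((0, 0, K) : triple).
  by congr (_, _, _); rewrite /= ?addr0 ?add0r.
apply: (QD); first apply: (QD).
- apply: (expand (fun F => (F, 0, 0)) ord0) => // F1 F2.
  by congr (_, _, _); rewrite /= addr0.
- apply: (expand (fun G => (0, G, 0)) 1) => // F1 F2.
  by congr (_, _, _); rewrite /= addr0.
- apply: (expand (fun K => (0, 0, K)) ord_max) => // F1 F2.
  by congr (_, _, _); rewrite /= addr0.
Qed.

Lemma int_model_free : free_module RA0.
Proof.
apply: (@free_of_family _ _ _ (fun u => assemble (unit_triple u))) => [x|s c us e u us'].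
  have [E <-] := assemble_surj x; have [l ->] := triple_span E; exists l.
  elim: l => [|[c u] l IH]; first by rewrite !big_nil; apply: (addrI (assemble 0)); rewrite -assembleD !addr0.
  by rewrite !big_cons assembleD IH int_scaleE (morphMz assembleD).
have E0 : \sum_(u <- s) unit_triple u *~ c u = 0.
  apply: assemble_inj0; rewrite -[RHS]e.
  elim: (s) => [|v l IH]; first by rewrite !big_nil; apply: (addrI (assemble 0)); rewrite -assembleD !addr0.
  by rewrite !big_cons assembleD IH int_scaleE (morphMz assembleD).
have c0 : coef_triple u 0 = 0 by apply: (addrI (coef_triple u 0)); rewrite -coef_tripleD !addr0.
have := congr1 (coef_triple u) E0; rewrite c0.
have -> : coef_triple u (\sum_(v <- s) unit_triple v *~ c v) = \sum_(v <- s) (v == u)%:R *~ c v.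
  elim: (s) => [|v l IH]; first by rewrite !big_nil.
  by rewrite !big_cons coef_tripleD IH (morphMz (@coef_tripleD u)) coef_unit eq_sym.
rewrite (big_rem u) //= eqxx big1_seq ?addr0 => [|v /andP[_]].
  by rewrite -[_ *~ _]/(1%:~R *~ _) intz => <-; rewrite intz.
by rewrite mem_rem_uniq // inE => /andP[/negPf-> _]; rewrite mul0rz.
Qed.

End Model.

(** * F-regular type of R/tR *)

Section ReductionModT.
Variables (m n : nat).
Hypotheses (m_gt0 : (0 < m)%N) (n_gt0 : (0 < n)%N).
Local Notation XX i := ('X_(inord i) : {mpoly int[5]}).
Local Notation XQ i := ('X_(inord i) : {mpoly rat[5]}).
Let two0 : (2%:R : rat) != 0. Proof. by []. Qed.

Definition cone_map_rat : {rmorphism {mpoly rat[5]} -> {poly {poly rat}}} :=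
  mmap (cst rat) (cone_val rat n).

Lemma cone_map_ratE f : cone_map_rat (map_mpoly intr f) = cone_map rat n f.
Proof.
apply: (@mpolyZ_rmorph_ext _ _ (cone_map_rat \o map_mpoly intr) (cone_map rat n)) => i.
transitivity (cone_map_rat (map_mpoly intr 'X_i)) => //.
by rewrite map_intr_mpolyX [LHS]mmapX mmap1U [RHS]mmapX mmap1U.
Qed.

Lemma cone_map_ratX i : (i < 5)%N ->
  cone_map_rat (XQ i) = [:: cA rat n; cB rat n; cC rat n; cD rat n; 0]`_i.
Proof. by move=> hi; rewrite [LHS]mmapX mmap1U /cone_val inordK. Qed.

Lemma minor_rel_cone (B : comNzRingType) (a b c d : B) :
  minor_rel m n a b c d 0 <-> cone_rel n a b c d.
Proof.
have z : (0 : B) ^+ m = 0 by rewrite expr0n gtn_eqF.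
rewrite /minor_rel /cone_rel z addr0 (exprS b n); split=> [[r1 r2 r3]|[r1 r2 r3]].
  split.
  - by rewrite -r1; ring.
  - by rewrite -r3; ring.
  - by rewrite -r2; ring.
split.
- by rewrite r1; ring.
- by rewrite r3; ring.
- by rewrite mulrBr r2; ring.
Qed.

(** The images of the variables in k[x, y] satisfy the equations of R with t = 0. *)
Lemma R_mod_t_kernel u : R_mod_t_proj m n u = 0 -> cone_map_rat u = 0.
Proof.
move=> /quot_map_eq0/in_spanE/in_span_cons[c' [_ [[e ->] ]]].
rewrite big_ord0 addr0; have [c <-] := quot_map_surj c'; move=> h.
have /R_proj_eq0 : R_proj m n (u - c * XQ 4) = 0.
  by rewrite rmorphB rmorphM; apply/eqP; rewrite subr_eq0; apply/eqP.
move=> /(rmorph_span0 (f := cone_map_rat)) h'.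
have : cone_map_rat (u - c * XQ 4) = 0.
  apply: h'; apply/minors_eq0; rewrite !cone_map_ratX //=.
  by apply/minor_rel_cone; exact: cone_rel_cover.
by rewrite rmorphB rmorphM [cone_map_rat (XQ 4)]cone_map_ratX //= mulr0 subr0.
Qed.

Definition to_R_mod_t : {rmorphism {mpoly int[5]} -> R_mod_t m n} :=
  R_mod_t_proj m n \o map_mpoly intr.

Lemma to_R_mod_tX i : to_R_mod_t (XX i) = R_mod_t_proj m n (XQ i).
Proof. by congr (R_mod_t_proj m n _); exact: map_intr_mpolyX. Qed.

Lemma to_R_mod_t_hom : cone_hom n to_R_mod_t.
Proof.
have t0 : R_mod_t_proj m n (XQ 4) = 0.
  by apply/quot_map_eq0/in_spanE; apply: in_span_mem; rewrite mem_head.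
split; last by rewrite to_R_mod_tX.
apply/minor_rel_cone; rewrite !to_R_mod_tX -t0.
apply/minors_eq0 => x xin.
have e : R_proj m n x = 0 by apply/R_proj_eq0; exact: in_span_mem.
by rewrite -[LHS]/(quot_map _ (R_proj m n x)) e rmorph0.
Qed.

Lemma to_R_mod_t_kills f : f \in int_ideal n -> to_R_mod_t f = 0.
Proof. by move=> /int_ideal_kills /ker_rat_sub h; apply: h to_R_mod_t_hom. Qed.

Definition model_map : {rmorphism {ideal_quot int_ideal n} -> R_mod_t m n} :=
  quot_lift to_R_mod_t_kills.

Lemma model_map_inj : injective model_map.
Proof.
apply: quot_lift_inj => f /R_mod_t_kernel h.
by rewrite ker_idealE -cone_map_ratE h.
Qed.

Lemma model_map_den (y : R_mod_t m n) :
  exists (N : nat) x, (0 < N)%N /\ model_map x = y *+ N.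
Proof.
have [y' <-] := quot_map_surj y; have [u <-] := quot_map_surj y'.
have [N [g [N0 e]]] := common_denominator u.
exists N, (quot_map (int_ideal n) g); split=> //.
by rewrite quot_liftE -[LHS]/(R_mod_t_proj m n (map_mpoly intr g)) -e rmorphMn.
Qed.

Section Fibers.
Variables (p : nat) (p_pr : prime p) (p_odd : odd p).

Definition fiber_alg : comAlgType int := restrict (quot_map (cone_ideal p n) \o @mpolyC 5 int).

Lemma fiber_alg_kills f : f \in int_ideal n -> quot_map (cone_ideal p n) f = 0.
Proof.
move=> /int_ideal_kills h; apply/quot_map_eq0; rewrite ker_idealE.
by apply/eqP; apply: (ker_rat_sub n_gt0 h); apply: cone_map_hom; exact: two_neq0.
Qed.

Definition to_fiber_alg : {rmorphism {ideal_quot int_ideal n} -> {ideal_quot cone_ideal p n}} :=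
  quot_lift fiber_alg_kills.

Lemma to_fiber_alg_linear : linear (to_fiber_alg : int_model n -> fiber_alg).
Proof. by apply: int_linear; exact: (rmorphD to_fiber_alg). Qed.

Lemma to_fiber_alg_surj y : exists x, to_fiber_alg x = y.
Proof.
by have [f <-] := quot_map_surj y; exists (quot_map _ f); rewrite quot_liftE.
Qed.

Lemma to_fiber_alg_ker x : to_fiber_alg x = 0 ->
  exists a (x' : int_model n), a \in prime_int p_pr /\ x = a *: x'.
Proof.
have [f <-] := quot_map_surj x; rewrite quot_liftE => /quot_map_eq0.
rewrite ker_idealE => /eqP /(ker_Fp_split n_gt0 p_pr p_odd)[h hE].
exists p%:Z, (quot_map (int_ideal n) h); rewrite prime_intE dvdzz; split=> //.
rewrite int_scaleE -[LHS]/(quot_map (int_ideal n) f) -pmulrn -rmorphMn.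
by apply/quot_map_eq; rewrite ker_idealE; apply/eqP.
Qed.

Lemma fiber_alg_kills_mu a (y : fiber_alg) : a \in prime_int p_pr -> a *: y = 0.
Proof.
rewrite prime_intE => /dvdzP[q ->]; have [f <-] := quot_map_surj y.
rewrite int_scaleE [q * _]mulrC mulrzA -pmulrn.
rewrite -[X in X *~ _](rmorphMn (quot_map (cone_ideal p n))).
have -> : quot_map (cone_ideal p n) (f *+ p) = 0.
  apply/quot_map_eq0; rewrite ker_idealE -mulr_natl rmorphM rmorph_nat.
  by rewrite -(rmorph_nat (cst 'F_p)) (pcharf0 (pchar_Fp p_pr)) rmorph0 mul0r.
by rewrite mul0rz.
Qed.

Lemma fiber_alg_F_regular : F_regular fiber_alg.
Proof. exact: (cone_F_regular p_pr p_odd n_gt0). Qed.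

End Fibers.

Theorem R_mod_t_F_regular_type : F_regular_type (R_mod_t_proj m n).
Proof.
exists int, (intr : {rmorphism int -> rat}), (int_ideal n); split.
- exact: intr_inj.
- exists 0%N, (fun i => 0) => x; exists x%:MP.
  by rewrite mmapC; exact/esym/intz.
- exact: (int_model_free n_gt0).
- pose K : {rmorphism rat -> R_mod_t m n} := R_mod_t_proj m n \o @mpolyC 5 rat.
  have thetaD : {morph (model_map : int_model n -> R_mod_t m n) : x y / x + y}.
    exact: (rmorphD model_map).
  exists (mk_bilinear (tau_ratl K thetaD) (tau_ratr K (model_map : int_model n -> _))).
  split; last by move=> k; rewrite /= /tau_rat rmorph1 mulr1.
  split.
  + exact: (tensor_rat K thetaD model_map_inj model_map_den).
  + by rewrite /= /tau_rat !rmorph1 mulr1.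
  + by move=> b c b' c'; rewrite /= /tau_rat (rmorphM K) (rmorphM model_map) mulrACA.
exists odd_primes; split.
- by move=> _ [p [p_pr [_ ->]]]; exact: prime_int_maximal.
- exact: odd_primes_dense.
move=> _ [p [p_pr [p_odd ->]]].
pose pi : {linear int_model n -> fiber_alg p} := mk_linear (to_fiber_alg_linear p_pr p_odd).
have kills (a : int) (y : fiber_alg p) : a \in (prime_int p_pr : idealr int) -> a *: y = 0.
  exact: fiber_alg_kills_mu.
exists (fiber_alg p), (mk_bilinear (tau_quotl pi kills) (tau_quotr pi kills)).
split; last exact: fiber_alg_F_regular.
apply: tensor_alg_quotient.
- exact: to_fiber_alg_surj.
- exact: to_fiber_alg_ker.
- exact: (rmorph1 (to_fiber_alg p_pr p_odd)).
- exact: (rmorphM (to_fiber_alg p_pr p_odd)).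
Qed.

End ReductionModT.

Theorem theorem5p3 (m n : nat) (m_gt0 : (0 < m)%N) (n_gt0 : (0 < n)%N)
    (hmn : 2%:R < m%:R - m%:R / n%:R :> rat) :
  ~ F_pure_type (R_proj m n) /\ F_regular_type (R_mod_t_proj m n).
Proof.
split; last exact: R_mod_t_F_regular_type.
apply: R_not_F_pure_type => //.
have n0 : (0 < n%:R :> rat) by rewrite ltr0n.
move: hmn; rewrite -(ltr_pM2r n0) mulrBl mulfVK ?gt_eqF // ltrBrDr.
by rewrite -!natrM -natrD ltr_nat.
Qed.
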